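(* Let $(G,A,\alpha,\sigma)$ be a twisted Banach algebra dynamical system. Then $C_c(G,A,\alpha,\sigma)$ has a contractive approximate identity (cai) with respect to the inductive limit topology. Moreover, such cai is also a cai for $L^1(G,A,\alpha,\sigma)$.
   Context: A cai of a Banach algebra $B$ is a net $(e_\lambda)$ with $\|e_\lambda\|\le1$, $\|e_\lambda b-b\|\to0$, $\|be_\lambda-b\|\to0$ for all $b$. Standing assumptions: the Banach algebra $A$ has a cai and admits an isometric nondegenerate representation $\pi:A\to\mathcal{B}(E)$ (nondegenerate: $\mathrm{span}\{\pi(a)\xi\}$ dense in $E$) on some Banach space $E$. $M(A)$ is the multiplier algebra (double centralizers), containing $A$ isometrically as a closed two-sided ideal. $\mathrm{Aut}(A)$ is the group of isometric automorphisms of $A$ (extended canonically to $M(A)$); $\mathrm{Inv}_1(M(A))$ is the group of invertible $u\in M(A)$ with $\|u\|=\|u^{-1}\|=1$; $\mathrm{Ad}(u)a=uau^{-1}$. A twisted Banach algebra dynamical system $(G,A,\alpha,\sigma)$ consists of a locally compact group $G$, a Banach algebra $A$ that has a cai and admits an isometric nondegenerate representation on some Banach space, and maps $\alpha:G\to\mathrm{Aut}(A)$, $\sigma:G\times G\to\mathrm{Inv}_1(M(A))$ such that: $x\mapsto\alpha_x(a)$ is continuous for each $a\in A$; $(x,y)\mapsto\sigma_{x,y}a$ and $(x,y)\mapsto a\sigma_{x,y}$ are continuous $G\times G\to A$ for each $a\in A$; $\alpha_{1_G}=\mathrm{id}_A$; $\sigma_{1_G,x}=\sigma_{x,1_G}=1_{M(A)}$;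 $\alpha_x\alpha_y=\mathrm{Ad}(\sigma_{x,y})\circ\alpha_{xy}$; $\alpha_z(\sigma_{x,y})\sigma_{z,xy}=\sigma_{z,x}\sigma_{zx,y}$ for all $x,y,z\in G$. $L^1(G,A,\alpha,\sigma)$ is $L^1(G;A)$ (Bochner integrable functions for a left Haar measure $dx$, norm $\|f\|_1=\int_G\|f(x)\|dx$) with product $(f*_{\alpha,\sigma}g)(x)=\int_G f(y)\alpha_y(g(y^{-1}x))\sigma_{y,y^{-1}x}\,dy$. $C_c(G,A,\alpha,\sigma)$ is its dense subalgebra of continuous compactly supported functions $C_c(G,A)$. The inductive limit topology on $C_c(G,A)$ is the largest topology making all inclusions $C_K(G,A)\hookrightarrow C_c(G,A)$ continuous, where $K$ ranges over compact subsets of $G$ and $C_K(G,A)=\{f\in C_c(G,A):\overline{\mathrm{supp}}(f)\subseteq K\}$ has the norm $\|f\|_K=\sup_{x\in K}\|f(x)\|$. A cai for $C_c(G,A,\alpha,\sigma)$ with respect to the inductive limit topology is a net $(f_i)$ in $C_c(G,A)$ with $\|f_i\|_1\le1$ such that $f_i*_{\alpha,\sigma}g\to g$ and $g*_{\alpha,\sigma}f_i\to g$ in the inductive limit topology for every $g\in C_c(G,A)$. *)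

(* Defs.v *)
From HB Require Import structures.
From mathcomp Require Import all_boot all_order all_algebra.
From mathcomp Require Import all_classical all_reals all_analysis.
From mathcomp Require Import complex.

Set Implicit Arguments.
Unset Strict Implicit.
Unset Printing Implicit Defensive.

Import Order.TTheory GRing.Theory Num.Theory.
Import numFieldNormedType.Exports.

Local Open Scope classical_set_scope.
Local Open Scope ring_scope.

(* MathComp's algType is unital; Banach algebras here need not have a unit. *)
HB.mixin Record CompleteNormedModule_isBanachAlgebra (K : numFieldType) A
    of CompleteNormedModule K A := {
  bmul : A -> A -> A;
  bmulA : associative bmul;
  bmulDl : left_distributive bmul +%R;
  bmulDr : right_distributive bmul +%R;
  bmulZl : forall (c : K) (a b : A), bmul (c *: a) b = c *: bmul a b;
  bmulZr : forall (c : K) (a b : A), bmul a (c *: b) = c *: bmul a b;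
  ler_norm_bmul : forall a b : A, `|bmul a b| <= `|a| * `|b| }.

#[short(type="banachAlgType")]
HB.structure Definition BanachAlgebra (K : numFieldType) :=
  {A of CompleteNormedModule K A & CompleteNormedModule_isBanachAlgebra K A}.

Notation "a ** b" := (bmul a b) (at level 40, left associativity) : ring_scope.

(* The base point, which need not be the unit, is required by the library's
   measurable types. *)
HB.mixin Record isTopologicalGroup G of PointedTopological G & Group G := {
  mulg_continuous : continuous (fun p : G * G => (p.1 * p.2)%g);
  invg_continuous : continuous (fun x : G => x^-1%g) }.

#[short(type="topologicalGroupType")]
HB.structure Definition TopologicalGroup :=
  {G of PointedTopological G & Group G & isTopologicalGroup G}.

Record netIndex := NetIndex {
  net_sort :> Type;
  net_le : net_sort -> net_sort -> Prop;
  net_le_refl : forall i, net_le i i;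
  net_le_trans : forall i j k, net_le i j -> net_le j k -> net_le i k;
  net_directed : forall i j, exists k, net_le i k /\ net_le j k;
  net_inhabited : inhabited net_sort }.

Definition tails (I : netIndex) : set_system I :=
  filter_from setT (fun i => [set j | net_le i j]).
Arguments tails : clear implicits.

Section BanachAlgebras.
Variable R : realType.

(* The norm of a normed R[i]-module takes its values in R[i]. *)
Definition rnorm (V : normedModType R[i]) (v : V) : R := complex.Re `|v|.

Definition bounded_op (V W : normedModType R[i]) (T : V -> W) : Prop :=
  exists M : R, forall v, rnorm (T v) <= M * rnorm v.

Definition opnorm (V W : normedModType R[i]) (T : V -> W) : R :=
  sup [set rnorm (T v) | v in [set v | rnorm v <= 1]].

Variable A : banachAlgType R[i].

Definition is_cai (I : netIndex) (e : I -> A) : Prop :=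
  (forall i, `|e i| <= 1) /\
  forall b : A, (e i ** b @[i --> tails I] --> b) /\
                (b ** e i @[i --> tails I] --> b).

Definition has_cai : Prop := exists (I : netIndex) (e : I -> A), is_cai e.

Record isometric_representation (E : completeNormedModType R[i])
    (pi : A -> E -> E) : Prop := {
  rep_op_linear : forall a, linear (pi a);
  rep_op_bounded : forall a, bounded_op (pi a);
  rep_linear : forall xi, linear (pi^~ xi);
  rep_mul : forall a b xi, pi (a ** b) xi = pi a (pi b xi);
  rep_isometric : forall a, opnorm (pi a) = rnorm a }.

Definition nondegenerate (E : completeNormedModType R[i])
    (pi : A -> E -> E) : Prop :=
  dense [set v : E | exists (n : nat) (c : 'I_n -> R[i]) (a : 'I_n -> A)
                       (xi : 'I_n -> E), v = \sum_(i < n) c i *: pi (a i) (xi i)].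

Definition has_isometric_nondegenerate_rep : Prop :=
  exists (E : completeNormedModType R[i]) (pi : A -> E -> E),
    isometric_representation pi /\ nondegenerate pi.

(* A double centralizer m: mulL m a is m a and mulR m a is a m. *)
Record multiplier := Multiplier {
  mulL : A -> A;
  mulR : A -> A;
  mulL_linear : linear mulL;
  mulR_linear : linear mulR;
  mulL_bounded : bounded_op mulL;
  mulR_bounded : bounded_op mulR;
  mulLM : forall a b, mulL (a ** b) = mulL a ** b;
  mulRM : forall a b, mulR (a ** b) = a ** mulR b;
  mulLR : forall a b, a ** mulL b = mulR a ** b }.

Lemma multiplier_ext (m n : multiplier) :
  mulL m =1 mulL n -> mulR m =1 mulR n -> m = n.
Proof.
case: m n => [L S p1 p2 p3 p4 p5 p6 p7] [L' S' q1 q2 q3 q4 q5 q6 q7] /= eL eS.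
move/funext: eL => eL; move/funext: eS => eS; subst L' S'.
by congr Multiplier; exact: Prop_irrelevance.
Qed.

Definition mnorm (m : multiplier) : R :=
  Num.max (opnorm (mulL m)) (opnorm (mulR m)).

Lemma linear_comp (V W X : lmodType R[i]) (S : W -> X) (T : V -> W) :
  linear S -> linear T -> linear (S \o T).
Proof. by move=> lS lT c u v /=; rewrite lT lS. Qed.

Lemma rnorm_ge0 (V : normedModType R[i]) (v : V) : 0 <= rnorm v.
Proof. by have := normr_ge0 v; rewrite /rnorm lecE => /andP[]. Qed.

Lemma bounded_op_comp (V W X : normedModType R[i]) (S : W -> X) (T : V -> W) :
  bounded_op S -> bounded_op T -> bounded_op (S \o T).
Proof.
move=> [M hM] [N hN]; exists (`|M| * N) => v /=; rewrite -mulrA.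
apply: (le_trans (hM _)); apply: (@le_trans _ _ (`|M| * rnorm (T v))).
  by rewrite ler_wpM2r ?rnorm_ge0 ?ler_norm.
by rewrite ler_wpM2l ?normr_ge0.
Qed.

Lemma bounded_op_isometry (V W : normedModType R[i]) (T : V -> W) :
  (forall v, `|T v| = `|v|) -> bounded_op T.
Proof. by move=> hT; exists 1 => v; rewrite /rnorm hT mul1r. Qed.

Definition mone : multiplier.
Proof.
by apply: (@Multiplier id id) => //; exact: bounded_op_isometry.
Defined.

Definition mmul (m n : multiplier) : multiplier.
Proof.
apply: (@Multiplier (mulL m \o mulL n) (mulR n \o mulR m)).
- exact: linear_comp (mulL_linear m) (mulL_linear n).
- exact: linear_comp (mulR_linear n) (mulR_linear m).
- exact: bounded_op_comp (mulL_bounded m) (mulL_bounded n).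
- exact: bounded_op_comp (mulR_bounded n) (mulR_bounded m).
- by move=> a b /=; rewrite !mulLM.
- by move=> a b /=; rewrite !mulRM.
- by move=> a b /=; rewrite mulLR mulLR.
Defined.

Record isomAut := IsomAut {
  aut :> A -> A;
  aut_inv : A -> A;
  autK : cancel aut aut_inv;
  aut_invK : cancel aut_inv aut;
  aut_linear : linear aut;
  autM : forall a b, aut (a ** b) = aut a ** aut b;
  aut_isometric : forall a, `|aut a| = `|a| }.

Lemma aut_inv_linear (phi : isomAut) : linear (aut_inv phi).
Proof.
by move=> c a b; apply: (can_inj (autK phi)); rewrite aut_linear !aut_invK.
Qed.

Lemma aut_invM (phi : isomAut) a b :
  aut_inv phi (a ** b) = aut_inv phi a ** aut_inv phi b.
Proof. by apply: (can_inj (autK phi)); rewrite autM !aut_invK. Qed.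

Lemma aut_inv_isometric (phi : isomAut) a : `|aut_inv phi a| = `|a|.
Proof. by rewrite -{2}(aut_invK phi a) aut_isometric. Qed.

(* The canonical extension of an automorphism to the multiplier algebra. *)
Definition aut_ext (phi : isomAut) (m : multiplier) : multiplier.
Proof.
have lin T : linear T -> linear (phi \o T \o aut_inv phi).
  move=> lT; apply: linear_comp (aut_inv_linear phi).
  exact: linear_comp (@aut_linear phi) lT.
have bnd T : bounded_op T -> bounded_op (phi \o T \o aut_inv phi).
  move=> bT; apply: bounded_op_comp.
    apply: bounded_op_comp bT; apply: bounded_op_isometry.
    exact: aut_isometric.
  by apply: bounded_op_isometry; exact: aut_inv_isometric.
apply: (@Multiplier (phi \o mulL m \o aut_inv phi)
                    (phi \o mulR m \o aut_inv phi)).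
- exact: lin (mulL_linear m).
- exact: lin (mulR_linear m).
- exact: bnd (mulL_bounded m).
- exact: bnd (mulR_bounded m).
- by move=> a b /=; rewrite aut_invM mulLM autM aut_invK.
- by move=> a b /=; rewrite aut_invM mulRM autM aut_invK.
- move=> a b /=; rewrite -[X in X ** _](aut_invK phi).
  by rewrite -[X in _ = _ ** X](aut_invK phi) -!autM mulLR.
Defined.

Record inv1 := Inv1 {
  inv1_val :> multiplier;
  inv1_inv : multiplier;
  inv1_mulV : mmul inv1_val inv1_inv = mone;
  inv1_Vmul : mmul inv1_inv inv1_val = mone;
  inv1_norm : mnorm inv1_val = 1;
  inv1_normV : mnorm inv1_inv = 1 }.

Definition Ad (u : inv1) (a : A) : A := mulL u (mulR (inv1_inv u) a).

End BanachAlgebras.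

Record twistedSystem (R : realType) (G : topologicalGroupType)
    (A : banachAlgType R[i]) := TwistedSystem {
  tw_hausdorff : hausdorff_space G;
  tw_locally_compact : locally_compact [set: G];
  tw_cai : has_cai A;
  tw_rep : has_isometric_nondegenerate_rep A;
  alpha : G -> isomAut A;
  sigma : G -> G -> inv1 A;
  alpha_continuous : forall a, continuous (fun x => alpha x a);
  sigmaL_continuous : forall a,
    continuous (fun p : G * G => mulL (sigma p.1 p.2) a);
  sigmaR_continuous : forall a,
    continuous (fun p : G * G => mulR (sigma p.1 p.2) a);
  alpha1 : forall a, alpha 1%g a = a;
  sigma1x : forall x, sigma 1%g x = mone A :> multiplier A;
  sigmax1 : forall x, sigma x 1%g = mone A :> multiplier A;
  alphaM : forall x y a,
    alpha x (alpha y a) = Ad (sigma x y) (alpha (x * y)%g a);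
  sigma_cocycle : forall x y z,
    mmul (aut_ext (alpha z) (sigma x y)) (sigma z (x * y)%g) =
    mmul (sigma z x) (sigma (z * x)%g y) }.

Section Bochner.
Context (R : realType) d (T : measurableType d) (V : completeNormedModType R[i])
  (mu : {measure set T -> \bar R}).

Record intSimple := IntSimple {
  simple_size : nat;
  simple_set : 'I_simple_size -> set T;
  simple_val : 'I_simple_size -> V;
  simple_measurable : forall i, measurable (simple_set i);
  simple_finite : forall i, (mu (simple_set i) < +oo)%E }.

Definition simple_fun (s : intSimple) (x : T) : V :=
  \sum_(i < simple_size s) (\1_(simple_set i) x : R[i]) *: simple_val i.

Definition simple_int (s : intSimple) : V :=
  \sum_(i < simple_size s) ((fine (mu (simple_set i)))%:C)%C *: simple_val i.

(* f need only be measurable for the completion of mu. The library's integral of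
   a nonnegative function is a supremum over simple functions below it, so it is
   unaffected by changing f on a null set. *)
Definition bochner_approx (f : T -> V) (s : nat -> intSimple) : Prop :=
  {ae mu, forall x, simple_fun (s n) x @[n --> \oo] --> f x} /\
  (\int[mu]_x (rnorm (f x - simple_fun (s n) x))%:E)%E @[n --> \oo] --> 0%E.

Definition bochner_integrable (f : T -> V) : Prop :=
  exists s, bochner_approx f s.

(* The Bochner integral, with the value 0 if f is not Bochner integrable. *)
Definition bochner_int (f : T -> V) : V :=
  xget 0 [set v | exists2 s, bochner_approx f s &
                             simple_int (s n) @[n --> \oo] --> v].

Definition L1norm (f : T -> V) : \bar R := (\int[mu]_x (rnorm (f x))%:E)%E.

Definition cvg_L1 (I : netIndex) (u : I -> T -> V) (f : T -> V) : Prop :=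
  (forall i, bochner_integrable (u i)) /\
  L1norm (u i \- f) @[i --> tails I] --> 0%E.

End Bochner.

Definition borel (G : ptopologicalType) := g_sigma_algebraType (@open G).
HB.instance Definition _ (G : ptopologicalType) := Measurable.on (borel G).

Record left_haar (R : realType) (G : topologicalGroupType)
    (mu : {measure set (borel G) -> \bar R}) : Prop := {
  haar_neq0 : mu setT <> 0%E;
  haar_left_invariant : forall (x : G) (B : set (borel G)), measurable B ->
    mu [set (x * y)%g | y in (B : set G)] = mu B;
  haar_compact : forall K : set G, compact K -> (mu K < +oo)%E;
  haar_outer : forall B : set (borel G), measurable B ->
    mu B = ereal_inf [set mu U | U in [set U : set G | open U /\ B `<=` U]];
  haar_inner : forall U : set G, open U ->
    mu U = ereal_sup [set mu K | K in [set K : set G | compact K /\ K `<=` U]] }.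

Section Cc.
Context (R : realType) (G : topologicalGroupType) (A : banachAlgType R[i]).

Record Cc := MkCc {
  Cc_fun :> G -> A;
  Cc_continuous : continuous Cc_fun;
  Cc_compact : compact (closure [set x | Cc_fun x != 0]) }.

HB.instance Definition _ := gen_eqMixin Cc.
HB.instance Definition _ := gen_choiceMixin Cc.

Definition CK (K : set G) : set Cc := [set f | closure [set x | f x != 0] `<=` K].

Definition normK (K : set G) (f : G -> A) : R := sup [set rnorm (f x) | x in K].

(* The largest topology making the inclusions of the normed spaces CK K
   continuous: U is open iff its trace on each CK K is open. *)
Definition ilimit_open (U : set Cc) : Prop :=
  forall K, compact K -> forall f, CK K f -> U f ->
    exists2 eps : R, 0 < eps &
      forall h, CK K h -> normK K (h \- f) < eps -> U h.

Let ilimit_openT : ilimit_open setT.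
Proof. by move=> K _ f _ _; exists 1. Qed.

Let ilimit_openI : setI_closed ilimit_open.
Proof.
move=> U V oU oV K cK f Kf [Uf Vf].
have [e e0 he] := oU K cK f Kf Uf; have [e' e'0 he'] := oV K cK f Kf Vf.
exists (Num.min e e'); first by rewrite lt_min e0 e'0.
by move=> h Kh; rewrite lt_min => /andP[he1 he2]; split; [exact: he|exact: he'].
Qed.

Let ilimit_open_bigU (I : Type) (f : I -> set Cc) :
  (forall i, ilimit_open (f i)) -> ilimit_open (\bigcup_i f i).
Proof.
move=> of_ K cK g Kg [i _ fig]; have [e e0 he] := of_ i K cK g Kg fig.
by exists e => // h Kh hh; exists i => //; exact: he.
Qed.

HB.instance Definition _ := isOpenTopological.Build Cc
  ilimit_openT ilimit_openI ilimit_open_bigU.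

End Cc.
Arguments Cc {R} G A.

Section TwistedConvolution.
Context (R : realType) (G : topologicalGroupType) (A : banachAlgType R[i])
  (S : twistedSystem G A) (mu : {measure set (borel G) -> \bar R}).

(* The integrand is f(y) alpha_y(g(y^-1 x)) sigma_{y, y^-1 x}. *)
Definition tconv (f g : G -> A) (x : G) : A :=
  bochner_int mu (fun y : borel G =>
    mulR (sigma S y (y^-1 * x)%g) (f y ** alpha S y (g (y^-1 * x)%g))).

(* Convergence in Cc G A of a net of functions includes membership in it. *)
Definition cvg_Cc (I : netIndex) (u : I -> G -> A) (g : Cc G A) : Prop :=
  exists2 h : I -> Cc G A, (forall i, h i =1 u i) & h i @[i --> tails I] --> g.

Definition is_cai_Cc (I : netIndex) (f : I -> Cc G A) : Prop :=
  (forall i, (L1norm mu (f i) <= 1)%E) /\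
  forall g : Cc G A, cvg_Cc (fun i => tconv (f i) g) g /\
                     cvg_Cc (fun i => tconv g (f i)) g.

Definition is_cai_L1 (I : netIndex) (f : I -> G -> A) : Prop :=
  (forall i, bochner_integrable mu (f i)) /\
  (forall i, (L1norm mu (f i) <= 1)%E) /\
  forall g : G -> A, bochner_integrable mu g ->
    cvg_L1 mu (fun i => tconv (f i) g) g /\
    cvg_L1 mu (fun i => tconv g (f i)) g.

End TwistedConvolution.

(* Main.v *)
(* For the existence part, take [f_(V, j) = phi_V e_j], where [e] is a cai of [A]
   and [phi_V >= 0] is a continuous function supported near 1 in [V] with integral 1
   and [phi_V z^-1 = phi_V z]. By this symmetry [y |-> phi_V (y^-1 * x)] also has
   integral 1, so no modular function is needed. Both convolutions with [g] are then
   averages over [V] of values that are uniformly close to [g x]: the twisted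
   translates of [g] are jointly continuous, and [e] acts almost as the identity
   uniformly on the compact sets [g x] and [alpha_y^-1 (g x)].

   For the second part, convergence in the inductive limit topology implies
   convergence in L1 norm. An integrable [g] is the limit, a.e. and fast in L1, of
   [phi_n] in [Cc]; Young's inequality on [Cc] makes [f_i * phi_n] Cauchy in L1
   uniformly in [i], and Fatou's lemma transfers the estimates to [f_i * g]. *)

Require Import Defs.
From mathcomp Require Import all_boot all_order all_algebra finmap.
From mathcomp Require Import all_classical all_reals all_analysis.
From mathcomp Require Import complex measurable_realfun lra.

Set Implicit Arguments.
Unset Strict Implicit.
Unset Printing Implicit Defensive.

Import Order.TTheory GRing.Theory Num.Theory.
Import numFieldNormedType.Exports.

Local Open Scope classical_set_scope.
Local Open Scope ring_scope.

(** * The real-valued norm and lower integrals *)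

(** The integral of a nonnegative function is a supremum over simple functions below it: it is
    monotone for arbitrary functions, but its additivity rests on measurability. Hence pointwise
    bounds pass to integrals directly, whereas each triangle inequality, Fatou argument or exchange
    of integrals first replaces the functions by measurable ones, a.e. equal to them or majorants.

    The convolution of [f_i] with an integrable [g] is a Bochner integral, which is 0 by default if
    the integrand is not integrable. Integrability of the integrand in [y], and of the convolution
    in [x], come from one source: a sequence in [Cc] with summable L1 increments and an a.e. limit.
    Joint measurability in [(x, y)] is replaced by continuity on [Cc] and by Riemann sums over
    finite Borel partitions of compact sets.

    In [f_i * g] the function [g] is evaluated at [y^-1 x], so null sets have to stay null under
    inversion, at least within compact sets; regularity of the Haar measure and compactly supported
    bumps yield this. *)

Lemma ge0_Re (R : rcfType) (z : R[i]) : 0 <= z -> (complex.Re z)%:C%C = z.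
Proof. by rewrite lecE => /andP[/eqP z0 _]; rewrite [RHS]complexE z0 mulr0 addr0. Qed.

Section RealNorm.
Context (R : realType) (V : normedModType R[i]).
Implicit Types u v w : V.

Lemma rnormE v : `|v| = (rnorm v)%:C%C.
Proof.
by rewrite [RHS]ge0_Re.
Qed.

Lemma rnorm0 : rnorm (0 : V) = 0.
Proof. by rewrite /rnorm normr0. Qed.

Lemma rnormN v : rnorm (- v) = rnorm v.
Proof. by rewrite /rnorm normrN. Qed.

Lemma rnormC u v : rnorm (u - v) = rnorm (v - u).
Proof. by rewrite -rnormN opprB. Qed.

Lemma rnorm_eq0 v : (rnorm v == 0) = (v == 0).
Proof. by rewrite -(normr_eq0 v) rnormE (inj_eq (@complexI R)). Qed.

Lemma ler_rnormD u v : rnorm (u + v) <= rnorm u + rnorm v.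
Proof. by rewrite -lecR rmorphD /= -!rnormE ler_normD. Qed.

Lemma ler_rnorm_dist w u v : rnorm (u - v) <= rnorm (u - w) + rnorm (w - v).
Proof. by rewrite (le_trans _ (ler_rnormD _ _))// addrA subrK. Qed.

Lemma rnormZ (c : R[i]) v : rnorm (c *: v) = complex.Re `|c| * rnorm v.
Proof.
by rewrite /rnorm normrZ rnormE normc_def -rmorphM.
Qed.

Lemma rnormZr (r : R) v : rnorm (r%:C%C *: v) = `|r| * rnorm v.
Proof. by rewrite rnormZ normc_def /= expr0n /= addr0 sqrtr_sqr. Qed.

Lemma ler_dist_rnorm u v : `|rnorm u - rnorm v| <= rnorm (u - v).
Proof.
have h (a b : V) : rnorm a - rnorm b <= rnorm (a - b).
  by rewrite lerBlDr (le_trans _ (ler_rnormD _ _))// subrK.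
by rewrite ler_norml h andbT lerNl opprB rnormC h.
Qed.

Lemma rnorm_cvgP (T : Type) (F : set_system T) (FF : Filter F) (f : T -> V) v :
  f @ F --> v <-> forall e : R, 0 < e -> \forall x \near F, rnorm (v - f x) < e.
Proof.
split=> [/cvgrPdist_lt h e e0|h].
  have := h e%:C%C; rewrite ltcR => /(_ e0); apply: filterS => x.
  by rewrite rnormE ltcR.
apply/cvgrPdist_lt => e e0.
have er : e = (complex.Re e)%:C%C.
  by rewrite ge0_Re// ltW.
by move: e0; rewrite er ltcR => /h; apply: filterS => x; rewrite rnormE ltcR.
Qed.

Lemma rnorm_cvg0P (T : Type) (F : set_system T) (FF : Filter F) (f : T -> V) v :
  f @ F --> v <-> rnorm (f x - v) @[x --> F] --> (0 : R).
Proof.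
rewrite rnorm_cvgP; split=> [h|/cvgrPdist_lt h].
  apply/cvgrPdist_lt => e /h; apply: filterS => x.
  by rewrite sub0r normrN ger0_norm ?rnorm_ge0// rnormC.
move=> e /h; apply: filterS => x.
by rewrite sub0r normrN ger0_norm ?rnorm_ge0// rnormC.
Qed.

Lemma rnorm_nbhsP v (P : set V) :
  nbhs v P <-> exists2 e : R, 0 < e & forall u, rnorm (v - u) < e -> P u.
Proof.
split.
  move=> /nbhs_ballP[e /= e0 h]; have er : e = (complex.Re e)%:C%C.
    by rewrite ge0_Re// ltW.
  exists (complex.Re e); first by rewrite -ltcR -er.
  by move=> u hu; apply: h; rewrite -ball_normE /= rnormE er ltcR.
move=> [e e0 h]; apply/nbhs_ballP; exists e%:C%C; first by rewrite /= ltcR.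
by move=> u; rewrite -ball_normE /= rnormE ltcR => /h.
Qed.

Lemma rnorm_continuous : continuous (@rnorm R V).
Proof.
move=> v; apply/cvgrPdist_lt => e e0; apply/rnorm_nbhsP; exists e => // u.
exact/le_lt_trans/ler_dist_rnorm.
Qed.

Lemma rnorm_sum_le I (r : seq I) (P : pred I) (f : I -> V) :
  rnorm (\sum_(i <- r | P i) f i) <= \sum_(i <- r | P i) rnorm (f i).
Proof.
elim/big_ind2 : _ => [|u r1 v r2 h1 h2|//]; first by rewrite rnorm0.
by rewrite (le_trans (ler_rnormD _ _))// lerD.
Qed.

End RealNorm.

Section LowerIntegral.
Context d (T : measurableType d) (R : realType)
  (mu : {measure set T -> \bar R}).
Local Open Scope ereal_scope.
Implicit Types f g : T -> \bar R.
Import HBNNSimple.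

(** Holds for arbitrary functions: a simple function below [f] is also below [g]. *)
Lemma le_lower_integral f g : (forall x, 0 <= f x) -> (forall x, f x <= g x) ->
  \int[mu]_x f x <= \int[mu]_x g x.
Proof.
move=> f0 fg; have g0 x : 0 <= g x by exact: le_trans (fg x).
rewrite !ge0_integralTE//; apply: le_ereal_sup => _ /= [h hf <-].
by exists h => // x; exact: le_trans (fg x).
Qed.

(** A simple function below [f] is a.e. below the measurable [g], so the a.e. comparison of
    measurable functions applies to it; then the supremum is taken. *)
Lemma ae_le_lower_integral f g : (forall x, 0 <= f x) -> (forall x, 0 <= g x) ->
  measurable_fun setT g -> {ae mu, forall x, f x <= g x} ->
  \int[mu]_x f x <= \int[mu]_x g x.
Proof.
move=> f0 g0 mg fg; rewrite [leLHS]ge0_integralTE//.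
apply: ge_ereal_sup => _ /= [h hf <-]; rewrite -integralT_nnsfun.
apply: ae_ge0_le_integral => //.
- by move=> x _; rewrite lee_fin.
- exact/measurable_EFinP/measurable_funP.
- by apply: filterS fg => x fgx _; exact: le_trans (hf x) fgx.
Qed.

Lemma ae_eq_lower_integral f g : (forall x, 0 <= f x) -> (forall x, 0 <= g x) ->
  measurable_fun setT g -> {ae mu, forall x, f x = g x} ->
  \int[mu]_x f x = \int[mu]_x g x.
Proof.
move=> f0 g0 mg fg; apply/eqP; rewrite eq_le; apply/andP; split.
  by apply: ae_le_lower_integral => //; apply: filterS fg => x ->.
case: fg => N [mN N0 hN].
(* Measurability of [g] lets its integral drop the null set [N]; the function cut off in this way is
   below [f] everywhere. *)
rewrite (ge0_negligible_integral mN)// integral_mkcond.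
apply: le_lower_integral => [x|x]; rewrite patchE; case: ifPn => //.
by rewrite inE /= => -[_ Nx]; rewrite leNgt; apply/negP => lt; apply/Nx/hN => /= E;
  rewrite E ltxx in lt.
Qed.

End LowerIntegral.

(** * The Bochner integral *)

Section SimpleFunctions.
Context (R : realType) d (T : measurableType d) (V : completeNormedModType R[i])
  (mu : {measure set T -> \bar R}).
Implicit Types s t : intSimple V mu.

(** Any [Phi] is allowed because its argument takes finitely many values. The vector [w] varies so
    that the first set can be split off: on it, its vector is absorbed into [w]. *)
Lemma measurable_comp_simple (Phi : V -> R) n (E : 'I_n -> set T) (v : 'I_n -> V) w :
  (forall i, measurable (E i)) ->
  measurable_fun setT (fun x => Phi (w + \sum_(i < n) (\1_(E i) x : R[i]) *: v i)).
Proof.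
elim: n E v w => [|n IH] E v w mE.
  by under eq_fun do rewrite big_ord0; exact: measurable_cst.
have -> : (fun x => Phi (w + \sum_(i < n.+1) (\1_(E i) x : R[i]) *: v i)) =
    (fun x => if x \in E ord0
      then Phi (w + v ord0 + \sum_(i < n) (\1_(E (lift ord0 i)) x : R[i]) *: v (lift ord0 i))
      else Phi (w + \sum_(i < n) (\1_(E (lift ord0 i)) x : R[i]) *: v (lift ord0 i))).
  apply/funext => x; rewrite big_ord_recl indicE; case: ifPn => _.
    by rewrite scale1r addrA.
  by rewrite scale0r add0r.
apply: measurable_fun_ifT; [|exact: IH|exact: IH].
by apply: (measurable_fun_bool true); rewrite setTI preimage_mem_true.
Qed.

Lemma measurable_rnorm_simple s w :
  measurable_fun setT (fun x => (rnorm (simple_fun s x - w))%:E).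
Proof.
apply/measurable_EFinP.
under eq_fun do rewrite addrC.
by apply: (@measurable_comp_simple (@rnorm R V)) => i; exact: simple_measurable.
Qed.

(* Letting [w] and [D] vary makes the induction work: split [D] along the first
   set, absorbing its vector into [w] on one piece. *)
Lemma le_rnorm_integral n (E : 'I_n -> set T) (v : 'I_n -> V) w (D : set T) :
  (forall i, measurable (E i)) -> measurable D -> (mu D < +oo)%E ->
  ((rnorm ((fine (mu D))%:C%C *: w +
           \sum_(i < n) (fine (mu (E i `&` D)))%:C%C *: v i))%:E <=
   \int[mu]_(x in D) (rnorm (w + \sum_(i < n) (\1_(E i) x : R[i]) *: v i))%:E)%E.
Proof.
elim: n E v w D => [|n IH] E v w D mE mD fD.
  rewrite big_ord0 addr0; under eq_integral do rewrite big_ord0 addr0.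
  rewrite integral_cst// rnormZr ger0_norm ?fine_ge0//.
  by rewrite -[X in (_ * X)%E]fineK ?ge0_fin_numE// -EFinM mulrC.
set E0 := E ord0; pose E' (i : 'I_n) := E (lift ord0 i).
pose v' (i : 'I_n) := v (lift ord0 i).
have mE' i : measurable (E' i) by exact: mE.
have mA : measurable (D `&` E0) by exact: measurableI (mE _).
have mB : measurable (D `\` E0) by exact: measurableD (mE _).
have fA : (mu (D `&` E0) < +oo)%E.
  by rewrite (le_lt_trans _ fD)// le_measure ?inE//; exact: subIsetl.
have fB : (mu (D `\` E0) < +oo)%E.
  by rewrite (le_lt_trans _ fD)// le_measure ?inE//; exact: subDsetl.
have add (B : set T) : measurable B -> measurable (B `&` (D `&` E0)) ->
    fine (mu (B `&` D)) = fine (mu (B `&` (D `&` E0))) + fine (mu (B `&` (D `\` E0))).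
  move=> mB1 mB2; rewrite -fineD; last 2 first.
  - rewrite ge0_fin_numE// (le_lt_trans _ fA)// le_measure ?inE//; exact: subIsetr.
  - rewrite ge0_fin_numE// (le_lt_trans _ fB)// le_measure ?inE//;
      first [exact: subIsetr|exact: measurableI].
  rewrite -measureU//; last 2 first.
  - exact: measurableI.
  - by rewrite -subset0 => x [[_ [_ h]] [_ [_ /(_ h)]]].
  congr (fine (mu _)); rewrite -setIUr; congr (_ `&` _).
  by rewrite setUIDK.
have -> : (fine (mu D))%:C%C *: w +
    \sum_(i < n.+1) (fine (mu (E i `&` D)))%:C%C *: v i =
    ((fine (mu (D `&` E0)))%:C%C *: (w + v ord0) +
      \sum_(i < n) (fine (mu (E' i `&` (D `&` E0))))%:C%C *: v' i) +
    ((fine (mu (D `\` E0)))%:C%C *: w +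
      \sum_(i < n) (fine (mu (E' i `&` (D `\` E0))))%:C%C *: v' i).
  have -> : fine (mu D) = fine (mu (D `&` E0)) + fine (mu (D `\` E0)).
    by have := add setT measurableT; rewrite !setTI; exact.
  rewrite big_ord_recl -/E0 (setIC E0) !scalerDr !rmorphD /= !scalerDl.
  rewrite (eq_bigr (fun i => (fine (mu (E' i `&` (D `&` E0))))%:C%C *: v' i +
     (fine (mu (E' i `&` (D `\` E0))))%:C%C *: v' i)); last first.
    by move=> i _; rewrite add// ?rmorphD ?scalerDl//; exact: measurableI.
  rewrite big_split /= -!addrA; congr (_ + _).
  by rewrite [LHS]addrCA; congr (_ + _); rewrite [LHS]addrCA.
have mF (B : set T) : measurable_fun B
    (fun x => (rnorm (w + \sum_(i < n.+1) (\1_(E i) x : R[i]) *: v i))%:E).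
  apply: (@measurable_funS _ _ _ _ setT) => //; apply/measurable_EFinP.
  exact: (@measurable_comp_simple (@rnorm R V)).
rewrite -[X in (_ <= \int[mu]_(x in X) _)%E](setUIDK D E0) ge0_integral_setU//; last 2 first.
- by move=> x _; rewrite lee_fin rnorm_ge0.
- by apply/disj_setPRL => x /= [_ h] [].
apply: (@le_trans _ _ (_%:E + _%:E)%E); first by rewrite -EFinD lee_fin; exact: ler_rnormD.
apply: leeD.
- apply: (le_trans (IH E' v' (w + v ord0) _ mE' mA fA)).
  rewrite le_eqVlt; apply/orP; left; apply/eqP; apply: eq_integral => x; rewrite inE => -[_ E0x].
  by rewrite big_ord_recl indicE mem_set// scale1r addrA.
- apply: (le_trans (IH E' v' w _ mE' mB fB)).
  rewrite le_eqVlt; apply/orP; left; apply/eqP; apply: eq_integral => x; rewrite inE => -[_ E0x].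
  by rewrite big_ord_recl indicE memNset// scale0r add0r.
Qed.

Lemma le_simple_int s : ((rnorm (simple_int s))%:E <= L1norm mu (simple_fun s))%E.
Proof.
(* The union of all the sets has finite measure and contains each of them, so [le_rnorm_integral]
   with [w = 0] sees their full measures. *)
pose D := \big[setU/set0]_(i < simple_size s) simple_set i.
have [mD fD] : measurable D /\ (mu D < +oo)%E.
  rewrite /D; elim/big_rec : _ => [|i X _ [mX fX]]; first by rewrite measure0.
  have mi := simple_measurable i; split; first exact: measurableU.
  by rewrite (le_lt_trans (measureU2 mu mi mX))// lte_add_pinfty// simple_finite.
have subD (i : 'I_(simple_size s)) : simple_set i `<=` D.
  by move=> x xi; rewrite /D -bigcup_seq; exists i => //=; rewrite mem_index_enum.
have := @le_rnorm_integral _ (@simple_set _ _ _ _ _ s) (@simple_val _ _ _ _ _ s) 0 D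
  (@simple_measurable _ _ _ _ _ s) mD fD.
rewrite scaler0 add0r.
under eq_bigr do rewrite setIidl//.
move=> /le_trans; apply; rewrite /L1norm.
under eq_integral do rewrite add0r.
apply: ge0_subset_integral => //.
- by have := measurable_rnorm_simple s 0; under eq_fun do rewrite subr0.
- by move=> x _; rewrite lee_fin rnorm_ge0.
Qed.

Lemma L1norm_simple_fin s : (L1norm mu (simple_fun s) < +oo)%E.
Proof.
apply: (@le_lt_trans _ _ (\int[mu]_x (\sum_(i < simple_size s)
    ((rnorm (simple_val i))%:E * (\1_(simple_set i) x)%:E)))%E).
  apply: le_lower_integral => x; first by rewrite lee_fin rnorm_ge0.
  under [leRHS]eq_bigr do rewrite -EFinM.
  rewrite sumEFin lee_fin /simple_fun (le_trans (rnorm_sum_le _ _ _))//.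
  apply: ler_sum => i _; rewrite rnormZ mulrC ler_wpM2l ?rnorm_ge0//.
  by rewrite !indicE; case: (_ \in _); rewrite /= ?expr1n expr0n /= ?addr0 ?sqrtr1 ?sqrtr0.
rewrite ge0_integral_sum//; last 2 first.
- move=> i; apply/measurable_EFinP; apply: measurable_funM => //.
  exact/measurable_indic/simple_measurable.
- by move=> i x _; rewrite mule_ge0// lee_fin ?rnorm_ge0.
apply: lte_sum_pinfty => i _.
rewrite ge0_integralZl_EFin ?rnorm_ge0//; last first.
  exact/measurable_EFinP/measurable_indic/simple_measurable.
rewrite integral_indic ?setIT//; last exact: simple_measurable.
by rewrite lte_mul_pinfty ?lee_fin ?rnorm_ge0//; exact: simple_finite.
Qed.

(** The sets of an [intSimple] may overlap, so a difference is formed by concatenating the two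
    families; function and integral are then handled by splitting a finite sum. *)
Definition simple_sub s t : intSimple V mu.
Proof.
pose P (i : 'I_(simple_size s + simple_size t)) := match fintype.split i with
  | inl j => simple_set j | inr k => simple_set k end.
refine (@IntSimple _ _ _ V mu (simple_size s + simple_size t) P
  (fun i => match fintype.split i with
    inl j => simple_val j | inr k => - simple_val k end) _ _).
- by move=> i; rewrite /P; case: (fintype.split i) => j; exact: simple_measurable.
- by move=> i; rewrite /P; case: (fintype.split i) => j; exact: simple_finite.
Defined.

Lemma simple_fun_sub s t x :
  simple_fun (simple_sub s t) x = simple_fun s x - simple_fun t x.
Proof.
rewrite /simple_fun /= big_split_ord /= -sumrN; congr (_ + _);
  apply: eq_bigr => i _.
  by rewrite (unsplitK (inl i)).
by rewrite (unsplitK (inr i)) scalerN.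
Qed.

Lemma simple_int_sub s t :
  simple_int (simple_sub s t) = simple_int s - simple_int t.
Proof.
rewrite /simple_int /= big_split_ord /= -sumrN; congr (_ + _);
  apply: eq_bigr => i _.
  by rewrite (unsplitK (inl i)).
by rewrite (unsplitK (inr i)) scalerN.
Qed.

Lemma le_simple_int_sub s t : ((rnorm (simple_int s - simple_int t))%:E <=
  L1norm mu (simple_fun s \- simple_fun t)%R)%E.
Proof.
rewrite -simple_int_sub (le_trans (le_simple_int _))//.
rewrite le_eqVlt; apply/orP; left; apply/eqP; rewrite /L1norm.
by apply: eq_integral => x _; rewrite simple_fun_sub.
Qed.

Definition simple0 : intSimple V mu.
Proof.
by refine (@IntSimple _ _ _ V mu 0 (fun=> set0) (fun=> 0) _ _) => -[].
Defined.

Lemma simple_fun0 x : simple_fun simple0 x = 0.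
Proof. by rewrite /simple_fun big_ord0. Qed.

Lemma simple_int0 : simple_int simple0 = 0.
Proof. by rewrite /simple_int big_ord0. Qed.

End SimpleFunctions.

Lemma ecvg0P (R : realType) (I : Type) (F : set_system I) (FF : Filter F)
    (u : I -> \bar R) : (forall x, 0 <= u x)%E ->
  u x @[x --> F] --> 0%E <->
  forall e : R, 0 < e -> \forall x \near F, (u x < e%:E)%E.
Proof.
move=> u0; split=> [h e e0|h].
  by apply: (h [set y | (y < e%:E)%E]); apply: open_nbhs_nbhs; split;
    [exact: open_ereal_lt_ereal|rewrite /= lte_fin].
apply/fine_cvgP; split.
  by apply: filterS (h 1 ltr01) => x ux; rewrite ge0_fin_numE// (lt_trans ux)// ltry.
apply/cvgrPdist_lt => e e0; apply: filterS (h e e0) => x ux.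
rewrite sub0r normrN ger0_norm ?fine_ge0//.
by rewrite -lte_fin fineK// ge0_fin_numE// (lt_trans ux)// ltry.
Qed.

Lemma rnorm_cauchy_cvg (R : realType) (V : completeNormedModType R[i])
    (u : nat -> V) :
  (forall e : R, 0 < e -> exists N, forall m n, (N <= m)%N -> (N <= n)%N ->
     rnorm (u m - u n) < e) ->
  cvg (u n @[n --> \oo]).
Proof.
move=> h; apply: cauchy_cvg; apply/cauchy_ballP => e e0.
have er : (complex.Re e)%:C%C = e by rewrite ge0_Re// ltW.
have [|N hN] := h (complex.Re e); first by rewrite -ltcR er.
exists ([set x | exists2 n, (N <= n)%N & x = u n], [set x | exists2 n, (N <= n)%N & x = u n]) => /=.
  by split; exists N => // n /= Nn; exists n.
move=> [x y] /= [[m Nm ->] [n Nn ->]].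
by rewrite -ball_normE /= rnormE -er ltcR hN.
Qed.

Section BochnerTheory.
Context (R : realType) d (T : measurableType d) (V : completeNormedModType R[i])
  (mu : {measure set T -> \bar R}).
Implicit Types (s t : intSimple V mu) (f g h : T -> V).

(** Strong measurability for the completion of [mu]. It gives the norm a measurable representative,
    on which the triangle inequality and Fatou's lemma for [L1norm] rest. *)
Definition smeasurable f := exists s : nat -> intSimple V mu,
  {ae mu, forall x, simple_fun (s n) x @[n --> \oo] --> f x}.

Lemma smeasurable_simple t : smeasurable (simple_fun t).
Proof. by exists (fun=> t); apply: aeW => x; exact: cvg_cst. Qed.

Lemma smeasurableB f g : smeasurable f -> smeasurable g -> smeasurable (f \- g).
Proof.
move=> [s sf] [t tg]; exists (fun n => simple_sub (s n) (t n)).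
apply: filterS2 sf tg => x sfx tgx.
under eq_fun do rewrite simple_fun_sub.
exact: cvgB.
Qed.

Lemma bochner_approx_smeasurable f (s : nat -> intSimple V mu) : bochner_approx f s -> smeasurable f.
Proof. by case=> sf _; exists s. Qed.

Lemma bochner_integrable_smeasurable f : bochner_integrable mu f -> smeasurable f.
Proof. by case=> s /bochner_approx_smeasurable. Qed.

(** The limsup of the norms of the approximating simple functions is measurable everywhere, and
    equals the norm of [f] wherever the approximation converges. *)
Lemma smeasurable_norm f : smeasurable f -> exists q : T -> \bar R,
  [/\ measurable_fun setT q, (forall x, 0 <= q x)%E &
      {ae mu, forall x, (rnorm (f x))%:E = q x}].
Proof.
move=> [s sf]; exists (fun x => limn_esup (fun n => (rnorm (simple_fun (s n) x))%:E)).
have m n : measurable_fun setT (fun x => (rnorm (simple_fun (s n) x))%:E).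
  by have := measurable_rnorm_simple (s n) 0; under eq_fun do rewrite subr0.
split.
- exact: measurable_fun_limn_esup.
- move=> x; rewrite limn_esup_lim; apply: lime_ge; first exact: is_cvg_esups.
  apply: nearW => n; apply: (@le_trans _ _ (rnorm (simple_fun (s n) x))%:E).
    by rewrite lee_fin rnorm_ge0.
  by apply: ereal_sup_ubound; exists n => /=.
- apply: filterS sf => x sfx; apply/esym.
  have := @cvg_limn_einf_sup R (fun n => (rnorm (simple_fun (s n) x))%:E) (rnorm (f x))%:E.
  case=> //; apply/fine_cvgP; split; first exact: nearW.
  exact: (cvg_comp _ _ sfx (@rnorm_continuous R V (f x))).
Qed.

Lemma L1norm_ge0 f : (0 <= L1norm mu f)%E.
Proof. by apply: integral_ge0 => x _; rewrite lee_fin rnorm_ge0. Qed.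

Lemma L1normC f g : L1norm mu (f \- g) = L1norm mu (g \- f).
Proof. by apply: eq_integral => x _; rewrite rnormC. Qed.

(** The two norms on the right are traded for their measurable representatives [p] and [q], whose
    integrals add; the norm on the left is only compared with [p + q] a.e. *)
Lemma L1norm_dist h f g : smeasurable h -> smeasurable f -> smeasurable g ->
  (L1norm mu (f \- g)%R <= L1norm mu (f \- h)%R + L1norm mu (h \- g)%R)%E.
Proof.
move=> mh mf mg.
have [p [mp p0 hp]] := smeasurable_norm (smeasurableB mf mh).
have [q [mq q0 hq]] := smeasurable_norm (smeasurableB mh mg).
have rn0 (k : T -> V) x : (0 <= (rnorm (k x))%:E :> \bar R)%E by rewrite lee_fin rnorm_ge0.
rewrite {2 3}/L1norm (ae_eq_lower_integral _ _ mp hp)//.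
rewrite (ae_eq_lower_integral _ _ mq hq)//.
rewrite -ge0_integralD//.
apply: ae_le_lower_integral => //.
- by move=> x; rewrite adde_ge0.
- exact: emeasurable_funD.
- apply: filterS2 hp hq => x <- <-; rewrite -EFinD lee_fin.
  exact: ler_rnorm_dist.
Qed.

Lemma L1norm_fatou (u : nat -> T -> V) f (C : \bar R) :
  (forall n, smeasurable (u n)) ->
  {ae mu, forall x, u n x @[n --> \oo] --> f x} ->
  (\forall n \near \oo, (L1norm mu (u n) <= C)%E) ->
  (L1norm mu f <= C)%E.
Proof.
move=> mu_ uf uC.
have [q hq] := choice (fun n => smeasurable_norm (mu_ n)).
have mq n : measurable_fun setT (q n) by have [] := hq n.
have q0 n x : (0 <= q n x)%E by have [_ + _] := hq n; exact.
have aeq : {ae mu, forall x, forall n, (rnorm (u n x))%:E = q n x}.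
  by apply: ae_foralln => n; have [] := hq n.
have rn0 (k : T -> V) x : (0 <= (rnorm (k x))%:E :> \bar R)%E by rewrite lee_fin rnorm_ge0.
(* By continuity of the norm this liminf is a.e. the norm of [f]; Fatou's lemma then applies to the
   measurable [q n]. *)
apply: (@le_trans _ _ (\int[mu]_x limn_einf (q^~ x))%E).
  apply: ae_le_lower_integral => //.
  - move=> x; rewrite limn_einf_lim; apply: lime_ge; first exact: is_cvg_einfs.
    by apply: nearW => n; apply: le_ereal_inf_tmp => _ [m _ <-].
  - rewrite /limn_einf; apply: measurableT_comp => //=.
    by apply: measurable_fun_limn_esup => n; exact: measurableT_comp.
  - apply: filterS2 aeq uf => x qx ux.
    have := @cvg_limn_einf_sup R (q^~ x) (rnorm (f x))%:E.
    case=> [|-> //]; under eq_fun do rewrite -qx.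
    apply/fine_cvgP; split; first exact: nearW.
    exact: (cvg_comp _ _ ux (@rnorm_continuous R V (f x))).
apply: (le_trans (fatou _ _ _ _)) => //.
rewrite limn_einf_lim; apply: lime_le; first exact: is_cvg_einfs.
apply: filterS uC => n un; apply: (le_trans _ un).
apply: ereal_inf_lbound; exists n => //=.
by apply/esym; apply: ae_eq_lower_integral => //; have [] := hq n.
Qed.

(** With [t] taken from the same sequence this makes the integrals Cauchy; with [t] from another
    approximating sequence it shows that the limits agree. *)
Lemma bochner_approx_dist f (s : nat -> intSimple V mu) t n : bochner_approx f s ->
  ((rnorm (simple_int (s n) - simple_int t))%:E <=
    L1norm mu (f \- simple_fun (s n))%R + L1norm mu (f \- simple_fun t)%R)%E.
Proof.
move=> /bochner_approx_smeasurable mf; rewrite (le_trans (le_simple_int_sub _ _))//.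
rewrite (L1normC f) L1norm_dist//; exact: smeasurable_simple.
Qed.

(** [bochner_int] is the limit along some unspecified approximating sequence; by this lemma every
    approximating sequence computes it. *)
Lemma bochner_int_cvg f (s : nat -> intSimple V mu) : bochner_approx f s ->
  simple_int (s n) @[n --> \oo] --> bochner_int mu f.
Proof.
move=> fs.
have ex : [set v : V | exists2 s : nat -> intSimple V mu, bochner_approx f s &
    simple_int (s n) @[n --> \oo] --> v] !=set0.
  have : cvg (simple_int (s n) @[n --> \oo]).
    apply: rnorm_cauchy_cvg => e e0; have e2 : 0 < e / 2 by rewrite divr_gt0.
    have [_] := fs; rewrite ecvg0P; last by move=> n; exact: L1norm_ge0.
    move=> /(_ _ e2)[N _ hN]; exists N => m n Nm Nn; rewrite -lte_fin.
    rewrite (le_lt_trans (bochner_approx_dist _ _ fs))// [e]splitr EFinD.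
    by rewrite lteD//; exact: hN.
  by move=> /cvg_ex[v hv]; exists v => /=; exists s.
have := xgetPex 0 ex; rewrite -/(bochner_int mu f) => -[t ft tint].
(* [t] is the sequence behind the value chosen by [xget]. Three errors of size [e / 4] occur: the
   two approximations in L1 and the convergence along [t]. *)
apply/rnorm_cvg0P/cvgrPdist_lt => e e0; have e4 : 0 < e / 4 by rewrite divr_gt0.
have [_] := fs; rewrite ecvg0P; last by move=> n; exact: L1norm_ge0.
move=> /(_ _ e4) hs.
have [_] := ft; rewrite ecvg0P; last by move=> n; exact: L1norm_ge0.
move=> /(_ _ e4) ht.
have /rnorm_cvgP/(_ _ e4) hi := tint.
have [m [m1 m2]] := filter_ex (filterI ht hi).
apply: filterS hs => n hn.
rewrite sub0r normrN ger0_norm ?rnorm_ge0//.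
rewrite (le_lt_trans (ler_rnorm_dist (simple_int (t m)) _ _))//.
have h1 : rnorm (simple_int (s n) - simple_int (t m)) < e / 4 + e / 4.
  by rewrite -lte_fin (le_lt_trans (bochner_approx_dist _ _ fs))// EFinD lteD.
by move: m2; rewrite rnormC; lra.
Qed.

Lemma bochner_int_simple_dist f t : bochner_integrable mu f ->
  ((rnorm (bochner_int mu f - simple_int t))%:E <=
    L1norm mu (f \- simple_fun t)%R)%E.
Proof.
move=> [s fs]; have ci := bochner_int_cvg fs.
apply/lee_addgt0Pr => e e0; have e2 : 0 < e / 2 by rewrite divr_gt0.
have [_] := fs; rewrite ecvg0P; last by move=> n; exact: L1norm_ge0.
move=> /(_ _ e2) hs; have /rnorm_cvgP/(_ _ e2) hi := ci.
have [n [n1 n2]] := filter_ex (filterI hs hi).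
apply: (@le_trans _ _ ((rnorm (bochner_int mu f - simple_int (s n)))%:E +
  (rnorm (simple_int (s n) - simple_int t))%:E)%E).
  by rewrite -EFinD lee_fin ler_rnorm_dist.
rewrite [in leRHS](splitr e) EFinD addeA [leRHS]addeC leeD//; first by rewrite lee_fin ltW.
rewrite (le_trans (bochner_approx_dist _ _ fs))// addeC leeD//; exact: ltW.
Qed.

(** Both functions are compared with one simple approximant of [g]. The resulting bound stands in
    for linearity of the integral in all later estimates. *)
Lemma bochner_int_dist f g : bochner_integrable mu f -> bochner_integrable mu g ->
  ((rnorm (bochner_int mu f - bochner_int mu g))%:E <= L1norm mu (f \- g)%R)%E.
Proof.
move=> bf bg; have [s gs] := bg.
apply/lee_addgt0Pr => e e0; have e2 : 0 < e / 2 by rewrite divr_gt0.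
have [_] := gs; rewrite ecvg0P; last by move=> n; exact: L1norm_ge0.
move=> /(_ _ e2) /filter_ex[n hn].
apply: (@le_trans _ _ ((rnorm (bochner_int mu f - simple_int (s n)))%:E +
  (rnorm (simple_int (s n) - bochner_int mu g))%:E)%E).
  by rewrite -EFinD lee_fin ler_rnorm_dist.
have h : (L1norm mu (f \- simple_fun (s n))%R <=
    L1norm mu (f \- g)%R + L1norm mu (g \- simple_fun (s n))%R)%E.
  by apply: L1norm_dist; [exact: bochner_integrable_smeasurable|
    exact: bochner_integrable_smeasurable|exact: smeasurable_simple].
rewrite [in leRHS](splitr e) EFinD addeA leeD//.
  by rewrite (le_trans (bochner_int_simple_dist _ bf))// (le_trans h)// leeD// ltW.
by rewrite rnormC (le_trans (bochner_int_simple_dist _ bg))// ltW.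
Qed.

Lemma le_bochner_int f : bochner_integrable mu f ->
  ((rnorm (bochner_int mu f))%:E <= L1norm mu f)%E.
Proof.
move=> bf; have := bochner_int_simple_dist (simple0 V mu) bf.
rewrite simple_int0 subr0 => /le_trans; apply.
by rewrite le_eqVlt; apply/orP; left; apply/eqP; apply: eq_integral => x _; rewrite /= simple_fun0 subr0.
Qed.

Lemma bochner_integrable_L1norm f : bochner_integrable mu f ->
  (L1norm mu f < +oo)%E.
Proof.
move=> bf; have [s fs] := bf; have [_] := fs.
rewrite ecvg0P; last by move=> n; exact: L1norm_ge0.
move=> /(_ _ ltr01) /filter_ex[n hn].
have := @L1norm_dist (simple_fun (s n)) f (simple_fun (simple0 V mu))
  (smeasurable_simple _) (bochner_integrable_smeasurable bf) (smeasurable_simple _).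
have sub0 g : (g \- simple_fun (simple0 V mu)) = g.
  by apply/funext => x /=; rewrite simple_fun0 subr0.
rewrite !sub0 => /le_lt_trans; apply; rewrite lte_add_pinfty//.
  by rewrite (lt_trans hn)// ltry.
exact: L1norm_simple_fin.
Qed.

(* Uniform approximation makes the simple functions inherit the a.e. limit of a
   sequence, without passing to a subsequence. *)
Definition unif_simple f := forall e : R, 0 < e -> exists t,
  (forall x, rnorm (f x - simple_fun t x) <= e) /\
  (L1norm mu (f \- simple_fun t)%R <= e%:E)%E.

Lemma bochner_integrable_lim (u : nat -> T -> V) f :
  (forall n, unif_simple (u n)) ->
  {ae mu, forall x, u n x @[n --> \oo] --> f x} ->
  L1norm mu (f \- u n) @[n --> \oo] --> 0%E ->
  bochner_integrable mu f.
Proof.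
move=> uu uf; rewrite ecvg0P; last by move=> n; exact: L1norm_ge0.
move=> Luf; have i0 n : 0 < n.+1%:R^-1 :> R by rewrite invr_gt0.
(* [t n] is within [1 / (n + 1)] of [u n] both uniformly and in L1, so the a.e. limit and the L1
   limit of [u] are also those of [t]. *)
have [t ht] := choice (fun n => uu n n.+1%:R^-1 (i0 _)).
have us n : smeasurable (u n).
  have [t' ht'] := choice (fun k => uu n k.+1%:R^-1 (i0 _)).
  exists t'; apply: aeW => x; apply/rnorm_cvgP => e e0; near=> k.
  have [+ _] := ht' k => /(_ x) /le_lt_trans; apply.
  by near: k; exact: near_infty_natSinv_lt (PosNum e0).
have tf : {ae mu, forall x, simple_fun (t n) x @[n --> \oo] --> f x}.
  apply: filterS uf => x ux; apply/rnorm_cvgP => e e0.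
  have e2 : 0 < e / 2 by rewrite divr_gt0.
  near=> k; rewrite (le_lt_trans (ler_rnorm_dist (u k x) _ _))// [ltRHS]splitr ltrD//.
    by near: k; move/rnorm_cvgP: ux; exact.
  have [+ _] := ht k => /(_ x) /le_lt_trans; apply.
  by near: k; exact: near_infty_natSinv_lt (PosNum e2).
exists t; split => //; apply/ecvg0P => [n|e e0]; first exact: L1norm_ge0.
have e2 : 0 < e / 2 by rewrite divr_gt0.
near=> k.
have := @L1norm_dist (u k) f (simple_fun (t k)) (us k) (ex_intro _ t tf) (smeasurable_simple _).
move=> /le_lt_trans; apply; rewrite [in ltRHS](splitr e) EFinD lteD//.
  by near: k; exact: Luf.
have [_ /le_lt_trans] := ht k; apply; rewrite lte_fin.
by near: k; exact: near_infty_natSinv_lt (PosNum e2).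
Unshelve. all: by end_near. Qed.

Lemma unif_simple_integrable f : unif_simple f -> bochner_integrable mu f.
Proof.
move=> uf; apply: (@bochner_integrable_lim (fun=> f)) => //.
  by apply: aeW => x; exact: cvg_cst.
apply: cvg_near_cst; apply: nearW => n; apply: integral0_eq => x _.
by rewrite /= subrr rnorm0.
Qed.

End BochnerTheory.

(** * Topological groups, Borel sets and compactly supported functions *)

Section TopologicalGroup.
Context (G : topologicalGroupType).

Lemma cvg_mulg (T : Type) (F : set_system T) (FF : Filter F) (f g : T -> G) (a b : G) :
  f @ F --> a -> g @ F --> b -> (f x * g x)%g @[x --> F] --> (a * b)%g.
Proof.
move=> fa gb.
apply: (@cvg_comp _ _ _ (fun x => (f x, g x)) (fun p : G * G => p.1 * p.2)%g).
  exact: (cvg_pair fa gb).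
exact: (@mulg_continuous G (a, b)).
Qed.

Lemma cvg_invg (T : Type) (F : set_system T) (FF : Filter F) (f : T -> G) (a : G) :
  f @ F --> a -> (f x)^-1%g @[x --> F] --> (a^-1)%g.
Proof. 
move=> fa; apply: (@cvg_comp _ _ _ f (fun x : G => x^-1)%g); first exact: fa.
exact: (@invg_continuous G a). Qed.

Lemma mulgl_continuous (a : G) : continuous (fun x : G => a * x)%g.
Proof. by move=> x; apply: cvg_mulg; [exact: cvg_cst|exact: cvg_id]. Qed.

Lemma divgl_continuous (a : G) : continuous (fun x : G => x^-1 * a)%g.
Proof.
by move=> x; apply: cvg_mulg; [exact: (@invg_continuous G x)|exact: cvg_cst].
Qed.

Lemma compact_image_mulg (K L : set G) : compact K -> compact L ->
  compact [set (x * y)%g | x in K & y in L].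
Proof.
move=> cK cL.
have -> : [set (x * y)%g | x in K & y in L] =
    (fun p : G * G => p.1 * p.2)%g @` (K `*` L).
  apply/seteqP; split => [_ [x Kx [y Ly <-]]|_ [[x y] [Kx Ly] <-]].
    by exists (x, y).
  by exists x => //; exists y.
apply: continuous_compact; last exact: compact_setX.
exact/continuous_subspaceT/mulg_continuous.
Qed.

Lemma compact_image_invg (K : set G) : compact K -> compact [set x^-1%g | x in K].
Proof.
move=> cK; apply: continuous_compact => //.
exact/continuous_subspaceT/invg_continuous.
Qed.

End TopologicalGroup.

(** The tube lemma: near each [(x0, y)] the inequality holds on a product neighbourhood, and
    compactness leaves one neighbourhood of [x0]. It turns joint continuity into estimates uniform
    over a compact set. *)
Lemma compact_near_lt (R : realType) (X Y : topologicalType) (K : set Y)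
    (D : X -> Y -> R) (x0 : X) (e : R) :
  compact K ->
  (forall y, K y -> {for (x0, y), continuous (fun p : X * Y => D p.1 p.2)}) ->
  (forall y, K y -> D x0 y < e) ->
  \forall x \near x0, forall y, K y -> D x y < e.
Proof.
move=> /compact_near_coveringP cK cD De.
apply: (cK X (nbhs x0) (fun x y => D x y < e) _) => y Ky.
have : nbhs (D x0 y) [set r | r < e].
  by apply: open_nbhs_nbhs; split; [exact: open_lt|exact: De].
move=> /(cD y Ky); rewrite /nbhs /= => -[[U1 U2] /= [hU1 hU2] h].
exists (U2, U1) => //= -[y' x'] /= [yU xU].
by apply: (h (x', y')).
Qed.

Lemma closure_suppP (G : topologicalType) (R : realType) (V : normedModType R[i])
    (f : G -> V) (K : set G) : hausdorff_space G -> compact K ->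
  (forall x, ~ K x -> f x = 0) -> closure [set x | f x != 0] `<=` K /\
  compact (closure [set x | f x != 0]).
Proof.
move=> hG cK hf.
have sub : closure [set x | f x != 0] `<=` K.
  rewrite [X in _ `<=` X](closure_id _).1; last exact: compact_closed.
  by apply: closureS => x /= /eqP fx0; apply: contrapT => /hf.
by split=> //; apply: (subclosed_compact _ cK sub); exact: closed_closure.
Qed.

Lemma supp_out (G : topologicalType) (R : realType) (V : normedModType R[i])
    (f : G -> V) x : ~ closure [set x | f x != 0] x -> f x = 0.
Proof.
by move=> h; apply: contrapT => /eqP fx; apply: h; exact: subset_closure.
Qed.

Section Borel.
Context (R : realType) (G : ptopologicalType).

Lemma borel_open (U : set G) : open U -> measurable (U : set (borel G)).
Proof. by move=> oU; apply: sub_sigma_algebra. Qed.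

Lemma borel_closed (F : set G) : closed F -> measurable (F : set (borel G)).
Proof.
move=> cF; rewrite -[F]setCK; apply: (@measurableC _ (borel G)); apply: borel_open.
exact: closed_openC.
Qed.

Lemma borel_compact (K : set G) : hausdorff_space G -> compact K ->
  measurable (K : set (borel G)).
Proof. by move=> hG cK; apply: borel_closed; exact: compact_closed. Qed.

Lemma borel_continuous (f : G -> R) : continuous f ->
  measurable_fun setT (f : borel G -> R).
Proof.
move=> /continuousP cf; apply: (measurability _ (RGenOpens.measurableE R)).
move=> _ [_ [a [b ->] <-]]; rewrite setTI; apply: borel_open.
exact/cf/interval_open.
Qed.

Lemma borel_econtinuous (f : G -> R) : continuous f ->
  measurable_fun setT (fun x : borel G => (f x)%:E).
Proof. by move=> /borel_continuous; exact: (@measurable_EFinP _ (borel G) _ _ _).2. Qed.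

Lemma borel_continuousG (G' : ptopologicalType) (f : G -> G') : continuous f ->
  measurable_fun setT (f : borel G -> borel G').
Proof.
move=> /continuousP cf; apply: (@measurability _ _ (borel G) (borel G') setT f (@open G')) => //.
by move=> _ [U oU <-]; rewrite setTI; apply: borel_open; exact: cf.
Qed.

(** A finite subcover by interiors of the sets [P y], made disjoint by removing from each piece the
    earlier ones; the piece of a point is given by the least [i] with [F i]. All Riemann sums below
    are taken over such partitions. *)
Lemma compact_partition (K : set G) (P : G -> set G) : hausdorff_space G ->
  compact K -> (forall y, K y -> nbhs y (P y)) ->
  exists (n : nat) (E : 'I_n -> set (borel G)) (y : 'I_n -> G),
  [/\ (forall i, measurable (E i)), (forall i, K (y i)),
      (forall i x, E i x -> K x /\ P (y i) x) &
      (forall x, K x -> exists i, E i x /\ forall j, E j x -> j = i)].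
Proof.
move=> hG cK KP; have := cK; rewrite compact_cover.
move=> /(_ G K (fun y => (P y)^°))[].
- by move=> y Ky; exact: open_interior.
- by move=> y Ky; exists y => //; exact: KP.
move=> D' sD cov; pose s : seq G := enum_fset D'.
pose yy i := nth (point : G) s i.
pose F i : set G := K `&` (P (yy i))^°.
exists (size s), (fun i : 'I_(size s) => F i `\` \big[setU/set0]_(j < i) F j), (fun i => yy i).
have mF i : measurable (F i : set (borel G)).
  apply: (@measurableI _ (borel G)); first exact: borel_compact.
  by apply: borel_open; exact: open_interior.
split.
- move=> i; apply: (@measurableD _ (borel G)); first exact: mF.
  elim/big_ind : _ => [|X Y mX mY|j _]; [exact: (@measurable0 _ (borel G))|
    exact: (@measurableU _ (borel G))|exact: mF].
- move=> i; have yD : yy i \in D' by exact: mem_nth.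
  by have := sD _ yD; rewrite inE.
- by move=> i x [[Kx]] /interior_subset.
move=> x Kx; have [z zD' Pz] := cov x Kx.
have ex : exists i, (i < size s)%N && `[< F i x >].
  exists (index z s); rewrite index_mem zD' /=; apply/asboolP; split => //.
  by rewrite /yy nth_index.
case: (ex_minnP ex) => i /andP[si /asboolP Fi] mi.
exists (Ordinal si); split; first split => //=.
  rewrite -bigcup_mkord => -[j /= ji Fj].
  have := mi j; rewrite (ltn_trans ji si) asboolT// => /(_ isT).
  by rewrite leqNgt ji.
move=> j [Fj nj]; apply/val_inj => /=; apply/eqP; rewrite eqn_leq.
rewrite mi ?ltn_ord ?asboolT// andbT leqNgt; apply/negP => ij.
by apply: nj; rewrite -bigcup_mkord; exists i.
Qed.

Lemma partition_sum (V : zmodType) n (E : 'I_n -> set G) (c : 'I_n -> V) x i :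
  E i x -> (forall j, E j x -> j = i) ->
  \sum_(j < n) (if x \in E j then c j else 0) = c i.
Proof.
move=> Ei uE; rewrite (bigD1 i)//= mem_set// big1 ?addr0// => j ji.
by rewrite memNset// => /uE ji'; rewrite ji' eqxx in ji.
Qed.

End Borel.

Lemma continuous_sum (R : realType) (G : topologicalType) n (F : 'I_n -> G -> R) :
  (forall i, continuous (F i)) -> continuous (fun x => \sum_(i < n) F i x).
Proof.
elim: n F => [|n IH] F cF x.
  by under eq_fun do rewrite big_ord0; exact: cvg_cst.
under eq_fun do rewrite big_ord_recl.
apply: (@cvgD _ R^o); first exact: cF.
by apply: IH => i; exact: cF.
Qed.

Lemma continuous_scaleV (R : realType) (G : topologicalType) (V : normedModType R[i])
    (h : G -> R) (v : V) : continuous h -> continuous (fun x => (h x)%:C%C *: v).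
Proof.
move=> ch x; apply/rnorm_cvgP => e e0.
have v1 : 0 < rnorm v + 1 by rewrite ltr_wpDl ?rnorm_ge0.
have /cvgrPdist_lt/(_ (e / (rnorm v + 1)) (divr_gt0 e0 v1)) := ch x.
apply: filterS => y; rewrite -scalerBl -rmorphB rnormZr ltr_pdivlMr//.
by apply: le_lt_trans; rewrite ler_wpM2l// lerDl.
Qed.

Lemma continuous_sumV (R : realType) (G : topologicalType) (V : normedModType R[i])
    n (F : 'I_n -> G -> V) :
  (forall i, continuous (F i)) -> continuous (fun x => \sum_(i < n) F i x).
Proof.
elim: n F => [|n IH] F cF x.
  by under eq_fun do rewrite big_ord0; exact: cvg_cst.
under eq_fun do rewrite big_ord_recl.
apply: cvgD; first exact: cF.
by apply: IH => i; exact: cF.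
Qed.

(** * Bump functions on a locally compact Hausdorff space *)

Section Bump.
Context (R : realType) (G : ptopologicalType).
Hypotheses (hG : hausdorff_space G) (lG : locally_compact [set: G]).

(** Complete regularity separates [x] from the complement of [U] intersected with the interior of
    [W]. Truncating at level 1/2 moves the support into the closed set [f <= 1 / 2], which lies in
    [U] and in the compact [W]. *)
Lemma point_bump (x : G) (U : set G) : open U -> U x ->
  exists (k : G -> R) (L : set G), [/\ continuous k, (forall y, 0 <= k y),
    compact L, L `<=` U & (forall y, ~ L y -> k y = 0) /\
    nbhs x [set y | 1 / 2 < k y]].
Proof.
move=> oU Ux; have [W Wx [cW clW]] := @lG x I; move: Wx; rewrite withinET => Wx.
have [f [cf f01 fx fB]] : exists f : G -> R, [/\ continuous f,
    range f `<=` `[0, 1]%classic, f @` [set x] `<=` [set 0] &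
    f @` (~` (U `&` W^°)) `<=` [set 1]].
  apply/uniform_separatorP; apply: (@locally_compact_completely_regular G R) => //.
    by apply: open_closedC; apply: openI => //; exact: open_interior.
  by move=> h; apply: h; split.
have fx0 : f x = 0 by apply: fx; exists x.
have fout y : ~ (U y /\ W y) -> f y = 1.
  move=> h; apply: fB; exists y => //= -[Uy Wy]; apply: h; split => //.
  exact: interior_subset.
pose L := [set y | f y <= 1 / 2].
have clL : closed L by apply: (preimage_closed _ (@closed_le R (1/2))) => y _; exact: cf.
have LUW : L `<=` U `&` W.
  by move=> y Ly; apply: contrapT => /fout fy1; move: Ly; rewrite /L /= fy1; lra.
exists (fun y => Num.max 0 (1 - 2 * f y)), L; split.
- move=> y; apply: (@continuous_max R G (fun=> 0) (fun y => 1 - 2 * f y) y).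
    exact: cvg_cst.
  by apply: (@cvgB _ R^o); [exact: cvg_cst|apply: cvgM; [exact: cvg_cst|exact: cf]].
- by move=> y; rewrite le_max lexx.
- by apply: (subclosed_compact clL cW) => y /LUW[].
- by move=> y /LUW[].
- split; first by move=> y; rewrite /L /= => /negP; rewrite -ltNge => h; rewrite max_l//; lra.
  have : nbhs (f x) [set r | r < 1 / 4 ].
    by apply: open_nbhs_nbhs; split; [exact: open_lt|rewrite /= fx0; lra].
  move=> /(cf x) nf; apply: (@filterS _ (nbhs x) _ _ _ _ nf) => y /= fy.
  by rewrite lt_max; apply/orP; right; lra.
Qed.

Lemma bump (K U : set G) : compact K -> open U -> K `<=` U ->
  exists (h : G -> R) (L : set G), [/\ continuous h, (forall y, 0 <= h y <= 1),
    (forall y, K y -> h y = 1), compact L /\ L `<=` U &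
    (forall y, ~ L y -> h y = 0)].
Proof.
move=> cK oU KU.
have /choice[k hk] : forall x, exists kx : G -> R, K x -> exists L : set G,
    [/\ continuous kx, (forall y, 0 <= kx y), compact L, L `<=` U &
      (forall y, ~ L y -> kx y = 0) /\ nbhs x [set y | 1 / 2 < kx y]].
  move=> x; have [Kx|nKx] := pselect (K x); last by exists (fun=> 0).
  by have [kx [L ?]] := point_bump oU (KU _ Kx); exists kx => _; exists L.
have /choice[L hL] : forall x, exists L : set G, K x ->
    [/\ continuous (k x), (forall y, 0 <= k x y), compact L, L `<=` U &
      (forall y, ~ L y -> k x y = 0) /\ nbhs x [set y | 1 / 2 < k x y]].
  move=> x; have [Kx|nKx] := pselect (K x); last by exists set0.
  by have [M ?] := hk _ Kx; exists M.
have [|n [E [y [mE Ky EP KE]]]] := @compact_partition G K (fun x => [set y | 1 / 2 < k x y]) hG cK.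
  by move=> x /hL[_ _ _ _ []].
(* At each point of [K] some [k (y i)] exceeds 1/2, so the doubled sum exceeds 1 and the cap makes
   [h] equal to 1. *)
pose h x := Num.min 1 (2 * \sum_(i < n) k (y i) x).
have sum0 x : 0 <= \sum_(i < n) k (y i) x.
  by apply: sumr_ge0 => i _; have [_ + _ _ _] := hL _ (Ky i); exact.
exists h, (\big[setU/set0]_(i < n) L (y i)); split.
- move=> x; apply: (@continuous_min R G (fun=> 1) (fun x => 2 * \sum_(i < n) k (y i) x) x).
    exact: cvg_cst.
  apply: cvgM; first exact: cvg_cst.
  by apply: continuous_sum => i; have [+ _ _ _ _] := hL _ (Ky i); exact.
- move=> x; rewrite /h le_min ler01 mulr_ge0//=; by rewrite ge_min lexx.
- move=> x Kx; rewrite /h min_l//; have [i [Ei _]] := KE _ Kx.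
  have [_ /= ki] := EP _ _ Ei; rewrite (bigD1 i)//=.
  have : 0 <= \sum_(j < n | j != i) k (y j) x.
    by apply: sumr_ge0 => j _; have [_ + _ _ _] := hL _ (Ky j); exact.
  by move: ki; lra.
- split.
    elim/big_ind : _ => [|X Y cX cY|i _]; [exact: compact0|exact: compactU|].
    by have [] := hL _ (Ky i).
  elim/big_ind : _ => [//|X Y sX sY|i _]; first by rewrite subUset.
  by have [] := hL _ (Ky i).
- move=> x nLx; rewrite /h big1 ?mulr0 ?min_r// => i _.
  have [_ _ _ _ [+ _]] := hL _ (Ky i); apply => Li; apply: nLx.
  by rewrite -bigcup_seq; exists i => //=; rewrite mem_index_enum.
Qed.

End Bump.

(** * Integrals of continuous functions with compact support *)

Section CompactSupport.
Context (R : realType) (G : ptopologicalType) (mu : {measure set (borel G) -> \bar R}).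
Hypotheses (hG : hausdorff_space G)
  (mu_compact : forall K : set G, compact K -> (mu K < +oo)%E).

Lemma csupp_bounded (f : G -> R) (K : set G) : continuous f -> compact K ->
  (forall x, ~ K x -> f x = 0) -> exists2 M, 0 <= M & forall x, `|f x| <= M.
Proof.
move=> cf cK f0.
have /compact_bounded[M [Mr hM]] : compact (f @` K).
  by apply: continuous_compact => //; exact: continuous_subspaceT.
exists (`|M| + 1) => [|x]; first by rewrite addr_ge0.
have [Kx|/f0 ->] := pselect (K x); last by rewrite normr0 addr_ge0.
by apply: (hM (`|M| + 1)); [rewrite (le_lt_trans (ler_norm _))// ltrDl|exists x].
Qed.

Lemma integral_le_compact (f : G -> R) (K : set G) (M : R) : compact K ->
  (forall x, 0 <= f x) ->
  (forall x, ~ K x -> f x = 0) -> (forall x, f x <= M) ->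
  (\int[mu]_x (f x)%:E <= (M * fine (mu K))%:E)%E.
Proof.
move=> cK f0 fK fM; have mK := borel_compact hG cK.
have M0 : 0 <= M by exact: le_trans (f0 point) (fM point).
apply: (@le_trans _ _ (\int[mu]_x (M%:E * (\1_K x)%:E))%E).
  apply: le_lower_integral => x; first by rewrite lee_fin.
  rewrite -EFinM lee_fin indicE; have [Kx|Kx] := pselect (K x).
    by rewrite mem_set// mulr1.
  by rewrite fK// memNset// mulr0.
rewrite ge0_integralZl_EFin//; last exact/measurable_EFinP/measurable_indic.
rewrite integral_indic// setIT EFinM fineK// ge0_fin_numE//; exact: mu_compact.
Qed.

Lemma csupp_integral_fin (f : G -> R) (K : set G) : continuous f -> compact K ->
  (forall x, 0 <= f x) -> (forall x, ~ K x -> f x = 0) ->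
  (\int[mu]_x (f x)%:E < +oo)%E.
Proof.
move=> cf cK f0 fK; have [M M0 hM] := csupp_bounded cf cK fK.
apply: (@le_lt_trans _ _ (M * fine (mu K))%:E); last exact: ltry.
by apply: integral_le_compact => // x; rewrite (le_trans (ler_norm _)).
Qed.

Lemma partition_mu_fin (K : set G) n (E : 'I_n -> set (borel G)) i :
  compact K -> measurable (E i) -> (forall x, E i x -> K x) -> (mu (E i) < +oo)%E.
Proof.
move=> cK mE EK; apply: le_lt_trans (mu_compact cK).
by apply: le_measure; rewrite ?inE//; exact: borel_compact.
Qed.

(** A Riemann sum with sample points [y i]. The partition is part of the conclusion so that
    [bochner_int_scale] can use it for a scalar function as well. *)
Lemma csupp_simple (V : completeNormedModType R[i]) (f : G -> V) (K : set G)
    (P : G -> set G) (e : R) : compact K ->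
  (forall x, ~ K x -> f x = 0) -> (forall y, K y -> nbhs y (P y)) ->
  (forall y x, P y x -> rnorm (f x - f y) <= e) -> 0 <= e ->
  exists n (E : 'I_n -> set (borel G)) (y : 'I_n -> G)
    (mE : forall i, measurable (E i)) (fE : forall i, (mu (E i) < +oo)%E),
  [/\ (forall x, rnorm (f x - simple_fun (@IntSimple _ _ _ V mu n E (fun i => f (y i)) mE fE) x) <= e),
      (forall i, K (y i)) ,
      (forall i x, E i x -> K x /\ P (y i) x),
      (forall x, K x -> exists i, E i x /\ forall j, E j x -> j = i) &
      (L1norm mu ((f : borel G -> V) \- simple_fun (@IntSimple _ _ _ V mu n E (fun i => f (y i)) mE fE))%R <=
        (e * fine (mu K))%:E)%E].
Proof.
move=> cK fK KP Pe e0.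
have [n [E [y [mE Ky EP KE]]]] := compact_partition hG cK KP.
have fE i : (mu (E i) < +oo)%E by apply: (partition_mu_fin cK) => // x /EP[].
exists n, E, y, mE, fE.
set t := IntSimple _ _ _.
have tout x : ~ K x -> simple_fun t x = 0.
  move=> Kx; rewrite /simple_fun big1// => i _ /=.
  by rewrite indicE memNset ?scale0r// => /EP[].
have ft x : rnorm (f x - simple_fun t x) <= e.
  have [Kx|Kx] := pselect (K x); last by rewrite tout// fK// subr0 rnorm0.
  have [i [Ei uE]] := KE _ Kx.
  have -> : simple_fun t x = f (y i).
    rewrite /simple_fun /= -(partition_sum (fun j => f (y j)) Ei uE).
    by apply: eq_bigr => j _; rewrite indicE; case: (x \in E j); rewrite ?scale1r ?scale0r.
  by apply: Pe; have [] := EP _ _ Ei.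
split => //; apply: integral_le_compact => //.
- by move=> x; exact: rnorm_ge0.
- by move=> x Kx /=; rewrite tout// fK// subr0 rnorm0.
Qed.

Lemma csupp_unif_simple (V : completeNormedModType R[i]) (f : G -> V) (K : set G) :
  continuous f -> compact K -> (forall x, ~ K x -> f x = 0) ->
  unif_simple mu (f : borel G -> V).
Proof.
move=> cf cK fK e e0.
pose m := fine (mu K); have m0 : 0 <= m by exact: fine_ge0.
have m1 : 0 < m + 1 by rewrite ltr_wpDl.
(* Small enough for both bounds at once: [e' <= e] and [e' * m <= e]. *)
pose e' := e / (m + 1).
have e'0 : 0 < e' by rewrite divr_gt0.
have e'e : e' <= e by rewrite ler_pdivrMr// ler_peMr ?lerDr// ltW.
have e'm : e' * m <= e.
  by rewrite /e' mulrAC ler_pdivrMr// ler_wpM2l ?lerDl ?ltW.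
have [||n [E [y [mE [fE [h _ _ _ hL]]]]]] :=
  @csupp_simple V f K (fun y => [set x | rnorm (f y - f x) < e']) e' cK fK _ _ (ltW e'0).
- move=> y _; have /rnorm_cvgP := cf y; exact.
- by move=> y x /ltW; rewrite rnormC.
exists (@IntSimple _ _ _ V mu n E (fun i => f (y i)) mE fE); split.
  by move=> x; exact: le_trans (h x) e'e.
by rewrite (le_trans hL)// lee_fin.
Qed.

Lemma csupp_integrable (V : completeNormedModType R[i]) (f : G -> V) (K : set G) :
  continuous f -> compact K -> (forall x, ~ K x -> f x = 0) ->
  bochner_integrable mu (f : borel G -> V).
Proof.
by move=> cf cK fK; apply: unif_simple_integrable; exact: csupp_unif_simple cK fK.
Qed.

(** Both sides are compared with the same Riemann sum: [simple_int t] is exactly [v] times the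
    integral of the scalar step function [q]. *)
Lemma bochner_int_scale (V : completeNormedModType R[i]) (f : G -> R) (v : V) (K : set G) :
  continuous f -> (forall x, 0 <= f x) -> compact K -> (forall x, ~ K x -> f x = 0) ->
  bochner_int mu (fun x : borel G => (f x)%:C%C *: v) =
    (fine (\int[mu]_x (f x)%:E))%:C%C *: v.
Proof.
move=> cf f0 cK fK.
have fv0 x : ~ K x -> (f x)%:C%C *: v = 0 by move=> /fK ->; rewrite scale0r.
have cfv : continuous (fun x => (f x)%:C%C *: v) by exact: continuous_scaleV.
have bi := csupp_integrable cfv cK fv0.
pose m := fine (mu K); have m0 : 0 <= m by exact: fine_ge0.
have Kfin : mu K \is a fin_num by rewrite ge0_fin_numE//; exact: mu_compact.
have ffin : (\int[mu]_x (f x)%:E)%E \is a fin_num.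
  rewrite ge0_fin_numE; first exact: csupp_integral_fin cf cK f0 fK.
  by apply: integral_ge0 => x _; rewrite lee_fin.
apply/eqP; rewrite -subr_eq0 -rnorm_eq0 eq_le rnorm_ge0 andbT.
apply/ler_addgt0Pl => e e0; rewrite addr0.
(* One [m * rnorm v] for the error of the Bochner integral, one for that of the scalar integral; the
   1 keeps [C] positive when they vanish. *)
pose C := m * rnorm v + m * rnorm v + 1.
have C0 : 0 < C by rewrite /C ltr_wpDl// addr_ge0// mulr_ge0 ?rnorm_ge0.
pose e' := e / C; have e'0 : 0 < e' by rewrite divr_gt0.
have [||n [E [y [mE [fE [h Ky EP KE hL]]]]]] :=
  @csupp_simple V _ K (fun y => [set x | `|f y - f x| < e']) (e' * rnorm v) cK fv0 _ _
    (mulr_ge0 (ltW e'0) (rnorm_ge0 v)).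
- by move=> z _; have /cvgrPdist_lt := cf z; exact.
- move=> z x /= /ltW fzx; rewrite -scalerBl -rmorphB rnormZr ler_wpM2r ?rnorm_ge0//.
  by rewrite distrC.
move: h hL; set t := IntSimple _ _ _ => h hL.
pose q x := \sum_(i < n) f (y i) * \1_(E i) x.
have qout x : ~ K x -> q x = 0.
  by move=> Kx; rewrite /q big1// => i _; rewrite indicE memNset ?mulr0// => /EP[].
have qin x : K x -> `|f x - q x| <= e'.
  move=> Kx; have [i [Ei uE]] := KE _ Kx.
  have -> : q x = f (y i).
    rewrite /q -(partition_sum (fun j => f (y j)) Ei uE).
    by apply: eq_bigr => j _; rewrite indicE; case: (x \in E j); rewrite ?mulr1 ?mulr0.
  by have [_ /= /ltW] := EP _ _ Ei; rewrite distrC.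
have q0 x : 0 <= q x by apply: sumr_ge0 => i _; rewrite mulr_ge0.
have mK := borel_compact hG cK.
have mq : measurable_fun setT (fun x : borel G => (q x)%:E).
  apply/(@measurable_EFinP _ (borel G)); apply: measurable_sum => i.
  by apply: measurable_funM; [exact: measurable_cst|exact: measurable_indic].
have mk : measurable_fun setT (fun x : borel G => (e' * \1_K x)%:E).
  by apply/(@measurable_EFinP _ (borel G)); apply: measurable_funM; [exact: measurable_cst|exact: measurable_indic].
have ik : (\int[mu]_x (e' * \1_K x)%:E = (e' * m)%:E)%E.
  under eq_integral do rewrite EFinM.
  rewrite ge0_integralZl_EFin//; [|exact/measurable_EFinP/measurable_indic|exact: ltW].
  by rewrite integral_indic// setIT /m [in RHS]EFinM fineK.
have iq : (\int[mu]_x (q x)%:E = (\sum_(i < n) f (y i) * fine (mu (E i)))%:E)%E.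
  under eq_integral do rewrite /q -sumEFin.
  rewrite ge0_integral_sum//; last 2 first.
  - move=> i; apply/measurable_EFinP; apply: measurable_funM.
      exact: measurable_cst.
    exact: measurable_indic.
  - by move=> i x _; rewrite lee_fin mulr_ge0.
  rewrite -sumEFin; apply: eq_bigr => i _.
  under eq_integral do rewrite EFinM.
  rewrite ge0_integralZl_EFin//; last exact/measurable_EFinP/measurable_indic.
  by rewrite integral_indic// setIT EFinM fineK// ge0_fin_numE.
have h1 : (\int[mu]_x (f x)%:E <= \int[mu]_x (q x)%:E + (e' * m)%:E)%E.
  rewrite -ik -ge0_integralD//; first last.
  - by move=> x _; rewrite lee_fin mulr_ge0// ltW.
  - by move=> x _; rewrite lee_fin.
  apply: le_lower_integral => x; first by rewrite lee_fin.
  rewrite -EFinD lee_fin indicE; have [Kx|Kx] := pselect (K x).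
    by rewrite mem_set// mulr1; have := qin _ Kx; rewrite ler_norml => /andP[? ?]; lra.
  by rewrite memNset// fK// mulr0 addr0.
have h2 : (\int[mu]_x (q x)%:E <= \int[mu]_x (f x)%:E + (e' * m)%:E)%E.
  rewrite -ik -ge0_integralD//; first last.
  - by move=> x _; rewrite lee_fin mulr_ge0// ltW.
  - exact: borel_econtinuous.
  - by move=> x _; rewrite lee_fin.
  apply: le_lower_integral => x; first by rewrite lee_fin.
  rewrite -EFinD lee_fin indicE; have [Kx|Kx] := pselect (K x).
    by rewrite mem_set// mulr1; have := qin _ Kx; rewrite ler_norml => /andP[? ?]; lra.
  by rewrite memNset// qout// fK// mulr0 addr0.
have si : simple_int t = (\sum_(i < n) f (y i) * fine (mu (E i)))%:C%C *: v.
  rewrite /simple_int /= rmorph_sum scaler_suml; apply: eq_bigr => i _.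
  by rewrite scalerA -rmorphM mulrC.
have := bochner_int_simple_dist t bi; move/le_trans => /(_ _ hL); rewrite lee_fin => h3.
rewrite (le_trans (ler_rnorm_dist (simple_int t) _ _))//.
have h4 : rnorm (simple_int t - (fine (\int[mu]_x (f x)%:E))%:C%C *: v) <= e' * m * rnorm v.
  rewrite si -scalerBl -rmorphB rnormZr ler_wpM2r ?rnorm_ge0//.
  rewrite iq -(fineK ffin) -EFinD lee_fin in h1.
  rewrite iq -(fineK ffin) -EFinD lee_fin in h2.
  by rewrite ler_norml; apply/andP; split; lra.
have : e' * C = e by rewrite /e' divfK// gt_eqF.
rewrite /C; move: h3 h4; rewrite -/m.
have := e'0; move: (rnorm _) (rnorm (_ - _)) (rnorm v) => a b c; nra.
Qed.

End CompactSupport.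

(** * Haar measure *)

Section Haar.
Context (R : realType) (G : topologicalGroupType)
  (mu : {measure set (borel G) -> \bar R}).
Hypotheses (mu_haar : left_haar mu) (hG : hausdorff_space G)
  (lG : locally_compact [set: G]).

Let mu_compact (K : set G) : compact K -> (mu K < +oo)%E.
Proof. exact: haar_compact. Qed.

Lemma haar_preimage (x : G) (B : set G) : measurable (B : set (borel G)) ->
  mu [set y | B (x * y)%g] = mu B.
Proof.
move=> mB; rewrite -(haar_left_invariant mu_haar x^-1%g mB); congr (mu _).
apply/seteqP; split => [y /= By|_ [y By <-] /=]; last by rewrite mulVKg.
by exists (x * y)%g => //; rewrite mulKg.
Qed.

Lemma haar_integral (x : G) (f : G -> R) : continuous f ->
  (forall y, 0 <= f y) ->
  (\int[mu]_y (f (x * y)%g)%:E = \int[mu]_y (f y)%:E)%E.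
Proof.
move=> cf f0; pose phi : borel G -> borel G := fun y => (x * y)%g.
have mphi : measurable_fun setT phi.
  by apply: borel_continuousG; exact: mulgl_continuous.
have := @ge0_integral_pushforward _ _ (borel G) (borel G) R phi mphi mu setT
  (fun y => (f y)%:E) (@measurableT _ (borel G)) (borel_econtinuous cf).
rewrite preimage_setT => <-; last by move=> y _; rewrite lee_fin.
apply: eq_measure_integral => /= B mB _.
exact: haar_preimage.
Qed.

(** If [U] were null, each compact set, covered by finitely many translates of [U], would be null,
    and by inner regularity so would the whole group. *)
Lemma haar_open_gt0 (U : set G) (x : G) : open U -> U x -> (0 < mu U)%E.
Proof.
move=> oU Ux; rewrite lt0e measure_ge0 andbT; apply/negP => /eqP U0.
suff K0 K : compact K -> mu K = 0%E.
  apply: (haar_neq0 mu_haar); rewrite (haar_inner mu_haar openT).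
  apply/eqP; rewrite eq_le; apply/andP; split.
    by apply: ge_ereal_sup => _ [K [cK _] <-]; rewrite K0.
  by apply: ereal_sup_ubound; exists set0; [split; [exact: compact0|]|rewrite measure0].
move=> cK; pose P (k : G) := [set y : G | U (x * (k^-1 * y))%g].
have oP k : open (P k).
  have /continuousP := @mulgl_continuous G (x * k^-1)%g => /(_ _ oU).
  by congr open; apply/funext => y /=; rewrite /P /= mulgA.
have [|n [E [y [mE Ky EP KE]]]] := @compact_partition G K P hG cK.
  by move=> k _; apply: open_nbhs_nbhs; split; [exact: oP|rewrite /P /= mulVg mulg1].
have PU k : mu (P k) = 0%E.
  rewrite -U0 -[RHS](haar_preimage (x * k^-1)%g (borel_open oU)).
  by congr (mu _); apply/funext => z /=; rewrite /P /= mulgA.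
pose D : set (borel G) := \big[setU/set0]_(i < n) (P (y i) : set (borel G)).
have [mD D0] : measurable D /\ (mu D <= 0)%E.
  rewrite /D; elim/big_rec : _ => [|i X _ [mX fX]]; first by rewrite measure0.
  have mi : measurable (P (y i) : set (borel G)) by exact: borel_open.
  split; first exact: measurableU.
  by apply: (le_trans (measureU2 mu mi mX)); rewrite [X in (X + _)%E](PU (y i)) add0e.
apply/eqP; rewrite eq_le measure_ge0 andbT (le_trans _ D0)//.
apply: le_measure; rewrite ?inE//; first exact: borel_compact.
move=> z Kz; have [i [Ei _]] := KE _ Kz.
by rewrite /D -bigcup_seq; exists i => /=; [rewrite mem_index_enum|have [] := EP _ _ Ei].
Qed.

(* A Tonelli inequality for the convolution. The Borel sets of [G * G] need not
   be the product sigma-algebra and [mu] need not be sigma-finite, so the library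
   version does not apply; the measurable majorant [q] is a Riemann sum in [y]. *)
Lemma conv_bound (a b : G -> R) (Ka Kb : set G) (e : R) :
  continuous a -> continuous b -> (forall x, 0 <= a x) -> (forall x, 0 <= b x) ->
  compact Ka -> compact Kb -> (forall x, ~ Ka x -> a x = 0) ->
  (forall x, ~ Kb x -> b x = 0) -> 0 < e ->
  exists q : borel G -> \bar R, [/\ measurable_fun setT q, (forall x, 0 <= q x)%E,
    (forall x, \int[mu]_y (a y * b (y^-1 * x)%g)%:E <= q x)%E &
    (\int[mu]_x q x <= \int[mu]_x (a x)%:E * \int[mu]_x (b x)%:E + e%:E)%E].
Proof.
move=> ca cb a0 b0 cKa cKb aK bK e0.
pose M := [set (x * y)%g | x in Ka & y in Kb].
have cM : compact M by exact: compact_image_mulg.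
have mM := borel_compact hG cM.
have Mfin : mu M \is a fin_num by rewrite ge0_fin_numE//; exact: mu_compact.
have afin : (\int[mu]_x (a x)%:E)%E \is a fin_num.
  rewrite ge0_fin_numE; first exact: csupp_integral_fin hG mu_compact _ _ ca cKa a0 aK.
  by apply: integral_ge0 => x _; rewrite lee_fin.
have bfin : (\int[mu]_x (b x)%:E)%E \is a fin_num.
  rewrite ge0_fin_numE; first exact: csupp_integral_fin hG mu_compact _ _ cb cKb b0 bK.
  by apply: integral_ge0 => x _; rewrite lee_fin.
pose m := fine (mu M); have m0 : 0 <= m by exact: fine_ge0.
pose ia := fine (\int[mu]_x (a x)%:E)%E.
have ia0 : 0 <= ia by apply: fine_ge0; apply: integral_ge0 => x _; rewrite lee_fin.
have C0 : 0 < ia * m + 1 by rewrite ltr_wpDl// mulr_ge0.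
(* After integration, the Riemann sum [q] overshoots the product of the integrals by
   [del * (ia * m)]. *)
have [del [del0 hdel]] : exists del : R, 0 < del /\ del * (ia * m) <= e.
  exists (e / (ia * m + 1)); split; first by rewrite divr_gt0.
  by rewrite mulrAC ler_pdivrMr// ler_wpM2l ?lerDl ?ltW.
pose P (y : G) := [set y' : G | forall x, M x -> `|b (y^-1 * x)%g - b (y'^-1 * x)%g| < del].
have nP y : nbhs y (P y).
  apply: (@compact_near_lt R G G M (fun y' x => `|b (y^-1 * x)%g - b (y'^-1 * x)%g|) y del cM).
    move=> x _; apply: (@cvg_norm _ R^o); apply: (@cvgB _ R^o).
      apply: (@cvg_comp _ _ _ (fun p : G * G => y^-1 * p.2)%g b); last exact: cb.
      by apply: cvg_mulg; [exact: cvg_cst|exact: cvg_snd].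
    apply: (@cvg_comp _ _ _ (fun p : G * G => p.1^-1 * p.2)%g b); last exact: cb.
    by apply: cvg_mulg; [apply: cvg_invg; exact: cvg_fst|exact: cvg_snd].
  by move=> x _; rewrite subrr normr0.
have [|n [E [y [mE Ky EP KE]]]] := @compact_partition G Ka P hG cKa; first by move=> y _.
pose A i : \bar R := (\int[mu]_z (a z * \1_(E i) z)%:E)%E.
have A0 i : (0 <= A i)%E.
  by apply: integral_ge0 => x _; rewrite lee_fin mulr_ge0.
have mA i : measurable_fun setT (fun z : borel G => (a z * \1_(E i) z)%:E).
  apply/(@measurable_EFinP _ (borel G)); apply: measurable_funM.
    exact: borel_continuous.
  exact: measurable_indic.
have sumA : (\sum_(i < n) A i = \int[mu]_x (a x)%:E)%E.
  rewrite -ge0_integral_sum//; last first.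
    by move=> i x _; rewrite lee_fin mulr_ge0.
  apply: eq_integral => x _; rewrite sumEFin; congr (_%:E).
  have [Kx|Kx] := pselect (Ka x); last first.
    by rewrite aK// big1// => i _; rewrite mul0r.
  have [i [Ei uE]] := KE _ Kx.
  rewrite -[RHS](partition_sum (fun=> a x) Ei uE); apply: eq_bigr => j _.
  by rewrite indicE; case: (x \in E j); rewrite ?mulr1 ?mulr0.
(* For [y] in [E i], the value [b (y^-1 x)] is replaced by the one at the sample point plus a margin
   [del]. The margin is confined to [M], off which [b (y^-1 x)] vanishes for every [y] in [Ka]. By
   left invariance each summand integrates to [A i] times the sum of the integral of [b] and
   [del * m]. *)
pose q (x : borel G) := (\sum_(i < n) A i * (b ((y i)^-1 * x)%g + del * \1_M x)%:E)%E.
have bd0 i x : 0 <= b ((y i)^-1 * x)%g + del * \1_M x by rewrite addr_ge0// mulr_ge0// ltW.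
have cbt i : continuous (fun x : G => b ((y i)^-1 * x)%g).
  by move=> x; apply: (@cvg_comp _ _ _ (fun x => (y i)^-1 * x)%g b); [exact: mulgl_continuous|exact: cb].
have mdM : measurable_fun setT (fun x : borel G => (del * \1_M x)%:E).
  apply/(@measurable_EFinP _ (borel G)); apply: measurable_funM.
    exact: measurable_cst.
  exact: measurable_indic.
have mbd i : measurable_fun setT (fun x : borel G => (b ((y i)^-1 * x)%g + del * \1_M x)%:E).
  under eq_fun do rewrite EFinD.
  by apply: emeasurable_funD => //; exact: borel_econtinuous.
exists q; split.
- apply: emeasurable_sum => i; apply: emeasurable_funM => //.
- by move=> x; apply: sume_ge0 => i _; rewrite mule_ge0// lee_fin.
- move=> x; rewrite /q.
  apply: (@le_trans _ _ (\int[mu]_z (\sum_(i < n)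
     (a z * \1_(E i) z)%:E * (b ((y i)^-1 * x)%g + del * \1_M x)%:E))%E).
    apply: le_lower_integral => z; first by rewrite lee_fin mulr_ge0.
    under [leRHS]eq_bigr do rewrite -EFinM.
    rewrite sumEFin lee_fin.
    have [Kz|Kz] := pselect (Ka z); last first.
      rewrite aK// mul0r; apply: sumr_ge0 => i _.
      by rewrite mul0r mul0r.
    have [i [Ei uE]] := KE _ Kz.
    rewrite (bigD1 i)//= indicE mem_set// mulr1.
    rewrite [X in _ <= _ + X]big1 ?addr0; last first.
      move=> j ji; rewrite indicE memNset ?mulr0 ?mul0r// => /uE ji'.
      by rewrite ji' eqxx in ji.
    rewrite ler_wpM2l// indicE; have [Mx|Mx] := pselect (M x).
      rewrite mem_set// mulr1; have [_ /(_ _ Mx)] := EP _ _ Ei.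
      by rewrite ltr_norml => /andP[? ?]; lra.
    rewrite memNset// mulr0 addr0 bK// => Kzx; apply: Mx.
    by exists z => //; exists (z^-1 * x)%g => //; rewrite mulVKg.
  rewrite ge0_integral_sum//; last 2 first.
  - by move=> i; apply: emeasurable_funM => //.
  - by move=> i z _; rewrite mule_ge0// lee_fin ?mulr_ge0.
  apply: lee_sum => i _; rewrite ge0_integralZr ?lee_fin//.
  by move=> z _; rewrite lee_fin mulr_ge0.
- rewrite /q ge0_integral_sum//; last 2 first.
  - by move=> i; apply: emeasurable_funM => //.
  - by move=> i x _; rewrite mule_ge0// lee_fin.
  have ib i : (\int[mu]_x (b ((y i)^-1 * x)%g + del * \1_M x)%:E =
      \int[mu]_x (b x)%:E + (del * m)%:E)%E.
    under eq_integral do rewrite EFinD.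
    rewrite ge0_integralD//; last 3 first.
    - by move=> x _; rewrite lee_fin.
    - exact: borel_econtinuous.
    - by move=> x _; rewrite lee_fin mulr_ge0// ltW.
    rewrite (haar_integral _ cb)//; congr (_ + _)%E.
    under eq_integral do rewrite EFinM.
    rewrite ge0_integralZl_EFin//; [|exact/measurable_EFinP/measurable_indic|exact: ltW].
    by rewrite integral_indic// setIT /m [in RHS]EFinM fineK.
  under eq_bigr => i _.
    rewrite ge0_integralZl//; last by move=> x _; rewrite lee_fin.
    rewrite ib; over.
  rewrite -ge0_sume_distrl; last by move=> i _; exact: A0.
  rewrite sumA -(fineK afin) -(fineK bfin) -EFinD -!EFinM -EFinD lee_fin mulrDr lerD2l.
  by rewrite mulrCA.
Qed.

Lemma conv_le (a b : G -> R) (Ka Kb : set G) :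
  continuous a -> continuous b -> (forall x, 0 <= a x) -> (forall x, 0 <= b x) ->
  compact Ka -> compact Kb -> (forall x, ~ Ka x -> a x = 0) ->
  (forall x, ~ Kb x -> b x = 0) ->
  (\int[mu]_x \int[mu]_y (a y * b (y^-1 * x)%g)%:E <=
   \int[mu]_x (a x)%:E * \int[mu]_x (b x)%:E)%E.
Proof.
move=> ca cb a0 b0 cKa cKb aK bK; apply/lee_addgt0Pr => e e0.
have [q [_ q0 hq iq]] := conv_bound ca cb a0 b0 cKa cKb aK bK e0.
apply: le_trans iq; apply: le_lower_integral => // x.
by apply: integral_ge0 => y _; rewrite lee_fin mulr_ge0.
Qed.

(* Integrating [psi y * h (y^-1 * x)] over x and y bounds the integral of
   [h z^-1] by that of [h] without introducing the modular function. *)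
Lemma integral_inv_le (M : set G) : compact M -> exists2 C : R, 0 <= C &
  forall h : G -> R, continuous h -> (forall x, 0 <= h x) ->
    (forall x, ~ M x -> h x = 0) ->
    (\int[mu]_z (h z^-1%g)%:E <= C%:E * \int[mu]_z (h z)%:E)%E.
Proof.
move=> cM; have [B B1 [cB clB]] := @lG 1%g I; move: B1; rewrite withinET => B1.
(* [L] contains [x z] whenever [x] is in [B] and [z^-1] in [M], so [psi] is 1 wherever the product
   in the double integral matters for [x] in [B]. *)
pose L := [set (x * y)%g | x in B & y in [set z^-1%g | z in M]].
have cL : compact L by apply: compact_image_mulg => //; exact: compact_image_invg.
have [psi [K [cpsi psi01 psiL [cK _] psiK]]] := @bump R G hG lG L setT cL openT (@subsetT _ _).
have psi0 x : 0 <= psi x by have /andP[] := psi01 x.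
have mB := borel_compact hG cB.
have B0 : (0 < mu B)%E.
  have := haar_open_gt0 (open_interior B) B1.
  move=> /lt_le_trans; apply; apply: le_measure; rewrite ?inE//.
    by apply: borel_open; exact: open_interior.
  exact: interior_subset.
have Bfin : mu B \is a fin_num by rewrite ge0_fin_numE//; exact: mu_compact.
have pfin : (\int[mu]_x (psi x)%:E)%E \is a fin_num.
  rewrite ge0_fin_numE; first exact: csupp_integral_fin hG mu_compact _ _ cpsi cK psi0 psiK.
  by apply: integral_ge0 => x _; rewrite lee_fin.
pose b := fine (mu B); have b0 : 0 < b by rewrite fine_gt0// B0 /= -ge0_fin_numE.
pose p := fine (\int[mu]_x (psi x)%:E)%E.
have p0 : 0 <= p by apply: fine_ge0; apply: integral_ge0 => x _; rewrite lee_fin.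
(* The double integral is at least [J * b], where [J] is the integral of [h z^-1], and at most [p]
   times the integral of [h]; hence the ratio. *)
exists (p / b); first by rewrite divr_ge0// ltW.
move=> h ch h0 hM.
set J := (\int[mu]_z (h z^-1%g)%:E)%E.
have J0 : (0 <= J)%E by apply: integral_ge0 => x _; rewrite lee_fin.
have le1 : (J * mu B <= \int[mu]_x \int[mu]_y (psi y * h (y^-1 * x)%g)%:E)%E.
  have -> : (J * mu B = \int[mu]_x (J * (\1_B x)%:E))%E.
    rewrite ge0_integralZl//; [by rewrite integral_indic// setIT|
      exact/measurable_EFinP/measurable_indic].
  apply: le_lower_integral => x; first by rewrite mule_ge0// lee_fin.
  rewrite indicE; have [Bx|Bx] := pselect (B x); last first.
    by rewrite memNset// mule0; apply: integral_ge0 => y _; rewrite lee_fin mulr_ge0.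
  rewrite mem_set// mule1.
  have cph : continuous (fun y : G => psi y * h (y^-1 * x)%g).
    move=> y; apply: (@cvgM R G); first exact: cpsi.
    by apply: (@cvg_comp _ _ _ (fun y => y^-1 * x)%g h); [exact: divgl_continuous|exact: ch].
  rewrite -(haar_integral x cph); last by move=> y; rewrite mulr_ge0.
  rewrite le_eqVlt; apply/orP; left; apply/eqP; apply: eq_integral => z _.
  rewrite invgM mulgVK; congr (_%:E).
  have [Mz|/hM ->] := pselect (M z^-1%g); last by rewrite mulr0.
  rewrite psiL ?mul1r//; exists x => //; exists z => //.
  by exists z^-1%g => //; rewrite invgK.
have le2 := conv_le cpsi ch psi0 h0 cK cM psiK hM.
have := le_trans le1 le2; rewrite -(fineK Bfin) -(fineK pfin) -/b -/p.
have hfin : (\int[mu]_x (h x)%:E)%E \is a fin_num.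
  rewrite ge0_fin_numE; first exact: csupp_integral_fin hG mu_compact _ _ ch cM h0 hM.
  by apply: integral_ge0 => x _; rewrite lee_fin.
rewrite -(fineK hfin) -!EFinM.
case: J J0 {le1} => [r| |] //; [move=> _|move=> _].
  by rewrite -EFinM !lee_fin -ler_pdivlMr// mulrAC.
by rewrite gt0_mulye// lte_fin.
Qed.

(** An open set of small measure contains the null set. The measure of its inverse is tested on
    compact sets [D] by inner regularity, and a bump equal to 1 on the inverse of [D] carries the
    smallness across through [integral_inv_le]. *)
Lemma null_inv (N L : set G) : measurable (N : set (borel G)) -> mu N = 0%E ->
  compact L -> mu [set z | N z^-1%g /\ L z] = 0%E.
Proof.
move=> mN N0 cL; pose M := [set z^-1%g | z in L].
have cM : compact M by exact: compact_image_invg.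
have [k [K [ck k01 kM [cK _] kK]]] := @bump R G hG lG M setT cM openT (@subsetT _ _).
(* Intersecting with [O] keeps every bump inside the compact [K], so that one constant [C], fixed
   before [U], serves for all of them. *)
pose O := [set x | 1 / 2 < k x].
have oO : open O.
  have /continuousP := ck => /(_ [set r | 1 / 2 < r]); apply; exact: open_gt.
have OK : O `<=` K.
  by move=> x Ox; apply: contrapT => /kK kx0; move: Ox; rewrite /O /= kx0; lra.
have MO : M `<=` O by move=> x Mx; rewrite /O /= kM//; lra.
have [C C0 hC] := integral_inv_le cK.
have mM := borel_compact hG cM.
have mN' : measurable (N `&` M : set (borel G)) by exact: measurableI.
have N'0 : mu (N `&` M) = 0%E.
  apply/eqP; rewrite eq_le measure_ge0 andbT -N0.
  by apply: le_measure; rewrite ?inE//; exact: subIsetl.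
have minv (X : set G) : measurable (X : set (borel G)) ->
    measurable ([set z : G | X z^-1%g] : set (borel G)).
  move=> mX; have := @borel_continuousG G G _ (@invg_continuous G).
  by move=> /(_ measurableT _ mX); rewrite setTI.
apply/eqP; rewrite eq_le measure_ge0 andbT; apply/lee_addgt0Pr => e e0; rewrite add0e.
have C1 : 0 < C + 1 by rewrite ltr_wpDl.
have d0 : 0 < e / (C + 1) by rewrite divr_gt0.
have [U [oU NU] Ue] : exists2 U : set G, open U /\ N `&` M `<=` U & (mu U < (e / (C + 1))%:E)%E.
  have : (ereal_inf [set mu U | U in [set U : set G | open U /\ N `&` M `<=` U]] < (e / (C + 1))%:E)%E.
    by rewrite -(haar_outer mu_haar mN') N'0 lte_fin.
  by move=> /ereal_inf_lt[_ [U hU <-] ?]; exists U.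
have oV : open (U `&` O) by exact: openI.
have oiV : open [set z : G | (U `&` O) z^-1%g].
  by have /continuousP := @invg_continuous G => /(_ _ oV).
apply: (@le_trans _ _ (mu [set z : G | (U `&` O) z^-1%g])).
  apply: le_measure; rewrite ?inE.
  - have -> : [set z | N z^-1%g /\ L z] = [set z | (N `&` M) z^-1%g].
      apply/seteqP; split => z /= [Nz]; first by move=> Lz; split=> //; exists z.
      by move=> [w Lw /invg_inj wz]; subst w.
    exact: (minv _ mN').
  - exact: borel_open.
  - by move=> z [Nz Lz]; split; [apply: NU; split => //|apply: MO]; exists z.
rewrite (haar_inner mu_haar oiV); apply: ge_ereal_sup => _ [D [cD DV] <-].
pose D' := [set z^-1%g | z in D].
have cD' : compact D' by exact: compact_image_invg.
have D'V : D' `<=` U `&` O by move=> _ [z Dz <-]; exact: DV.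
have [h [K' [ch h01 hD [cK' K'V] hK']]] := @bump R G hG lG D' _ cD' oV D'V.
have h0 x : 0 <= h x by have /andP[] := h01 x.
have mD := borel_compact hG cD.
apply: (@le_trans _ _ (\int[mu]_z (h z^-1%g)%:E)%E).
  rewrite -[X in (mu X <= _)%E]setIT -integral_indic//.
  apply: le_lower_integral => x; first by rewrite lee_fin.
  rewrite lee_fin indicE; have [Dx|Dx] := pselect (D x); last by rewrite memNset.
  by rewrite mem_set// hD//; exists x.
apply: (le_trans (hC h ch h0 _)).
  by move=> x Kx; apply: hK' => /K'V[_ /OK].
apply: (@le_trans _ _ (C%:E * (e / (C + 1))%:E)%E).
  rewrite lee_wpmul2l//; apply: (le_trans _ (ltW Ue)).
  rewrite -[X in (_ <= mu X)%E]setIT -integral_indic//; last exact: borel_open.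
  apply: le_lower_integral => x; first by rewrite lee_fin.
  rewrite lee_fin indicE; have [Ux|Ux] := pselect (U x).
    by rewrite mem_set//; have /andP[] := h01 x.
  by rewrite memNset// hK'// => /K'V[].
rewrite -EFinM lee_fin mulrA ler_pdivrMr//.
by rewrite mulrDr mulr1 mulrC lerDl ltW.
Qed.

(** In the variable [z = x^-1 y] the point [y^-1 x] is [z^-1], so left invariance reduces the claim
    to [null_inv]. *)
Lemma null_conv (N L : set G) (x : G) : measurable (N : set (borel G)) -> mu N = 0%E ->
  compact L -> mu.-negligible [set y : borel G | N (y^-1 * x)%g /\ L y].
Proof.
move=> mN N0 cL.
pose L' := [set (z * y)%g | z in [set x^-1%g] & y in L].
have cL' : compact L' by apply: compact_image_mulg => //; exact: compact_set1.
have mE : measurable ([set z | N z^-1%g /\ L' z] : set (borel G)).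
  apply: (@measurableI _ (borel G)); last exact: borel_compact.
  have := @borel_continuousG G G _ (@invg_continuous G).
  by move=> /(_ measurableT _ mN); rewrite setTI.
exists [set y | [set z | N z^-1%g /\ L' z] (x^-1 * y)%g]; split.
- have := @borel_continuousG G G _ (@mulgl_continuous G x^-1%g).
  by move=> /(_ measurableT _ mE); rewrite setTI.
- by rewrite (haar_preimage x^-1%g mE); exact: null_inv.
- move=> y [Ny Ly] /=; split; first by rewrite invgM invgK.
  by exists x^-1%g => //; exists y.
Qed.

End Haar.

(** * Twisted convolution on Cc *)

Section Contractions.
Context (R : realType).

Lemma opnorm_contraction (V W : normedModType R[i]) (T : V -> W) :
  linear T -> bounded_op T -> opnorm T <= 1 -> forall v, rnorm (T v) <= rnorm v.
Proof.
move=> lT [M hM] T1 v.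
have T0 : T 0 = 0.
  by have := lT (-1) 0 0; rewrite scaler0 addr0 scaleN1r addNr.
have TZ c u : T (c *: u) = c *: T u.
  by rewrite -[c *: u]addr0 lT T0 addr0.
have [->|v0] := eqVneq v 0.
  by rewrite T0 !rnorm0.
have nv0 : 0 < rnorm v by rewrite lt_neqAle rnorm_ge0 andbT eq_sym rnorm_eq0.
pose u := (rnorm v)^-1%:C%C *: v.
have u1 : rnorm u = 1.
  by rewrite rnormZr ger0_norm ?invr_ge0 ?rnorm_ge0// mulVf// gt_eqF.
have : rnorm (T u) <= 1.
  apply: le_trans T1; apply: ub_le_sup; last by exists u => //=; rewrite u1.
  (* [opnorm] is a [sup], which is 0 by convention on an unbounded set; boundedness is what makes
     [opnorm T <= 1] informative. *)
  exists `|M| => _ [w /= w1 <-]; apply: (le_trans (hM w)).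
  apply: (@le_trans _ _ (`|M| * rnorm w)); first by rewrite ler_wpM2r ?rnorm_ge0// ler_norm.
  by rewrite -[leRHS]mulr1 ler_wpM2l.
rewrite TZ rnormZr ger0_norm ?invr_ge0 ?rnorm_ge0//.
by rewrite mulrC ler_pdivrMr// mul1r.
Qed.

Context (A : banachAlgType R[i]).

Lemma rnorm_mulR (u : inv1 A) a : rnorm (mulR u a) <= rnorm a.
Proof.
apply: opnorm_contraction; [exact: mulR_linear|exact: mulR_bounded|].
by have := inv1_norm u; rewrite /mnorm => <-; rewrite le_max lexx orbT.
Qed.

Lemma mulRB (u : inv1 A) a b : mulR u (a - b) = mulR u a - mulR u b.
Proof.
by rewrite -[a - b]addrC -scaleN1r mulR_linear scaleN1r addrC.
Qed.

Lemma rnorm_aut (phi : isomAut A) a : rnorm (phi a) = rnorm a.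
Proof. by rewrite /rnorm aut_isometric. Qed.

Lemma autB (phi : isomAut A) a b : phi (a - b) = phi a - phi b.
Proof.
by rewrite -[a - b]addrC -scaleN1r aut_linear scaleN1r addrC.
Qed.

Lemma autZ (phi : isomAut A) c a : phi (c *: a) = c *: phi a.
Proof.
have p0 : phi 0 = 0 by rewrite -[X in phi X](subrr 0) autB subrr.
by rewrite -[c *: a]addr0 aut_linear p0 addr0.
Qed.

Lemma mulRZ (u : inv1 A) c a : mulR u (c *: a) = c *: mulR u a.
Proof.
have u0 : mulR u 0 = 0 by rewrite -[X in mulR u X](subrr 0) mulRB subrr.
by rewrite -[c *: a]addr0 mulR_linear u0 addr0.
Qed.

Lemma rnorm_bmul (a b : A) : rnorm (a ** b) <= rnorm a * rnorm b.
Proof. by have := ler_norm_bmul a b; rewrite !rnormE -rmorphM lecR. Qed.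

Lemma bmul0l (b : A) : 0 ** b = 0.
Proof. by rewrite -[X in X ** _](scale0r (0 : A)) bmulZl scale0r. Qed.

Lemma bmulBl (a b c : A) : (a - b) ** c = a ** c - b ** c.
Proof. by rewrite bmulDl -[- b]scaleN1r bmulZl scaleN1r. Qed.

Lemma bmulBr (a b c : A) : a ** (b - c) = a ** b - a ** c.
Proof. by rewrite bmulDr -[- c]scaleN1r bmulZr scaleN1r. Qed.

Section Convergence.
Context (T : Type) (F : set_system T) (FF : Filter F).

Lemma cvg_bmul (f g : T -> A) (a b : A) : f @ F --> a -> g @ F --> b ->
  (f t ** g t) @[t --> F] --> a ** b.
Proof.
move=> fa gb; apply/rnorm_cvgP => e e0.
have a1 : 0 < rnorm a + 1 by rewrite ltr_wpDl ?rnorm_ge0.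
have b1 : 0 < rnorm b + 1 by rewrite ltr_wpDl ?rnorm_ge0.
have /rnorm_cvgP/(_ _ (divr_gt0 (divr_gt0 e0 (ltr0n R 2)) b1)) h1 := fa.
have /rnorm_cvgP/(_ _ (divr_gt0 (divr_gt0 e0 (ltr0n R 2)) a1)) h2 := gb.
have /rnorm_cvgP/(_ _ ltr01) h3 := fa.
near=> t.
rewrite (le_lt_trans (ler_rnorm_dist (f t ** b) _ _))// [ltRHS]splitr ltrD//.
  rewrite -bmulBl (le_lt_trans (rnorm_bmul _ _))//.
  have : rnorm (a - f t) < e / 2 / (rnorm b + 1) by near: t.
  rewrite ltr_pdivlMr//; apply: le_lt_trans.
  by rewrite ler_wpM2l ?rnorm_ge0// lerDl.
rewrite -bmulBr (le_lt_trans (rnorm_bmul _ _))//.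
have : rnorm (b - g t) < e / 2 / (rnorm a + 1) by near: t.
rewrite ltr_pdivlMr// mulrC; apply: le_lt_trans.
rewrite ler_wpM2r ?rnorm_ge0//.
have : rnorm (a - f t) < 1 by near: t.
rewrite rnormC => ft1.
have := ler_rnormD (f t - a) a; rewrite subrK; lra.
Unshelve. all: by end_near. Qed.

End Convergence.
End Contractions.

Section Kernel.
Context (R : realType) (G : topologicalGroupType) (A : banachAlgType R[i])
  (S : twistedSystem G A).

Section Convergence.
Context (T : Type) (F : set_system T) (FF : Filter F).

(** Strong continuity upgrades to joint continuity because all the maps have Lipschitz constant
    1. *)
Lemma cvg_contraction (Phi : T -> A -> A) (f : T -> A) (a b : A) :
  (forall t c d, rnorm (Phi t c - Phi t d) <= rnorm (c - d)) ->
  Phi t a @[t --> F] --> b -> f @ F --> a -> Phi t (f t) @[t --> F] --> b.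
Proof.
move=> hPhi Pa fa; apply/rnorm_cvgP => e e0.
have e2 : 0 < e / 2 by rewrite divr_gt0.
have /rnorm_cvgP/(_ _ e2) h1 := Pa; have /rnorm_cvgP/(_ _ e2) h2 := fa.
apply: filterS2 h1 h2 => t h1 h2.
rewrite (le_lt_trans (ler_rnorm_dist (Phi t a) _ _))// [ltRHS]splitr ltrD//.
exact: le_lt_trans (hPhi _ _ _) h2.
Qed.

Lemma cvg_alpha (x : T -> G) (f : T -> A) (x0 : G) (a : A) :
  x @ F --> x0 -> f @ F --> a -> alpha S (x t) (f t) @[t --> F] --> alpha S x0 a.
Proof.
move=> cx; apply: (@cvg_contraction (fun t => alpha S (x t))).
  by move=> t c d; rewrite -autB rnorm_aut.
apply: (@cvg_comp _ _ _ x (fun x => alpha S x a)); first exact: cx.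
exact: (@alpha_continuous _ _ _ S a x0).
Qed.

(** Isometries pass strong continuity to their inverses: applying [alpha S (x t)] to the difference
    leaves [alpha S (x t) b - f t], where both terms tend to [a]. *)
Lemma cvg_alpha_inv (x : T -> G) (f : T -> A) (x0 : G) (a : A) :
  x @ F --> x0 -> f @ F --> a ->
  aut_inv (alpha S (x t)) (f t) @[t --> F] --> aut_inv (alpha S x0) a.
Proof.
move=> cx fa; set b := aut_inv (alpha S x0) a.
have h : alpha S (x t) b @[t --> F] --> a.
  rewrite -[a in _ --> a](aut_invK (alpha S x0)).
  apply: (@cvg_comp _ _ _ x (fun x => alpha S x b)); first exact: cx.
  exact: (@alpha_continuous _ _ _ S b x0).
apply/rnorm_cvgP => e e0; have e2 : 0 < e / 2 by rewrite divr_gt0.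
have /rnorm_cvgP/(_ _ e2) h1 := h; have /rnorm_cvgP/(_ _ e2) h2 := fa.
apply: filterS2 h1 h2 => t h1 h2.
rewrite -(rnorm_aut (alpha S (x t))) autB aut_invK.
rewrite (le_lt_trans (ler_rnorm_dist a _ _))// [ltRHS]splitr ltrD//.
by rewrite rnormC.
Qed.

Lemma cvg_sigmaR (x y : T -> G) (f : T -> A) (x0 y0 : G) (a : A) :
  x @ F --> x0 -> y @ F --> y0 -> f @ F --> a ->
  mulR (sigma S (x t) (y t)) (f t) @[t --> F] --> mulR (sigma S x0 y0) a.
Proof.
move=> cx cy; apply: (@cvg_contraction (fun t => mulR (sigma S (x t) (y t)))).
  by move=> t c d; rewrite -mulRB rnorm_mulR.
apply: (@cvg_comp _ _ _ (fun t => (x t, y t))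
   (fun p : G * G => mulR (sigma S p.1 p.2) a)); first exact: (cvg_pair cx cy).
exact: (@sigmaR_continuous _ _ _ S a (x0, y0)).
Qed.

End Convergence.

Definition kern (f g : G -> A) (x y : G) : A :=
  mulR (sigma S y (y^-1 * x)%g) (f y ** alpha S y (g (y^-1 * x)%g)).

(** Since [alpha] is isometric and [sigma] contractive, L1 estimates for the twisted convolution
    reduce to the ordinary convolution of two real functions. *)
Lemma rnorm_kern f g x y :
  rnorm (kern f g x y) <= rnorm (f y) * rnorm (g (y^-1 * x)%g).
Proof.
rewrite (le_trans (rnorm_mulR _ _))// (le_trans (rnorm_bmul _ _))//.
by rewrite rnorm_aut.
Qed.

Lemma kernBl f f' g x y : kern f g x y - kern f' g x y = kern (f \- f') g x y.
Proof. by rewrite /kern -mulRB -bmulBl. Qed.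

Lemma kernBr f g g' x y : kern f g x y - kern f g' x y = kern f (g \- g') x y.
Proof. by rewrite /kern -mulRB -bmulBr -autB. Qed.

Lemma kern_continuous f g : continuous f -> continuous g ->
  continuous (fun p : G * G => kern f g p.1 p.2).
Proof.
move=> cf cg [x y].
have cd : (q.2^-1 * q.1)%g @[q --> (x, y)] --> (y^-1 * x)%g.
  by apply: cvg_mulg; [apply: cvg_invg; exact: cvg_snd|exact: cvg_fst].
apply: cvg_sigmaR => //; first exact: cvg_snd.
apply: cvg_bmul.
  apply: (@cvg_comp _ _ _ (fun p : G * G => p.2) f); last exact: cf.
  exact: cvg_snd.
apply: cvg_alpha; first exact: cvg_snd.
by apply: (@cvg_comp _ _ _ (fun p : G * G => p.2^-1 * p.1)%g g); [exact: cd|exact: cg].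
Qed.

End Kernel.

Section TwistedConvolutionCc.
Context (R : realType) (G : topologicalGroupType) (A : banachAlgType R[i])
  (S : twistedSystem G A) (mu : {measure set (borel G) -> \bar R}).
Hypothesis mu_haar : left_haar mu.
Implicit Types f g h : Cc G A.

Let hG : hausdorff_space G := tw_hausdorff S.
Let lG : locally_compact [set: G] := @tw_locally_compact _ _ _ S.
Let mu_compact (K : set G) : compact K -> (mu K < +oo)%E.
Proof. exact: haar_compact. Qed.

Definition supp f : set G := closure [set x | f x != 0].

Lemma supp0 f x : ~ supp f x -> f x = 0.
Proof. exact: supp_out. Qed.

Lemma Cc_unif_simple f : unif_simple mu (f : borel G -> A).
Proof.
exact: csupp_unif_simple hG mu_compact _ _ _ (@Cc_continuous _ _ _ f) (@Cc_compact _ _ _ f) (@supp0 f).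
Qed.

Lemma Cc_integrable f : bochner_integrable mu (f : borel G -> A).
Proof. exact/unif_simple_integrable/Cc_unif_simple. Qed.

Lemma continuous_rnorm (h : G -> A) : continuous h -> continuous (fun x => rnorm (h x)).
Proof.
move=> ch x; apply: (@cvg_comp _ _ _ h (@rnorm R A)); first exact: ch.
exact: rnorm_continuous.
Qed.

Lemma continuousB (h k : G -> A) : continuous h -> continuous k -> continuous (h \- k).
Proof. by move=> ch ck x; apply: cvgB; [exact: ch|exact: ck]. Qed.

Lemma kern_out (h k : G -> A) x y : h y = 0 -> kern S h k x y = 0.
Proof. by move=> h0; rewrite /kern h0 bmul0l -[X in mulR _ X](subrr 0) mulRB subrr. Qed.

Lemma kernr_continuous (h k : G -> A) x : continuous h -> continuous k ->
  continuous (kern S h k x).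
Proof.
move=> ch ck y.
apply: (@cvg_comp _ _ _ (fun y => (x, y)) (fun p : G * G => kern S h k p.1 p.2)).
  have c1 : (fun=> x) @ nbhs y --> x by exact: cvg_cst.
  have c2 : id @ nbhs y --> y by exact: cvg_id.
  exact: (cvg_pair c1 c2).
exact: (@kern_continuous _ _ _ S h k ch ck (x, y)).
Qed.

Lemma kern_integrable f g x : bochner_integrable mu (kern S f g x : borel G -> A).
Proof.
apply: (csupp_integrable hG mu_compact (K := supp f)).
- exact: kernr_continuous (@Cc_continuous _ _ _ f) (@Cc_continuous _ _ _ g).
- exact: Cc_compact.
- by move=> y /supp0 fy; exact: kern_out.
Qed.

Lemma tconv_continuous f g : continuous (tconv S mu f g).
Proof.
move=> x; apply/rnorm_cvgP => e e0.
pose m := fine (mu (supp f)); have m0 : 0 <= m by exact: fine_ge0.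
have m1 : 0 < m + 1 by rewrite ltr_wpDl.
have e'0 : 0 < e / (m + 1) by rewrite divr_gt0.
(* The integrands vanish off [supp f], of measure [m], so a uniform bound [e / (m + 1)] there
   integrates to less than [e]. *)
have : \forall x' \near x, forall y, supp f y ->
    rnorm (kern S f g x y - kern S f g x' y) < e / (m + 1).
  apply: (@compact_near_lt R G G (supp f)
    (fun x' y => rnorm (kern S f g x y - kern S f g x' y)) x (e / (m + 1))).
  - exact: Cc_compact.
  - move=> y _.
    apply: (@cvg_comp _ _ _ (fun p : G * G => kern S f g x p.2 - kern S f g p.1 p.2)
      (@rnorm R A)); last exact: rnorm_continuous.
    apply: cvgB.
      apply: (@cvg_comp _ _ _ (fun p : G * G => p.2) (kern S f g x)).
        exact: cvg_snd.
      exact: kernr_continuous (@Cc_continuous _ _ _ f) (@Cc_continuous _ _ _ g) _.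
    exact: (@kern_continuous _ _ _ S _ _ (@Cc_continuous _ _ _ f) (@Cc_continuous _ _ _ g) (x, y)).
  - by move=> y _; rewrite subrr rnorm0.
apply: filterS => x' hx'; rewrite -lte_fin.
apply: (le_lt_trans (bochner_int_dist (kern_integrable f g x) (kern_integrable f g x'))).
apply: (@le_lt_trans _ _ (e / (m + 1) * m)%:E); last first.
  by rewrite lte_fin mulrAC ltr_pdivrMr// ltr_pM2l// ltrDl.
apply: (integral_le_compact hG mu_compact (@Cc_compact _ _ _ f)).
- by move=> y; exact: rnorm_ge0.
- by move=> y /supp0 fy /=; rewrite !kern_out// subr0 rnorm0.
- move=> y /=; have [Ky|/supp0 fy] := pselect (supp f y); first exact/ltW/hx'.
  by rewrite !kern_out// subr0 rnorm0 ltW.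
Qed.

Lemma tconv_out f g x : ~ [set (y * z)%g | y in supp f & z in supp g] x ->
  tconv S mu f g x = 0.
Proof.
move=> nx; apply/eqP; rewrite -rnorm_eq0 eq_le rnorm_ge0 andbT -lee_fin.
rewrite (le_trans (le_bochner_int (kern_integrable f g x)))//.
rewrite /L1norm integral0_eq// => y _; congr (_%:E); apply/eqP; rewrite rnorm_eq0.
have [fy|/supp0 fy] := pselect (supp f y); last by rewrite kern_out.
have /supp0 gy : ~ supp g (y^-1 * x)%g.
  by move=> gy; apply: nx; exists y => //; exists (y^-1 * x)%g => //; rewrite mulVKg.
by rewrite -rnorm_eq0 eq_le rnorm_ge0 andbT (le_trans (rnorm_kern _ _ _ _ _))// gy rnorm0 mulr0.
Qed.

Lemma tconv_supp f g :
  closure [set x | tconv S mu f g x != 0] `<=` [set (y * z)%g | y in supp f & z in supp g]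
  /\ compact (closure [set x | tconv S mu f g x != 0]).
Proof.
apply: closure_suppP => //; last exact: tconv_out.
by apply: compact_image_mulg; exact: Cc_compact.
Qed.

Definition tconv_Cc f g : Cc G A := MkCc (@tconv_continuous f g) (tconv_supp f g).2.

Lemma conv_le_A (h k : G -> A) (H K : set G) : continuous h -> continuous k ->
  compact H -> compact K -> (forall x, ~ H x -> h x = 0) ->
  (forall x, ~ K x -> k x = 0) ->
  (\int[mu]_x \int[mu]_y (rnorm (h y) * rnorm (k (y^-1 * x)%g))%:E <=
    L1norm mu (h : borel G -> A) * L1norm mu (k : borel G -> A))%E.
Proof.
move=> ch ck cH cK hH kK; apply: (conv_le mu_haar hG (Ka := H) (Kb := K)) => //.
- exact: continuous_rnorm.
- exact: continuous_rnorm.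
- by move=> x; exact: rnorm_ge0.
- by move=> x; exact: rnorm_ge0.
- by move=> x /hH ->; rewrite rnorm0.
- by move=> x /kK ->; rewrite rnorm0.
Qed.

Lemma Cc_sub_out f g x : ~ (supp f `|` supp g) x -> (f \- g) x = 0.
Proof. by move=> /not_orP[/supp0 fx /supp0 gx] /=; rewrite fx gx subr0. Qed.

(** Young's inequality with the difference taken inside the integrand, the form that
    [bochner_int_dist] and [kernBr] provide. *)
Lemma tconv_distr f g g' :
  (L1norm mu ((tconv S mu f g : borel G -> A) \- tconv S mu f g')%R <=
    L1norm mu (f : borel G -> A) * L1norm mu ((g : borel G -> A) \- g')%R)%E.
Proof.
apply: le_trans (@conv_le_A f (g \- g') (supp f) (supp g `|` supp g') _ _ _ _ _ _).
- apply: le_lower_integral => x; first by rewrite lee_fin rnorm_ge0.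
  apply: (le_trans (bochner_int_dist (kern_integrable f g x) (kern_integrable f g' x))).
  apply: le_lower_integral => y; first by rewrite lee_fin rnorm_ge0.
  by rewrite lee_fin /= kernBr rnorm_kern.
- exact: Cc_continuous.
- by apply: continuousB; exact: Cc_continuous.
- exact: Cc_compact.
- by apply: compactU; exact: Cc_compact.
- exact: supp0.
- exact: Cc_sub_out.
Qed.

Lemma tconv_distl f f' g :
  (L1norm mu ((tconv S mu f g : borel G -> A) \- tconv S mu f' g)%R <=
    L1norm mu ((f : borel G -> A) \- f')%R * L1norm mu (g : borel G -> A))%E.
Proof.
apply: le_trans (@conv_le_A (f \- f') g (supp f `|` supp f') (supp g) _ _ _ _ _ _).
- apply: le_lower_integral => x; first by rewrite lee_fin rnorm_ge0.
  apply: (le_trans (bochner_int_dist (kern_integrable f g x) (kern_integrable f' g x))).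
  apply: le_lower_integral => y; first by rewrite lee_fin rnorm_ge0.
  by rewrite lee_fin /= kernBl rnorm_kern.
- by apply: continuousB; exact: Cc_continuous.
- exact: Cc_continuous.
- by apply: compactU; exact: Cc_compact.
- exact: Cc_compact.
- exact: Cc_sub_out.
- exact: supp0.
Qed.

End TwistedConvolutionCc.

(** * Twisted convolution on L1 *)

(** By monotone convergence the integral of the series is the sum of the integrals, hence finite,
    and an integrable function is finite a.e. *)
Lemma summable_ae (R : realType) d (T : measurableType d)
    (mu : {measure set T -> \bar R}) (q : nat -> T -> \bar R) (c : nat -> \bar R) :
  (forall n, measurable_fun setT (q n)) -> (forall n x, 0 <= q n x)%E ->
  (forall n, \int[mu]_x q n x <= c n)%E -> (\sum_(0 <= n <oo) c n < +oo)%E ->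
  {ae mu, forall x, (\sum_(0 <= n <oo) q n x < +oo)%E}.
Proof.
move=> mq q0 qc c1.
have iq : (\int[mu]_x (\sum_(0 <= n <oo) q n x) < +oo)%E.
  rewrite integral_nneseries//; apply: le_lt_trans c1.
  by apply: lee_nneseries => [n _ _|n _]; [apply: integral_ge0 => x _|exact: qc].
have s0 x : (0 <= \sum_(0 <= n <oo) q n x)%E by apply: nneseries_ge0.
have mS : measurable_fun setT (fun x => \sum_(0 <= n <oo) q n x)%E.
  exact: ge0_emeasurable_sum.
have int : mu.-integrable setT (fun x => \sum_(0 <= n <oo) q n x)%E.
  apply/integrableP; split=> //.
  by under eq_integral do rewrite gee0_abs//.
apply: filterS (integrable_ae measurableT int) => x /(_ I).
by rewrite ge0_fin_numE.
Qed.

(** * Density of [Cc] in L1, and limits of sequences with summable increments *)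

Section Density.
Context (R : realType) (G : topologicalGroupType) (A : banachAlgType R[i])
  (S : twistedSystem G A) (mu : {measure set (borel G) -> \bar R}).
Hypothesis mu_haar : left_haar mu.

Let hG : hausdorff_space G := tw_hausdorff S.
Let lG : locally_compact [set: G] := @tw_locally_compact _ _ _ S.
Let mu_compact (K : set G) : compact K -> (mu K < +oo)%E.
Proof. exact: haar_compact. Qed.

Lemma indic_approx (E : set (borel G)) (e : R) : measurable E -> (mu E < +oo)%E ->
  0 < e -> exists (h : G -> R) (K : set G), [/\ continuous h, compact K,
    (forall x, ~ K x -> h x = 0) &
    (\int[mu]_x (`|\1_E x - h x|)%:E <= e%:E)%E].
Proof.
move=> mE fE e0; have e2 : 0 < e / 2 by rewrite divr_gt0.
have Efin : mu E \is a fin_num by rewrite ge0_fin_numE.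
have [U [oU EU] Ue] : exists2 U : set G, open U /\ E `<=` U & (mu U < mu E + (e / 2)%:E)%E.
  have : (ereal_inf [set mu U | U in [set U : set G | open U /\ E `<=` U]] < mu E + (e / 2)%:E)%E.
    by rewrite -(haar_outer mu_haar mE) lteDl// lte_fin.
  by move=> /ereal_inf_lt[_ [U hU <-] ?]; exists U.
have mU := borel_open oU.
have fU : (mu U < +oo)%E by rewrite (lt_trans Ue)// lte_add_pinfty// ltry.
have Ufin : mu U \is a fin_num by rewrite ge0_fin_numE.
(* Inner regularity is a property of open sets here, so [K] approximates [U] instead of [E]. A bump
   between [K] and [U] differs from the indicator of [E] only on the parts of [U] outside [E] or
   outside [K], each of measure at most [e / 2]. *)
have [K [cK KU] Ke] : exists2 K : set G, compact K /\ K `<=` U & (mu U - (e / 2)%:E < mu K)%E.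
  have : (mu U - (e / 2)%:E < ereal_sup [set mu K | K in [set K : set G | compact K /\ K `<=` U]])%E.
    by rewrite -(haar_inner mu_haar oU) lteBlDr// lteDl// lte_fin.
  by move=> /ereal_sup_gt[_ [K hK <-] ?]; exists K.
have mK := borel_compact hG cK.
have [h [L [ch h01 hK [cL LU] hL]]] := @bump R G hG lG K U cK oU KU.
exists h, L; split => //.
have UEe : (mu (U `\` E) <= (e / 2)%:E)%E.
  rewrite measureD// setIidr//.
  by rewrite leeBlDr// addeC ltW.
have UKe : (mu (U `\` K) <= (e / 2)%:E)%E.
  rewrite measureD// setIidr//.
  have Kfin : mu K \is a fin_num by rewrite ge0_fin_numE//; exact: mu_compact.
  by rewrite leeBlDr// addeC -leeBlDr// ltW.
have mUE : measurable (U `\` E : set (borel G)) by exact: measurableD.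
have mUK : measurable (U `\` K : set (borel G)) by exact: measurableD.
apply: (@le_trans _ _ (\int[mu]_x ((\1_(U `\` E) x)%:E + (\1_(U `\` K) x)%:E))%E).
  apply: le_lower_integral => x; first by rewrite lee_fin.
  rewrite -EFinD lee_fin !indicE; have /andP[h0 h1] := h01 x.
  have [Ux|Ux] := pselect (U x); last first.
    rewrite memNset; last by move=> /EU.
    by rewrite hL ?subrr ?normr0 ?addr_ge0// => /LU.
  have [Ex|Ex] := pselect (E x).
    rewrite mem_set//; have [Kx|Kx] := pselect (K x).
      by rewrite hK// subrr normr0 addr_ge0.
    rewrite [X in _ <= _ + (nat_of_bool X)%:R]mem_set//.
    by rewrite ger0_norm ?subr_ge0//; case: (_ \in _); rewrite /=; lra.
  rewrite memNset// [X in _ <= (nat_of_bool X)%:R + _]mem_set//.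
  rewrite sub0r normrN ger0_norm//; case: (_ \in _); rewrite /=; lra.
rewrite ge0_integralD//; first last.
- exact/measurable_EFinP/measurable_indic.
- exact/measurable_EFinP/measurable_indic.
by rewrite !integral_indic// !setIT (splitr e) EFinD leeD.
Qed.

Lemma mkCc (h : G -> A) (K : set G) : continuous h -> compact K ->
  (forall x, ~ K x -> h x = 0) -> exists phi : Cc G A, phi =1 h.
Proof.
move=> ch cK hK; have [_ cs] := closure_suppP hG cK hK.
by exists (MkCc ch cs).
Qed.

Lemma simple_approx_Cc (s : intSimple A mu) (e : R) : 0 < e ->
  exists phi : Cc G A, (L1norm mu (simple_fun s \- phi)%R <= e%:E)%E.
Proof.
move=> e0; pose n := simple_size s.
pose N := \sum_(i < n) rnorm (simple_val i : A).
have N0 : 0 <= N by apply: sumr_ge0 => i _; exact: rnorm_ge0.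
have N1 : 0 < N + 1 by rewrite ltr_wpDl.
have d0 : 0 < e / (N + 1) by rewrite divr_gt0.
have /choice[h hh] : forall i : 'I_n, exists h : G -> R, exists K : set G,
    [/\ continuous h, compact K, (forall x, ~ K x -> h x = 0) &
    (\int[mu]_x (`|\1_(simple_set i) x - h x|)%:E <= (e / (N + 1))%:E)%E].
  by move=> i; apply: indic_approx => //; [exact: simple_measurable|exact: simple_finite].
have /choice[K hK] := hh.
have [phi hphi] : exists phi : Cc G A, phi =1 (fun x => \sum_(i < n) (h i x)%:C%C *: simple_val i).
  apply: (@mkCc _ (\big[setU/set0]_(i < n) K i)).
  - apply: (@continuous_sumV R G A n (fun i x => (h i x)%:C%C *: simple_val i)) => i.
    by apply: continuous_scaleV; have [] := hK i.
  - elim/big_ind : _ => [|X Y cX cY|i _]; [exact: compact0|exact: compactU|].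
    by have [] := hK i.
  - move=> x nKx; rewrite big1// => i _; have [_ _ hi _] := hK i; rewrite hi ?scale0r// => Ki.
    by apply: nKx; rewrite -bigcup_seq; exists i => //=; rewrite mem_index_enum.
exists phi.
have mh i : measurable_fun setT (fun x : borel G => `|\1_(simple_set i) x - h i x|).
  apply: measurableT_comp => //; apply: measurable_funB.
    exact/measurable_indic/simple_measurable.
  by apply: borel_continuous; have [] := hK i.
apply: (@le_trans _ _ (\int[mu]_x (\sum_(i < n) ((rnorm (simple_val i : A))%:E *
    (`|\1_(simple_set i) x - h i x|)%:E)))%E).
  apply: le_lower_integral => x; first by rewrite lee_fin rnorm_ge0.
  under [leRHS]eq_bigr do rewrite -EFinM.
  rewrite sumEFin lee_fin /= hphi /simple_fun -sumrB.
  rewrite (le_trans (rnorm_sum_le _ _ _))//; apply: ler_sum => i _.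
  rewrite -scalerBl mulrC.
  have -> : (\1_(simple_set i) x : R[i]) - (h i x)%:C%C = (\1_(simple_set i) x - h i x)%:C%C.
    by rewrite rmorphB /= !indicE; case: (_ \in _).
  by rewrite rnormZr.
rewrite ge0_integral_sum//; last 2 first.
- by move=> i; apply/measurable_EFinP; apply: measurable_funM.
- by move=> i x _; rewrite mule_ge0// lee_fin ?rnorm_ge0.
apply: (@le_trans _ _ (\sum_(i < n) (rnorm (simple_val i : A) * (e / (N + 1)))%:E)%E).
  apply: lee_sum => i _; rewrite ge0_integralZl_EFin ?rnorm_ge0//; last exact/measurable_EFinP.
  by rewrite EFinM lee_wpmul2l ?lee_fin ?rnorm_ge0//; have [] := hK i.
rewrite sumEFin lee_fin -mulr_suml -/N mulrA ler_pdivrMr//.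
by rewrite mulrC mulrDr mulr1 lerDl ltW.
Qed.

(** Written as the terms of [epsilon_trick0] with bound 1. *)
Definition half_pow (n : nat) : R := 1 / (2 ^ n.+1)%:R.

Lemma half_pow_gt0 n : 0 < half_pow n.
Proof. by rewrite divr_gt0// ltr0n expn_gt0. Qed.

Lemma sum_half_pow : (\sum_(0 <= n <oo) (half_pow n)%:E < +oo)%E.
Proof.
by apply: (@le_lt_trans _ _ 1%:E); [exact: epsilon_trick0|exact: ltry].
Qed.

(** The simple approximants converge a.e. by assumption; their L1 distances to the [phi n] are
    summable, so those differences tend to 0 a.e. *)
Lemma Cc_approx (g : G -> A) : bochner_integrable mu (g : borel G -> A) ->
  exists phi : nat -> Cc G A,
    {ae mu, forall x, phi n x @[n --> \oo] --> g x} /\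
    forall n, (L1norm mu ((phi n.+1 : borel G -> A) \- phi n)%R <= (half_pow n)%:E)%E.
Proof.
move=> bg; have [s [sg]] := bg.
rewrite ecvg0P; last by move=> n; exact: L1norm_ge0.
move=> Lsg; have d0 n : 0 < half_pow n / 4 by rewrite divr_gt0 ?half_pow_gt0.
have /choice[k hk] : forall n, exists k, forall m, (k <= m)%N ->
    (L1norm mu (g \- simple_fun (s m))%R < (half_pow n / 4)%:E)%E.
  by move=> n; have [k _ hk] := Lsg _ (d0 n); exists k => m km; exact: hk.
(* At least [k n], for the L1 estimate, and at least [n], for the a.e. limit along [s]. *)
pose j n := (n + \sum_(i < n.+1) k i)%N.
have kj n : (k n <= j n)%N by rewrite /j big_ord_recr /= addnA leq_addl.
have nj n : (n <= j n)%N by rewrite leq_addr.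
have /choice[phi hphi] := fun n => simple_approx_Cc (s (j n)) (d0 n).
exists phi; split; last first.
  move=> n.
  have msm m : smeasurable mu (simple_fun (s m)) by exact: smeasurable_simple.
  have mphi m : smeasurable mu (phi m : borel G -> A).
    by apply: bochner_integrable_smeasurable; exact: (Cc_integrable S mu_haar).
  have mg : smeasurable mu (g : borel G -> A) by exact: bochner_integrable_smeasurable.
  have hn : half_pow n.+1 <= half_pow n.
    rewrite /half_pow ler_wpM2l// lef_pV2 ?posrE ?ltr0n ?expn_gt0//.
    by rewrite ler_nat leq_exp2l.
  apply: le_trans (L1norm_dist (msm (j n.+1)) (mphi _) (mphi _)) _.
  have h1 : (L1norm mu ((phi n.+1 : borel G -> A) \- simple_fun (s (j n.+1)))%R <= (half_pow n / 4)%:E)%E.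
    rewrite L1normC (le_trans (hphi _))// lee_fin; lra.
  have h2 : (L1norm mu (simple_fun (s (j n.+1)) \- g)%R <= (half_pow n / 4)%:E)%E.
    rewrite L1normC (le_trans (ltW (hk n.+1 _ (kj _))))// lee_fin; lra.
  have h3 : (L1norm mu (g \- simple_fun (s (j n)))%R <= (half_pow n / 4)%:E)%E.
    by rewrite ltW// hk.
  have h4 := hphi n.
  (* The chain [phi n.+1], [s (j n.+1)], [g], [s (j n)], [phi n] has four links, each bounded by a
     quarter. *)
  have -> : half_pow n = half_pow n / 4 + (half_pow n / 4 + (half_pow n / 4 + half_pow n / 4)).
    lra.
  rewrite !EFinD leeD//.
  apply: le_trans (L1norm_dist mg (msm _) (mphi _)) _; rewrite leeD//.
  by apply: le_trans (L1norm_dist (msm (j n)) mg (mphi _)) _; rewrite leeD.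
have /choice[q hq] : forall n, exists q : borel G -> \bar R,
   [/\ measurable_fun setT q, (forall x, 0 <= q x)%E &
      {ae mu, forall x, (rnorm ((simple_fun (s (j n)) \- phi n) x))%:E = q x}].
  move=> n; apply: smeasurable_norm; apply: smeasurableB.
    exact: smeasurable_simple.
  by apply: bochner_integrable_smeasurable; exact: (Cc_integrable S mu_haar).
have sq : {ae mu, forall x, (\sum_(0 <= n <oo) q n x < +oo)%E}.
  apply: (summable_ae (c := fun n => (half_pow n)%:E)).
  - by move=> n; have [] := hq n.
  - by move=> n; have [] := hq n.
  - move=> n; have [mq q0 aeq] := hq n.
    rewrite -(ae_eq_lower_integral (f := fun x => (rnorm ((simple_fun (s (j n)) \- phi n) x))%:E) _ q0 mq aeq); last first.
      by move=> x; rewrite lee_fin rnorm_ge0.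
    by rewrite (le_trans (hphi n))// lee_fin; have := half_pow_gt0 n; lra.
  - exact: sum_half_pow.
have aq : {ae mu, forall x, forall n, (rnorm ((simple_fun (s (j n)) \- phi n) x))%:E = q n x}.
  by apply: ae_foralln => n; have [] := hq n.
apply: filterS3 sg sq aq => x sx qx ax.
have q0 n : (0 <= q n x)%E by have [_ + _] := hq n; exact.
have q1 : q n x @[n --> \oo] --> 0%E.
  apply: (@squeeze_cvge _ _ _ _ (fun=> 0%E) _ (fun n => \sum_(n <= k <oo) q k x)%E).
  - apply: nearW => n; rewrite q0 /=.
    have := @nneseries_lim_ge R (q^~ x) xpredT n n.+1 (fun k _ _ => q0 k).
    by rewrite big_nat1.
  - exact: cvg_cst.
  - by apply: nneseries_tail_cvg.
have := (ecvg0P _ q0).1 q1 => {}q1.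
apply/rnorm_cvgP => e e0; have e2 : 0 < e / 2 by rewrite divr_gt0.
move/rnorm_cvgP : sx => /(_ _ e2)[M _ hM].
near=> n.
rewrite (le_lt_trans (ler_rnorm_dist (simple_fun (s (j n)) x) _ _))// [ltRHS]splitr ltrD//.
  apply: hM => /=; apply: leq_trans (nj n); near: n; exact: nbhs_infty_ge.
have := ax n => /= axn; rewrite -lte_fin axn; near: n; exact: q1.
Unshelve. all: by end_near. Qed.

(** Telescoping bounds [u m - u n]; as [m] grows, Fatou's lemma bounds [T - u n] by the tail of the
    series. The tails tend to 0, which makes [T], known so far only as an a.e. limit, integrable. *)
Lemma L1_limit (T : G -> A) (u : nat -> Cc G A) (c : nat -> \bar R) :
  (forall k, 0 <= c k)%E -> (\sum_(0 <= k <oo) c k < +oo)%E ->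
  (forall k, L1norm mu ((u k.+1 : borel G -> A) \- u k)%R <= c k)%E ->
  {ae mu, forall x, u n x @[n --> \oo] --> T x} ->
  bochner_integrable mu (T : borel G -> A) /\
  forall n, (L1norm mu ((T : borel G -> A) \- u n)%R <= \sum_(n <= k <oo) c k)%E.
Proof.
move=> c0 c1 uc uT.
have mu_ n : smeasurable mu (u n : borel G -> A).
  by apply: bochner_integrable_smeasurable; exact: (Cc_integrable S mu_haar).
have tel n m : (L1norm mu ((u (n + m)%N : borel G -> A) \- u n)%R <=
    \sum_(n <= k < n + m) c k)%E.
  elim: m => [|m IH].
    rewrite addn0 big_geq// /L1norm integral0_eq// => x _.
    by rewrite /= subrr rnorm0.
  rewrite addnS big_nat_recr /= ?leq_addr//.
  apply: (le_trans (L1norm_dist (mu_ (n + m)%N) (mu_ _) (mu_ _))).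
  by rewrite [leRHS]addeC; apply: leeD; [exact: uc|exact: IH].
have tail n : (L1norm mu ((T : borel G -> A) \- u n)%R <= \sum_(n <= k <oo) c k)%E.
  apply: (@L1norm_fatou _ _ _ _ mu (fun m => (u m : borel G -> A) \- u n)).
  - by move=> m; apply: (smeasurableB (mu_ m) (mu_ n)).
  - apply: (@filterS _ _ (ae_filter_ringOfSetsType mu) _ _ _ uT) => x ux.
    by apply: cvgB => //; exact: cvg_cst.
  - exists n => // m /= nm; rewrite -(subnKC nm) (le_trans (tel _ _))//.
    by apply: (@nneseries_lim_ge R c xpredT n) => k _ _; exact: c0.
split=> //.
apply: (@bochner_integrable_lim _ _ _ _ mu (fun n => u n : borel G -> A)) => //.
  by move=> n; exact: (Cc_unif_simple S mu_haar).
apply: (@squeeze_cvge _ _ _ _ (fun=> 0%E) _ (fun n => \sum_(n <= k <oo) c k)%E).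
- by apply: nearW => n; rewrite L1norm_ge0 tail.
- exact: cvg_cst.
- by apply: nneseries_tail_cvg.
Qed.

End Density.

Section TwistedConvolutionL1.
Context (R : realType) (G : topologicalGroupType) (A : banachAlgType R[i])
  (S : twistedSystem G A) (mu : {measure set (borel G) -> \bar R}).
Hypothesis mu_haar : left_haar mu.
Implicit Types f : Cc G A.

Let hG : hausdorff_space G := tw_hausdorff S.
Let mu_compact (K : set G) : compact K -> (mu K < +oo)%E.
Proof. exact: haar_compact. Qed.

Lemma kern_compact f (g : Cc G A) x : compact (closure [set y | kern S f g x y != 0]).
Proof.
apply: (closure_suppP hG (@Cc_compact _ _ _ f) _).2 => y /supp0 fy.
exact: kern_out.
Qed.

Definition kern_Cc f (g : Cc G A) x : Cc G A :=
  MkCc (@kernr_continuous R G A S f g x (@Cc_continuous _ _ _ f) (@Cc_continuous _ _ _ g))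
    (@kern_compact f g x).

(** Meant for the integrands of the convolutions at a fixed [x]. [L1_limit] supplies the
    integrability of [F], on which the meaning of its [bochner_int] depends. *)
Lemma bochner_int_lim (F : G -> A) (u : nat -> Cc G A) (c : nat -> \bar R) :
  (forall k, 0 <= c k)%E -> (\sum_(0 <= k <oo) c k < +oo)%E ->
  (forall k, L1norm mu ((u k.+1 : borel G -> A) \- u k)%R <= c k)%E ->
  {ae mu, forall y, u n y @[n --> \oo] --> F y} ->
  bochner_int mu (u n : borel G -> A) @[n --> \oo] --> bochner_int mu (F : borel G -> A).
Proof.
move=> c0 c1 uc uF; have [bF tF] := L1_limit S mu_haar c0 c1 uc uF.
have := @nneseries_tail_cvg R c xpredT c1 (fun k _ => c0 k).
have t0 n : (0 <= \sum_(n <= k <oo) c k)%E by apply: nneseries_ge0.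
move=> /(ecvg0P _ t0) h.
apply/rnorm_cvgP => e /h; apply: filterS => n; rewrite -lte_fin.
apply: le_lt_trans; apply: le_trans (tF n).
exact: bochner_int_dist bF (Cc_integrable S mu_haar (u n)).
Qed.

(* The null set where [phi n] does not converge to [g] is seen through
   [y |-> y^-1 * x], whence the appeal to [null_conv]. *)
Lemma tconv_limr f (g : G -> A) (phi : nat -> Cc G A) :
  {ae mu, forall x, phi n x @[n --> \oo] --> g x} ->
  (forall n, L1norm mu ((phi n.+1 : borel G -> A) \- phi n)%R <= (half_pow R n)%:E)%E ->
  {ae mu, forall x, tconv S mu f (phi n) x @[n --> \oo] --> tconv S mu f g x}.
Proof.
move=> phig hphi.
have fL : L1norm mu (f : borel G -> A) \is a fin_num.
  rewrite ge0_fin_numE ?L1norm_ge0//; exact: bochner_integrable_L1norm (Cc_integrable S mu_haar f).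
pose M := fine (L1norm mu (f : borel G -> A)).
have M0 : 0 <= M by rewrite fine_ge0// L1norm_ge0.
have /choice[q hq] : forall k, exists q : borel G -> \bar R,
  [/\ measurable_fun setT q, (forall x, 0 <= q x)%E,
    (forall x, \int[mu]_y (rnorm (f y) * rnorm ((phi k.+1 \- phi k) (y^-1 * x)%g))%:E <= q x)%E &
    (\int[mu]_x q x <= L1norm mu (f : borel G -> A) *
      L1norm mu ((phi k.+1 : borel G -> A) \- phi k)%R + (half_pow R k)%:E)%E].
  move=> k.
  apply: (@conv_bound R G mu mu_haar hG (fun y => rnorm (f y)) (fun y => rnorm ((phi k.+1 \- phi k) y))
    (supp f) (supp (phi k.+1) `|` supp (phi k))).
  - by apply: continuous_rnorm; exact: Cc_continuous.
  - by apply: continuous_rnorm; apply: continuousB; exact: Cc_continuous.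
  - by move=> y; exact: rnorm_ge0.
  - by move=> y; exact: rnorm_ge0.
  - exact: Cc_compact.
  - by apply: compactU; exact: Cc_compact.
  - by move=> y /supp0 ->; rewrite rnorm0.
  - by move=> y /Cc_sub_out ->; rewrite rnorm0.
  - exact: half_pow_gt0.
have sq : {ae mu, forall x, (\sum_(0 <= k <oo) q k x < +oo)%E}.
  (* [M] times the increment of [phi], plus the slack [half_pow R k] left by [conv_bound]. *)
  apply: (summable_ae (c := fun k => ((M + 1) / (2 ^ k.+1)%:R)%:E)).
  - by move=> k; have [] := hq k.
  - by move=> k; have [] := hq k.
  - move=> k; have [_ _ _ /le_trans] := hq k; apply.
    have -> : (M + 1) / (2 ^ k.+1)%:R = M * half_pow R k + half_pow R k.
      by rewrite /half_pow mulrDl mulrA mulr1.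
    rewrite [X in (X * _ + _ <= _)%E](_ : _ = M%:E); last by rewrite /M fineK.
    rewrite EFinD [(M * _)%:E]EFinM; apply: leeD => //; apply: lee_wpmul2l; first by rewrite lee_fin.
    exact: hphi.
  - by apply: (@le_lt_trans _ _ (M + 1)%:E); [apply: epsilon_trick0; rewrite addr_ge0|exact: ltry].
case: phig => N [mN N0 hN].
apply: filterS sq => x qx.
(* Where the series of the [q k x] converges, its terms bound the L1 increments of the integrands
   [kern S f (phi n) x]. *)
apply: (@bochner_int_lim (kern S f g x) (fun n => kern_Cc f (phi n) x) (fun k => q k x)) => //.
- by move=> k; have [] := hq k.
- move=> k; have [_ _ /(_ x) + _] := hq k; apply: le_trans.
  apply: le_lower_integral => y; first by rewrite lee_fin rnorm_ge0.
  by rewrite lee_fin /= kernBr rnorm_kern.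
- apply: negligibleS (null_conv mu_haar hG (tw_locally_compact S) x mN N0 (@Cc_compact _ _ _ f)).
  move=> y /= hy; apply: contrapT => h; apply: hy.
  have [fy|/supp0 fy] := pselect (supp f y); last first.
    by rewrite kern_out//; under eq_fun do rewrite kern_out//; exact: cvg_cst.
  have : phi n (y^-1 * x)%g @[n --> \oo] --> g (y^-1 * x)%g.
    by apply: contrapT => hc; apply: h; split=> //; exact: hN.
  move=> /rnorm_cvgP hc; apply/rnorm_cvgP => e e0.
  have f1 : 0 < rnorm (f y) + 1 by rewrite ltr_wpDl ?rnorm_ge0.
  have := hc _ (divr_gt0 e0 f1); apply: filterS => n; rewrite ltr_pdivlMr// => hn.
  rewrite kernBr (le_lt_trans (rnorm_kern _ _ _ _ _))// (le_lt_trans _ hn)// mulrC.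
  by rewrite ler_wpM2l ?rnorm_ge0// lerDl.
Qed.

(** Here the approximated factor [g] is evaluated at [y] itself and the other factor is bounded by
    [M], so the increments of the integrands are summable for every [x], and the exceptional null
    set is the one of [phi]. *)
Lemma tconv_liml f (g : G -> A) (phi : nat -> Cc G A) :
  {ae mu, forall x, phi n x @[n --> \oo] --> g x} ->
  (forall n, L1norm mu ((phi n.+1 : borel G -> A) \- phi n)%R <= (half_pow R n)%:E)%E ->
  forall x, tconv S mu (phi n) f x @[n --> \oo] --> tconv S mu g f x.
Proof.
move=> phig hphi x.
have [M M0 hM] := csupp_bounded (continuous_rnorm (@Cc_continuous _ _ _ f))
  (@Cc_compact _ _ _ f) (fun y hy => etrans (congr1 (@rnorm R A) (supp0 hy)) (rnorm0 A)).
have fM y : rnorm (f y) <= M by rewrite (le_trans _ (hM y))// ler_norm.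
apply: (@bochner_int_lim (kern S g f x) (fun n => kern_Cc (phi n) f x)
  (fun k => (M / (2 ^ k.+1)%:R)%:E)).
- by move=> k; rewrite lee_fin divr_ge0.
- by apply: (@le_lt_trans _ _ M%:E); [exact: epsilon_trick0|exact: ltry].
- move=> k.
  have -> : M / (2 ^ k.+1)%:R = M * half_pow R k by rewrite /half_pow mulrA mulr1.
  have ck : continuous (fun y => rnorm ((phi k.+1 \- phi k) y)).
    by apply: continuous_rnorm; apply: continuousB; exact: Cc_continuous.
  apply: (@le_trans _ _ (\int[mu]_y (M%:E * (rnorm ((phi k.+1 \- phi k) y))%:E))%E).
    apply: le_lower_integral => y; first by rewrite lee_fin rnorm_ge0.
    rewrite -EFinM lee_fin /= kernBl (le_trans (rnorm_kern _ _ _ _ _))// mulrC.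
    by rewrite ler_wpM2r ?rnorm_ge0.
  rewrite ge0_integralZl_EFin//; last 2 first.
  - by move=> y _; rewrite lee_fin rnorm_ge0.
  - exact: borel_econtinuous.
  rewrite [(M * _)%:E]EFinM; apply: lee_wpmul2l; first by rewrite lee_fin.
  exact: hphi.
- apply: (@filterS _ _ (ae_filter_ringOfSetsType mu) _ _ _ phig) => y /rnorm_cvgP hc.
  apply/rnorm_cvgP => e e0; have M1 : 0 < M + 1 by rewrite ltr_wpDl.
  have := hc _ (divr_gt0 e0 M1); apply: filterS => n; rewrite ltr_pdivlMr// => hn.
  rewrite kernBl (le_lt_trans (rnorm_kern _ _ _ _ _))// (le_lt_trans _ hn)//.
  by rewrite ler_wpM2l ?rnorm_ge0// (le_trans (fM _))// lerDl.
Qed.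

(* [T] is the twisted convolution with [g], and [Tn n] that with the
   approximation [phi n] of [g]. *)
Lemma L1norm_approx_identity (g T : G -> A) (phi Tn : nat -> Cc G A) :
  {ae mu, forall x, phi n x @[n --> \oo] --> g x} ->
  (forall n, L1norm mu ((phi n.+1 : borel G -> A) \- phi n)%R <= (half_pow R n)%:E)%E ->
  {ae mu, forall x, Tn n x @[n --> \oo] --> T x} ->
  (forall m n, L1norm mu ((Tn m : borel G -> A) \- Tn n)%R <=
     L1norm mu ((phi m : borel G -> A) \- phi n)%R)%E ->
  bochner_integrable mu (T : borel G -> A) /\
  forall n, (L1norm mu ((T : borel G -> A) \- g)%R <=
    L1norm mu ((Tn n : borel G -> A) \- phi n)%R +
    (\sum_(n <= k <oo) (half_pow R k)%:E + \sum_(n <= k <oo) (half_pow R k)%:E))%E.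
Proof.
move=> phig hphi TnT hT.
have c0 k : (0 <= (half_pow R k)%:E :> \bar R)%E by rewrite lee_fin ltW// half_pow_gt0.
have [bg tg] := L1_limit S mu_haar c0 (sum_half_pow R) hphi phig.
have [bT tT] := L1_limit S mu_haar c0 (sum_half_pow R)
  (fun k => le_trans (hT k.+1 k) (hphi k)) TnT.
have sC (u : Cc G A) : smeasurable mu (u : borel G -> A).
  by apply: bochner_integrable_smeasurable; exact: (Cc_integrable S mu_haar).
have sT := bochner_integrable_smeasurable bT.
have sg := bochner_integrable_smeasurable bg.
split=> // n.
have h1 := L1norm_dist (sC (Tn n)) sT sg.
have h2 := L1norm_dist (sC (phi n)) (sC (Tn n)) sg.
have h3 := tg n; rewrite L1normC in h3.
by rewrite addeCA; exact: le_trans h1 (leeD (tT n) (le_trans h2 (leeD (lexx _) h3))).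
Qed.

Lemma tails_filter (I : netIndex) : ProperFilter (tails I).
Proof.
have [i0] := net_inhabited I.
apply: filter_from_proper; last by move=> i _; exists i; exact: net_le_refl.
apply: filter_from_filter; first by exists i0.
move=> i j _ _; have [k [ik jk]] := net_directed i j.
by exists k => // l /= kl; split; exact: net_le_trans kl.
Qed.

(** Compact supports make the supremum one of a bounded set, and off [K] both functions vanish; for
    empty [K] the supremum is 0 by convention. *)
Lemma le_normK (K : set G) (h k : Cc G A) x : CK K h -> CK K k ->
  rnorm (h x - k x) <= normK K (h \- k).
Proof.
move=> Kh Kk.
have [M M0 hM] := csupp_bounded
  (continuous_rnorm (continuousB (@Cc_continuous _ _ _ h) (@Cc_continuous _ _ _ k)))
  (@compactU _ _ _ (@Cc_compact _ _ _ h) (@Cc_compact _ _ _ k))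
  (fun y hy => etrans (congr1 (@rnorm R A) (Cc_sub_out hy)) (rnorm0 A)).
have ub : has_ubound [set rnorm ((h \- k) x) | x in K].
  by exists M => _ [y _ <-]; rewrite (le_trans _ (hM y))// ler_norm.
have [Kx|nKx] := pselect (K x); first by apply: ub_le_sup => //; exists x.
have h0 : h x = 0 by apply: (@supp0 _ _ _ h) => /Kh.
have k0 : k x = 0 by apply: (@supp0 _ _ _ k) => /Kk.
rewrite h0 k0 subr0 rnorm0; have [K0|/set0P[y Ky]] := eqVneq K set0.
  by rewrite /normK K0 image_set0 sup0.
by apply: (le_trans (rnorm_ge0 ((h \- k) y))); apply: ub_le_sup => //; exists y.
Qed.

(** The L1 ball around [g] is open in the inductive limit topology: on [CK K] the L1 distance is at
    most [mu K] times the distance in [normK K]. *)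
Lemma cvg_Cc_L1norm (I : netIndex) (u : I -> G -> A) (g : Cc G A) : cvg_Cc u g ->
  forall e : R, 0 < e ->
  \forall i \near tails I, (L1norm mu ((u i : borel G -> A) \- g)%R < e%:E)%E.
Proof.
move=> [h hu hg] e e0; have FF := tails_filter I.
have sC (k : Cc G A) : smeasurable mu (k : borel G -> A).
  by apply: bochner_integrable_smeasurable; exact: (Cc_integrable S mu_haar).
pose U : set (Cc G A) := [set k | (L1norm mu ((k : borel G -> A) \- g)%R < e%:E)%E].
have oU : open U.
  move=> K cK f Kf Uf.
  have ffin : L1norm mu ((f : borel G -> A) \- g)%R \is a fin_num.
    by rewrite ge0_fin_numE ?L1norm_ge0// (lt_trans Uf)// ltry.
  pose d := e - fine (L1norm mu ((f : borel G -> A) \- g)%R).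
  have d0 : 0 < d by rewrite subr_gt0 -lte_fin fineK.
  have m0 : 0 <= fine (mu K) by exact: fine_ge0.
  have m1 : 0 < fine (mu K) + 1 by rewrite ltr_wpDl.
  exists (d / (fine (mu K) + 1)); first by rewrite divr_gt0.
  move=> k Kk hk; rewrite /U /=.
  apply: (le_lt_trans (L1norm_dist (sC f) (sC k) (sC g))).
  have -> : e = d + fine (L1norm mu ((f : borel G -> A) \- g)%R) by rewrite subrK.
  rewrite EFinD fineK// lteD2rE//.
  apply: (@le_lt_trans _ _ (normK K (k \- f) * fine (mu K))%:E).
    apply: (integral_le_compact hG mu_compact cK).
    - by move=> x; exact: rnorm_ge0.
    - move=> x Kx /=; have -> : k x = 0 by apply: (@supp0 _ _ _ k) => /Kk.
      have -> : f x = 0 by apply: (@supp0 _ _ _ f) => /Kf.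
      by rewrite subr0 rnorm0.
    - by move=> x; exact: le_normK.
  rewrite lte_fin; apply: (@le_lt_trans _ _ (d / (fine (mu K) + 1) * fine (mu K))).
    by rewrite ler_wpM2r// ltW.
  by rewrite mulrAC ltr_pdivrMr// ltr_pM2l// ltrDl.
have gU : U g.
  rewrite /U /= /L1norm integral0_eq ?lte_fin// => x _.
  by rewrite /= subrr rnorm0.
have hU : tails I [set i | U (h i)] := hg U (open_nbhs_nbhs (conj oU gU)).
apply: filterS hU => i; rewrite /U /=.
by have -> : (h i : G -> A) = u i by apply/funext; exact: hu.
Qed.

Lemma cai_Cc_cai_L1 (I : netIndex) (f : I -> Cc G A) : is_cai_Cc S mu f ->
  is_cai_L1 S mu (fun i => f i : G -> A).
Proof.
move=> [f1 fg]; split; first by move=> i; exact: (Cc_integrable S mu_haar).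
split=> // g bg; have [phi [phig hphi]] := Cc_approx S mu_haar bg.
have FF := tails_filter I.
have tail (e : R) : 0 < e -> exists n,
    (\sum_(n <= k <oo) (half_pow R k)%:E + \sum_(n <= k <oo) (half_pow R k)%:E < e%:E)%E.
  move=> e0; have c0 k : (0 <= (half_pow R k)%:E :> \bar R)%E by rewrite lee_fin ltW// half_pow_gt0.
  have := @nneseries_tail_cvg R _ xpredT (sum_half_pow R) (fun k _ => c0 k).
  move=> /(ecvg0P _ (fun n => nneseries_ge0 (fun k _ _ => c0 k)))/(_ (e / 2)).
  rewrite divr_gt0// => /(_ isT)/filter_ex[n hn]; exists n.
  by rewrite (splitr e) EFinD lteD.
(* Serves both sides. The tails do not depend on [i], so [n] is fixed first; the inductive limit
   topology is then used for the single function [phi n]. *)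
have conclude (T : I -> G -> A) (Tn : I -> nat -> Cc G A) :
    (forall i, {ae mu, forall x, Tn i n x @[n --> \oo] --> T i x}) ->
    (forall i m n, L1norm mu ((Tn i m : borel G -> A) \- Tn i n)%R <=
       L1norm mu ((phi m : borel G -> A) \- phi n)%R)%E ->
    (forall n, cvg_Cc (fun i => Tn i n : G -> A) (phi n)) -> cvg_L1 mu T g.
  move=> TnT hT cT; split.
    by move=> i; have [] := L1norm_approx_identity phig hphi (TnT i) (hT i).
  apply/ecvg0P => [i|e e0]; first exact: L1norm_ge0.
  have e2 : 0 < e / 2 by rewrite divr_gt0.
  have [n hn] := tail _ e2.
  apply: filterS (cvg_Cc_L1norm (cT n) e2) => i hi.
  have [_ /(_ n) /le_lt_trans] := L1norm_approx_identity phig hphi (TnT i) (hT i).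
  by apply; rewrite [in ltRHS](splitr e) EFinD lteD.
split.
- apply: (conclude _ (fun i n => tconv_Cc S mu_haar (f i) (phi n))).
  + by move=> i; exact: tconv_limr.
  + move=> i m n; apply: (le_trans (tconv_distr S mu_haar (f i) (phi m) (phi n))).
    (* [f i] has L1 norm at most 1, so Young's inequality makes convolution with it a
       contraction. *)
    by rewrite -[leRHS]mul1e lee_wpmul2r// ?L1norm_ge0.
  + by move=> n; exact: (fg (phi n)).1.
- apply: (conclude _ (fun i n => tconv_Cc S mu_haar (phi n) (f i))).
  + by move=> i; apply: aeW => x; exact: tconv_liml.
  + move=> i m n; apply: (le_trans (tconv_distl S mu_haar (phi m) (phi n) (f i))).
    by rewrite -[leRHS]mule1 lee_wpmul2l// ?L1norm_ge0.
  + by move=> n; exact: (fg (phi n)).2.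
Qed.

End TwistedConvolutionL1.

(** * Existence *)

Section InductiveLimit.
Context (R : realType) (G : topologicalGroupType) (A : banachAlgType R[i]).

(** Once a single compact [K] carries the whole net, an open set is tested on [CK K] alone, where
    its trace contains a ball for the sup norm. *)
Lemma cvg_Cc_unif (I : Type) (F : set_system I) (FF : Filter F) (K : set G)
    (h : I -> Cc G A) (g : Cc G A) : compact K -> (forall i, CK K (h i)) -> CK K g ->
  (forall e : R, 0 < e -> \forall i \near F, forall x, rnorm (h i x - g x) <= e) ->
  h i @[i --> F] --> g.
Proof.
move=> cK Kh Kg hg U; rewrite nbhsE => -[B [oB Bg] BU].
have [e e0 he] := oB K cK g Kg Bg; have e2 : 0 < e / 2 by rewrite divr_gt0.
apply: filterS (hg _ e2) => i hi; apply/BU/he => //.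
have e2e : e / 2 < e by lra.
apply: le_lt_trans e2e; rewrite /normK; have [->|K0] := eqVneq K set0.
  by rewrite image_set0 sup0 ltW.
apply: ge_sup; first by move/set0P: K0 => [x Kx]; exists (rnorm ((h i \- g) x)), x.
by move=> _ [x _ <-]; exact: hi.
Qed.

(** Equicontinuity turns pointwise convergence into uniform convergence on compact sets. There are
    three terms of size [e / 4]: replacing [a y'] by [a y] inside [Phi i], the convergence at [a y],
    and the return to [a y']. *)
Lemma contraction_unif_compact (I : Type) (F : set_system I) (FF : Filter F)
    (Y : topologicalType) (K : set Y) (a : Y -> A) (Phi : I -> A -> A) :
  compact K -> continuous a ->
  (forall i b c, rnorm (Phi i b - Phi i c) <= rnorm (b - c)) ->
  (forall b, Phi i b @[i --> F] --> b) ->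
  forall e : R, 0 < e -> \forall i \near F, forall y, K y -> rnorm (Phi i (a y) - a y) < e.
Proof.
move=> /compact_near_coveringP cK ca cPhi Phib e e0.
apply: (cK I F (fun i y => rnorm (Phi i (a y) - a y) < e) FF) => y Ky.
have e4 : 0 < e / 4 by rewrite divr_gt0.
have := ca y => /rnorm_cvgP/(_ _ e4) h1.
have := Phib (a y) => /rnorm_cvgP/(_ _ e4) h2.
exists ([set y' | rnorm (a y - a y') < e / 4], [set i | rnorm (a y - Phi i (a y)) < e / 4]).
  by split.
move=> [y' i] /= [hy hi].
rewrite (le_lt_trans (ler_rnorm_dist (Phi i (a y)) _ _))//.
have := cPhi i (a y') (a y); rewrite [rnorm (a y' - a y)]rnormC => h3.
have := ler_rnorm_dist (a y) (Phi i (a y)) (a y').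
rewrite [rnorm (Phi i (a y) - a y)]rnormC; lra.
Qed.

End InductiveLimit.

Section NeighborhoodNet.
Context (G : topologicalGroupType) (J : netIndex).

Definition nbhs1 := {V : set G | nbhs 1%g V}.

Definition nbhs1_net : netIndex.
Proof.
refine (@NetIndex (nbhs1 * J)%type
  (fun i j => sval j.1 `<=` sval i.1 /\ net_le i.2 j.2) _ _ _ _).
- by move=> i; split=> //; exact: net_le_refl.
- move=> i j k [ij1 ij2] [jk1 jk2]; split; first exact: subset_trans jk1 ij1.
  exact: net_le_trans ij2 jk2.
- move=> [[V hV] i] [[W hW] j]; have [k [ik jk]] := net_directed i j.
  exists (exist _ (V `&` W) (filterI hV hW), k); split; split => //=;
    by move=> x [].
- have [j] := net_inhabited J; constructor.
  exact: (exist _ setT filterT, j).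
Defined.

Lemma near_nbhs1_net (V : set G) (P : J -> Prop) : nbhs 1%g V ->
  (\forall j \near tails J, P j) ->
  \forall i \near tails nbhs1_net, sval i.1 `<=` V /\ P i.2.
Proof.
move=> hV [j _ hj]; exists (exist _ V hV, j) => // i [/= iV ij].
by split=> //; exact: hj.
Qed.

End NeighborhoodNet.

Section Existence.
Context (R : realType) (G : topologicalGroupType) (A : banachAlgType R[i])
  (S : twistedSystem G A) (mu : {measure set (borel G) -> \bar R}).
Hypothesis mu_haar : left_haar mu.

Let hG : hausdorff_space G := tw_hausdorff S.
Let lG : locally_compact [set: G] := @tw_locally_compact _ _ _ S.
Let mu_compact (K : set G) : compact K -> (mu K < +oo)%E.
Proof. exact: haar_compact. Qed.

Lemma symmetric_bump (V : set G) : nbhs 1%g V -> exists (phi : G -> R) (L : set G),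
  [/\ continuous phi, (forall z, 0 <= phi z) /\ (forall z, phi z^-1%g = phi z),
      compact L /\ L `<=` V, (forall z, ~ L z -> phi z = 0) &
      (\int[mu]_z (phi z)%:E = 1)%E].
Proof.
(* [U] is symmetric, so the inverse of the support of [h] also lies in [V]. *)
move=> V1; pose U : set G := V^° `&` [set z | V^° z^-1%g].
have oV : open V^° by exact: open_interior.
have oU : open U.
  apply: openI => //; have /continuousP := @invg_continuous G; exact.
have U1 : U 1%g by split => //=; rewrite invg1.
have [h [L [ch h01 h1 [cL LU] hL]]] := @bump R G hG lG [set 1%g] U
  (@compact_set1 _ _) oU (fun z (hz : z = 1%g) => ltac:(by rewrite hz)).
have h0 z : 0 <= h z by have /andP[] := h01 z.
pose L' := L `|` [set z^-1%g | z in L].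
have cL' : compact L' by apply: compactU => //; exact: compact_image_invg.
pose psi z := h z + h z^-1%g.
have psi0 z : 0 <= psi z by rewrite addr_ge0.
have cpsi : continuous psi.
  move=> z; apply: (@cvgD _ R^o); first exact: ch.
  by apply: (@cvg_comp _ _ _ (fun z : G => z^-1)%g h); [exact: invg_continuous|exact: ch].
have psiL z : ~ L' z -> psi z = 0.
  move=> /not_orP[Lz Lz']; rewrite /psi hL// hL ?addr0// => Lz''.
  by apply: Lz'; exists z^-1%g => //; rewrite invgK.
have pfin : (\int[mu]_z (psi z)%:E)%E \is a fin_num.
  rewrite ge0_fin_numE; first exact: csupp_integral_fin hG mu_compact _ _ cpsi cL' psi0 psiL.
  by apply: integral_ge0 => x _; rewrite lee_fin.
(* [psi] is at least [h], which exceeds 1/2 on an open set around 1, of positive measure; hence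
   [psi] can be normalised. *)
have ppos : (0 < \int[mu]_z (psi z)%:E)%E.
  pose O := [set z | 1 / 2 < h z].
  have oO : open O.
    have /continuousP := ch => /(_ [set r | 1 / 2 < r]); apply; exact: open_gt.
  have O1 : O 1%g by rewrite /O /= h1//; lra.
  have mO : measurable (O : set (borel G)) by exact: borel_open.
  have := haar_open_gt0 mu_haar hG oO O1 => mO0.
  apply: (@lt_le_trans _ _ (\int[mu]_z ((1 / 2)%:E * (\1_O z)%:E))%E).
    rewrite ge0_integralZl_EFin//; [|exact/measurable_EFinP/measurable_indic].
    by rewrite integral_indic// setIT mule_gt0// lte_fin; lra.
  apply: le_lower_integral => z; first by rewrite -EFinM lee_fin mulr_ge0//; lra.
  rewrite -EFinM lee_fin indicE; have [Oz|Oz] := pselect (O z); last by rewrite memNset// mulr0.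
  by rewrite mem_set// mulr1 /psi; have := h0 z^-1%g; move: Oz; rewrite /O /=; lra.
pose p := fine (\int[mu]_z (psi z)%:E)%E.
have p0 : 0 < p by rewrite fine_gt0// ppos /= -ge0_fin_numE// ltW.
exists (fun z => p^-1 * psi z), L'; split.
- by move=> z; apply: (@cvgM R G); [exact: cvg_cst|exact: cpsi].
- split=> z; first by rewrite mulr_ge0// invr_ge0 ltW.
  by rewrite /psi invgK addrC.
- split => // z [Lz|[w Lw <-]].
    by have [Vz _] := LU _ Lz; exact: (@interior_subset G V _ Vz).
  by have [_ Vw] := LU _ Lw; exact: (@interior_subset G V _ Vw).
- by move=> z /psiL ->; rewrite mulr0.
- under eq_integral do rewrite EFinM.
  rewrite ge0_integralZl_EFin//; [|by move=> x _; rewrite lee_fin|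
    exact: borel_econtinuous|by rewrite invr_ge0 ltW].
  by rewrite -(fineK pfin) -EFinM mulVf// gt_eqF.
Qed.

Lemma cai_Cc_exists : exists (I : netIndex) (f : I -> Cc G A), is_cai_Cc S mu f.
Proof.
have [J [ee [ee1 eeA]]] := tw_cai S.
have JF := tails_filter J.
have e1 j : rnorm (ee j) <= 1.
  by have := ee1 j; rewrite rnormE -[1 in X in X -> _]/(1%:C)%C lecR.
(* Confining all bumps to one compact [W] gives the whole net of convolutions a common compact
   support, as [cvg_Cc_unif] requires. *)
have [W W1 [cW clW]] := @lG 1%g I; move: W1; rewrite withinET => W1.
have /choice[phi hphi] : forall V : nbhs1 G, exists phi : G -> R, exists L : set G,
  [/\ continuous phi, (forall z, 0 <= phi z) /\ (forall z, phi z^-1%g = phi z),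
      compact L /\ L `<=` sval V `&` W, (forall z, ~ L z -> phi z = 0) &
      (\int[mu]_z (phi z)%:E = 1)%E].
  by move=> [V hV]; apply: symmetric_bump; exact: filterI.
have cphi V : continuous (phi V) by have [L []] := hphi V.
have phi0 V z : 0 <= phi V z by have [L [_ [+ _] _ _ _]] := hphi V; exact.
have phiV V z : phi V z^-1%g = phi V z by have [L [_ [_ +] _ _ _]] := hphi V; exact.
have phi1 V : (\int[mu]_z (phi V z)%:E = 1)%E by have [L []] := hphi V.
have phiW V z : ~ (sval V z /\ W z) -> phi V z = 0.
  move=> h; have [L [_ _ [_ LV] + _]] := hphi V; apply => /LV; exact: h.
have phiW' V z : ~ W z -> phi V z = 0 by move=> Wz; apply: phiW => -[].
pose I := nbhs1_net G J.
have IF := tails_filter I.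
have /choice[f hf] : forall i : I, exists f : Cc G A, f =1 (fun z => (phi i.1 z)%:C%C *: ee i.2).
  move=> i; apply: (mkCc S (K := W)) => //; first exact: continuous_scaleV.
  by move=> z /phiW' ->; rewrite scale0r.
have supf i : supp (f i) `<=` W.
  apply: (closure_suppP hG cW _).1 => z Wz; by rewrite hf phiW'// scale0r.
(* Writing [g x] as an average against [phi V] turns its distance to the convolution into a distance
   of two integrals, to be estimated pointwise. *)
have ints V v : bochner_int mu (fun z : borel G => (phi V z)%:C%C *: v) = v.
  rewrite (bochner_int_scale hG mu_compact v (cphi V) (phi0 V) cW (phiW' V)) phi1.
  by rewrite scale1r.
exists I, f; split.
  move=> i; rewrite -(phi1 i.1); apply: le_lower_integral => z.
    by rewrite lee_fin rnorm_ge0.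
  by rewrite lee_fin hf rnormZr ger0_norm// ler_piMr.
move=> g; have cg := @Cc_continuous _ _ _ g; have cKg := @Cc_compact _ _ _ g.
have W11 : W 1%g by exact: nbhs_singleton.
split.
- pose K := [set (y * z)%g | y in W & z in supp g].
  have cK : compact K by exact: compact_image_mulg.
  have gK : CK K g by move=> z gz; exists 1%g => //; exists z => //; rewrite mul1g.
  have fK i : CK K (tconv_Cc S mu_haar (f i) g).
    apply: subset_trans (tconv_supp S mu_haar (f i) g).1 _.
    by move=> _ [y /supf Wy [z gz <-]]; exists y => //; exists z.
  exists (fun i => tconv_Cc S mu_haar (f i) g) => //.
  apply: (@cvg_Cc_unif R G A I (tails I) _ K (fun i => tconv_Cc S mu_haar (f i) g) g cK fK gK) => e e0.
  have e2 : 0 < e / 2 by rewrite divr_gt0.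
  (* The integrand is [phi i.1 y] times [ee i.2 ** b y x], since right multiplication by [sigma]
     commutes with left multiplication by [ee i.2]. *)
  pose b (y x : G) := mulR (sigma S y (y^-1 * x)%g) (alpha S y (g (y^-1 * x)%g)).
  have b1 x : b 1%g x = g x.
    by rewrite /b invg1 mul1g alpha1 sigma1x.
  have cb : continuous (fun p : G * G => b p.1 p.2).
    move=> [y x]; have cd : (p.1^-1 * p.2)%g @[p --> (y, x)] --> (y^-1 * x)%g.
      by apply: cvg_mulg; [apply: cvg_invg; exact: cvg_fst|exact: cvg_snd].
    apply: cvg_sigmaR => //; first exact: cvg_fst.
    apply: cvg_alpha; first exact: cvg_fst.
    by apply: (@cvg_comp _ _ _ (fun p : G * G => p.1^-1 * p.2)%g g); [exact: cd|exact: cg].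
  have nV : \forall y \near (1%g : G), forall x, K x -> rnorm (b y x - g x) < e / 2.
    apply: (@compact_near_lt R G G K (fun y x => rnorm (b y x - g x)) 1%g (e / 2)) => //.
    - move=> x _; apply: (@cvg_comp _ _ _ (fun p : G * G => b p.1 p.2 - g p.2) (@rnorm R A));
        last exact: rnorm_continuous.
      apply: cvgB; first exact: (cb (1%g, x)).
      by apply: (@cvg_comp _ _ _ (fun p : G * G => p.2) g); [exact: cvg_snd|exact: cg].
    - by move=> x _; rewrite b1 subrr rnorm0.
  have nJ : \forall j \near tails J, forall x, K x -> rnorm (ee j ** g x - g x) < e / 2.
    apply: (@contraction_unif_compact R A J (tails J) _ G K g (fun j a => ee j ** a)) => //.
    - move=> j c d; rewrite -bmulBr (le_trans (rnorm_bmul _ _))//.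
      by rewrite ler_piMl ?rnorm_ge0.
    - by move=> c; have [] := eeA c.
  apply: filterS (near_nbhs1_net nV nJ) => i [iV ij] x.
  have [Kx|nKx] := pselect (K x); last first.
    have -> : g x = 0 by apply: (@supp0 _ _ _ g) => /gK.
    have -> : tconv_Cc S mu_haar (f i) g x = 0.
      apply: tconv_out => // -[y /supf Wy [z gz yz]].
      by apply: nKx; exists y => //; exists z.
    by rewrite subr0 rnorm0 ltW.
  have bi : bochner_integrable mu (fun z : borel G => (phi i.1 z)%:C%C *: g x).
    apply: (csupp_integrable hG mu_compact (K := W)) => //; first exact: continuous_scaleV.
    by move=> z /phiW' ->; rewrite scale0r.
  have := bochner_int_dist (kern_integrable S mu_haar (f i) g x) bi.
  rewrite ints -lee_fin => /le_trans; apply.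
  apply: (@le_trans _ _ (\int[mu]_y (e%:E * (phi i.1 y)%:E))%E); last first.
    rewrite ge0_integralZl_EFin//; [by rewrite phi1 mule1|
      by move=> z _; rewrite lee_fin|exact: borel_econtinuous|exact: ltW].
  apply: le_lower_integral => y; first by rewrite lee_fin rnorm_ge0.
  rewrite -EFinM lee_fin /=.
  have -> : kern S (f i) g x y = (phi i.1 y)%:C%C *: (ee i.2 ** b y x).
    by rewrite /kern hf bmulZl mulRZ /b mulRM.
  rewrite -scalerBr rnormZr ger0_norm// mulrC.
  have [[Vy Wy]|nVW] := pselect (sval i.1 y /\ W y); last by rewrite phiW// !mulr0.
  rewrite ler_wpM2r//.
  rewrite (le_trans (ler_rnorm_dist (ee i.2 ** g x) _ _))// [leRHS]splitr lerD//; last exact/ltW/ij.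
  rewrite -bmulBr (le_trans (rnorm_bmul _ _))//.
  rewrite (le_trans (ler_wpM2r (rnorm_ge0 _) (e1 _)))// mul1r.
  by apply/ltW; exact: iV.
- pose K := [set (y * z)%g | y in supp g & z in W].
  have cK : compact K by exact: compact_image_mulg.
  have gK : CK K g by move=> z gz; exists z => //; exists 1%g => //; rewrite mulg1.
  have fK i : CK K (tconv_Cc S mu_haar g (f i)).
    apply: subset_trans (tconv_supp S mu_haar g (f i)).1 _.
    by move=> _ [y gy [z /supf Wz <-]]; exists y => //; exists z.
  exists (fun i => tconv_Cc S mu_haar g (f i)) => //.
  apply: (@cvg_Cc_unif R G A I (tails I) _ K (fun i => tconv_Cc S mu_haar g (f i)) g cK fK gK) => e e0.
  have e4 : 0 < e / 4 by rewrite divr_gt0.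
  (* The effect of the cocycle in the variable [z = y^-1 x], that is [y = x z^-1]; at [z = 1] it is
     that of [sigma S x 1], the unit. *)
  pose c (z x : G) := mulR (sigma S (x * z^-1)%g z) (g x).
  have c1 x : c 1%g x = g x by rewrite /c sigmax1.
  have cd (x : G) : (p.2 * p.1^-1)%g @[p --> ((1%g : G), x)] --> x.
    rewrite -[X in _ --> X]mulg1 -[in X in _ --> X]invg1.
    by apply: cvg_mulg; [exact: cvg_snd|apply: cvg_invg; exact: cvg_fst].
  have nV1 : \forall z \near (1%g : G), forall x, K x -> rnorm (c z x - g x) < e / 4.
    apply: (@compact_near_lt R G G K (fun z x => rnorm (c z x - g x)) 1%g (e / 4)) => //.
    - move=> x _; apply: (@cvg_comp _ _ _ (fun p : G * G => c p.1 p.2 - g p.2) (@rnorm R A));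
        last exact: rnorm_continuous.
      have c2 : g p.2 @[p --> ((1%g : G), x)] --> g x.
        by apply: (@cvg_comp _ _ _ (fun p : G * G => p.2) g); [exact: cvg_snd|exact: cg].
      apply: cvgB => //; rewrite /c /= invg1 mulg1.
      by apply: cvg_sigmaR; [exact: cd|exact: cvg_fst|exact: c2].
    - by move=> x _; rewrite c1 subrr rnorm0.
  have nV2 : \forall z \near (1%g : G), forall x, K x -> rnorm (g (x * z^-1)%g - g x) < e / 4.
    apply: (@compact_near_lt R G G K (fun z x => rnorm (g (x * z^-1)%g - g x)) 1%g (e / 4)) => //.
    - move=> x _; apply: (@cvg_comp _ _ _ (fun p : G * G => g (p.2 * p.1^-1)%g - g p.2) (@rnorm R A));
        last exact: rnorm_continuous.
      have c2 : g p.2 @[p --> ((1%g : G), x)] --> g x.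
        by apply: (@cvg_comp _ _ _ (fun p : G * G => p.2) g); [exact: cvg_snd|exact: cg].
      apply: cvgB => //; rewrite /= invg1 mulg1.
      by apply: (@cvg_comp _ _ _ (fun p : G * G => p.2 * p.1^-1)%g g); [exact: cd|exact: cg].
    - by move=> x _; rewrite invg1 mulg1 subrr rnorm0.
  (* Contains every [y = x z^-1] with [x] in [K] and [z] in [W]. *)
  pose K2 := [set (y * z)%g | y in K & z in [set z^-1%g | z in W]].
  have cK2 : compact K2 by apply: compact_image_mulg => //; exact: compact_image_invg.
  (* The product of [g x] with [alpha_y e_j] is the image under the isometry [alpha_y] of
     [alpha_y^-1 (g x) ** e_j], whence the estimate on these elements, uniformly in [y] and [x]. *)
  have nJ : \forall j \near tails J, forall p : G * G, (K2 `*` K) p ->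
      rnorm (aut_inv (alpha S p.1) (g p.2) ** ee j - aut_inv (alpha S p.1) (g p.2)) < e / 4.
    apply: (@contraction_unif_compact R A J (tails J) _ (G * G)%type (K2 `*` K)
      (fun p => aut_inv (alpha S p.1) (g p.2)) (fun j a => a ** ee j)) => //.
    - exact: compact_setX.
    - move=> [y x]; apply: cvg_alpha_inv; first exact: cvg_fst.
      by apply: (@cvg_comp _ _ _ (fun p : G * G => p.2) g); [exact: cvg_snd|exact: cg].
    - move=> j a d; rewrite -bmulBl (le_trans (rnorm_bmul _ _))//.
      by rewrite ler_piMr ?rnorm_ge0.
    - by move=> a; have [] := eeA a.
  apply: filterS (near_nbhs1_net (filterI nV1 nV2) nJ) => i [iV ij] x.
  have [Kx|nKx] := pselect (K x); last first.
    have -> : g x = 0 by apply: (@supp0 _ _ _ g) => /gK.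
    have -> : tconv_Cc S mu_haar g (f i) x = 0.
      apply: tconv_out => // -[y gy [z /supf Wz yz]].
      by apply: nKx; exists y => //; exists z.
    by rewrite subr0 rnorm0 ltW.
  pose ps (y : G) := phi i.1 (y^-1 * x)%g.
  have ps0 y : 0 <= ps y by exact: phi0.
  have cps : continuous ps.
    by move=> y; apply: (@cvg_comp _ _ _ (fun y => y^-1 * x)%g (phi i.1)); [exact: divgl_continuous|exact: cphi].
  pose L := [set (y * z)%g | y in [set x] & z in [set z^-1%g | z in W]].
  have cL : compact L.
    by apply: compact_image_mulg; [exact: compact_set1|exact: compact_image_invg].
  have psL y : ~ L y -> ps y = 0.
    move=> nLy; apply: phiW' => Wy; apply: nLy; exists x => //.
    exists (x^-1 * y)%g; last by rewrite mulVKg.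
    by exists (y^-1 * x)%g => //; rewrite invgM invgK.
  have ps1 : (\int[mu]_y (ps y)%:E = 1)%E.
    rewrite -(haar_integral mu_haar x cps)// -(phi1 i.1); apply: eq_integral => z _.
    by rewrite /ps invgM mulgVK phiV.
  have intg : bochner_int mu (fun y : borel G => (ps y)%:C%C *: g x) = g x.
    by rewrite (bochner_int_scale hG mu_compact (g x) cps ps0 cL psL) ps1 scale1r.
  have bi : bochner_integrable mu (fun z : borel G => (ps z)%:C%C *: g x).
    apply: (csupp_integrable hG mu_compact (K := L)) => //; first exact: continuous_scaleV.
    by move=> z /psL ->; rewrite scale0r.
  have := bochner_int_dist (kern_integrable S mu_haar g (f i) x) bi.
  rewrite intg -lee_fin => /le_trans; apply.
  apply: (@le_trans _ _ (\int[mu]_y (e%:E * (ps y)%:E))%E); last first.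
    rewrite ge0_integralZl_EFin//; [by rewrite ps1 mule1|
      by move=> z _; rewrite lee_fin|exact: borel_econtinuous|exact: ltW].
  apply: le_lower_integral => y; first by rewrite lee_fin rnorm_ge0.
  rewrite -EFinM lee_fin /=.
  have -> : kern S g (f i) x y =
      (ps y)%:C%C *: mulR (sigma S y (y^-1 * x)%g) (g y ** alpha S y (ee i.2)).
    by rewrite /kern hf autZ bmulZr mulRZ.
  rewrite -scalerBr rnormZr ger0_norm// mulrC.
  have [[Vy Wy]|nVW] := pselect (sval i.1 (y^-1 * x)%g /\ W (y^-1 * x)%g); last first.
    by rewrite /ps phiW// !mulr0.
  rewrite ler_wpM2r//.
  have yE : y = (x * (y^-1 * x)^-1)%g by rewrite invgM invgK mulVKg.
  have [/(_ x Kx) hc /(_ x Kx) hg] := iV _ Vy.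
  (* Three comparisons of size [e / 4] follow: [g y] with [g x], then removal of [alpha_y e_j], then
     removal of [sigma]. *)
  rewrite /c -yE in hc; rewrite -yE in hg.
  have h1 : rnorm (mulR (sigma S y (y^-1 * x)%g) (g y ** alpha S y (ee i.2)) -
      mulR (sigma S y (y^-1 * x)%g) (g x ** alpha S y (ee i.2))) <= e / 4.
    rewrite -mulRB (le_trans (rnorm_mulR _ _))// -bmulBl (le_trans (rnorm_bmul _ _))//.
    rewrite rnorm_aut (le_trans (ler_wpM2l (rnorm_ge0 _) (e1 _)))// mulr1.
    exact: ltW.
  have h2 : rnorm (mulR (sigma S y (y^-1 * x)%g) (g x ** alpha S y (ee i.2)) -
      mulR (sigma S y (y^-1 * x)%g) (g x)) <= e / 4.
    rewrite -mulRB (le_trans (rnorm_mulR _ _))//.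
    rewrite -{1 2}(aut_invK (alpha S y) (g x)) -autM -autB rnorm_aut; apply/ltW.
    apply: (ij (y, x)); split=> //=; exists x => //.
    exists (y^-1 * x)^-1%g => //; by exists (y^-1 * x)%g.
  have := ler_rnorm_dist (mulR (sigma S y (y^-1 * x)%g) (g x ** alpha S y (ee i.2)))
    (mulR (sigma S y (y^-1 * x)%g) (g y ** alpha S y (ee i.2))) (g x).
  have := ler_rnorm_dist (mulR (sigma S y (y^-1 * x)%g) (g x))
    (mulR (sigma S y (y^-1 * x)%g) (g x ** alpha S y (ee i.2))) (g x).
  move: hc h1 h2; lra.
Qed.

End Existence.

Theorem proposition3p6 (R : realType) (G : topologicalGroupType)
    (A : banachAlgType R[i]) (S : twistedSystem G A)
    (mu : {measure set (borel G) -> \bar R}) (mu_haar : left_haar mu) :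
  (exists (I : netIndex) (f : I -> Cc G A), is_cai_Cc S mu f) /\
  (forall (I : netIndex) (f : I -> Cc G A), is_cai_Cc S mu f ->
    is_cai_L1 S mu (fun i => f i : G -> A)).
Proof.
split; first exact: cai_Cc_exists mu_haar.
by move=> I f; exact: cai_Cc_cai_L1 mu_haar I f.
Qed.
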